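(* Let $N\ge2$ and let $b_i[N]$ ($1\le i\le N-1$) be the limiting waist ratios and $b_2[N]$ the limiting balancing constant defined in the context. (i) The limiting waist ratios are $b_i[N]=\dfrac{\sin(i\pi/N)}{\sin(\pi/N)}$ for $1\le i\le N-1$, so that the balancing constant is $b_2[N]=2\cos(\pi/N)$, the largest eigenvalue of the adjacency matrix $A(P_{N-1})$ of the path graph on $N-1$ vertices, and $\lambda_1(L(P_N))=2-b_2[N]$, where $\lambda_1(L(P_N))$ is the smallest nonzero eigenvalue of the combinatorial Laplacian of the path graph on $N$ vertices. (ii) For every stacked Clifford torus of type $(N,k,\ell,m)$ the total conductance $C_i$ of the tunnels joining two adjacent tori ($1\le i\le N-1$) is $$C_i=\frac{8\pi^2}{2-b_2[N]}\big(1+O(m^{-2})\big)=:C_N\big(1+O(m^{-2})\big),\qquad \frac{C_N}{2\pi^2}\,\lambda_1(L(P_N))=4,$$ and the lowest Rayleigh quotient $\mu(\widetilde A,C)$ of the weighted path graph model of the invariant sector equals $4+O(m^{-2})$; the constants in the error terms depend on $N$, $k$ and $\ell$, and the estimates hold uniformly for $m\ge m_0[N,k,\ell]$. (iii) As $N\to\infty$, $\lambda_1(L(P_N))=\pi^2N^{-2}+O(N^{-4})$ and $C_N=8N^2+O(1)$.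
   Context: Coordinates. $\mathbb S^3=\{(z_1,z_2)\in\mathbb C^2:|z_1|^2+|z_2|^2=1\}$ with the round metric; $\Phi(x,y,z):=(e^{i\sqrt2x}\sin(z+\tfrac\pi4),\,e^{i\sqrt2y}\cos(z+\tfrac\pi4))$ for $(x,y,z)\in\mathbb R^2\times(-\tfrac\pi4,\tfrac\pi4)$; horizontal coordinates $(x,y)$ are read in the flat torus $\mathbb T_{\rm fl}:=\mathbb R^2/(\sqrt2\pi\mathbb Z)^2$. Integers $N\ge2$, $k,\ell,m\ge1$ are given; one assumes $k\le\ell$, which is no loss of generality since interchanging the axes $\{z_2=0\}$, $\{z_1=0\}$ interchanges $k$ and $\ell$. Put $X:=\frac{\pi}{\sqrt2km}$, $Y:=\frac{\pi}{\sqrt2\ell m}$, $R:=\frac1{10\ell m}$, $M:=k\ell m^2$. Symmetry group. $\mathcal G=\mathcal G[k,\ell,m]$ is the group of isometries of $\mathbb S^3$ generated by the maps sending $(z_1,z_2)$ to $(e^{2\pi i/(km)}z_1,z_2)$, $(z_1,e^{2\pi i/(\ell m)}z_2)$, $(\overline{z_1},z_2)$, $(z_1,\overline{z_2})$; through $\Phi$ it acts on $(x,y,z)$ by the group generated by $x\mapsto x+2X$, $y\mapsto y+2Y$, $x\mapsto-x$, $y\mapsto-y$, fixing $z$. Lattices. $\mathsf L_0\subset\mathbb T_{\rm fl}$ is the image of $2X\mathbb Z\times2Y\mathbb Z$, $\mathsf L_1:=\mathsf L_0+(X,Y)$ (each has $M$ points). Tunnels of layer $i$ ($1\le i\le N-1$,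 joining tori $i$ and $i+1$) sit over $\mathsf L_{(i+1)\bmod 2}$. Removal points: $Z_1:=\mathsf L_0$, $Z_N:=\mathsf L_{N\bmod2}$, $Z_j:=\mathsf L_0\cup\mathsf L_1$ for $1<j<N$; $M_j:=\#Z_j$. Perforated tori: $D_j:=\mathbb T_{\rm fl}\setminus\bigcup_{p\in Z_j}B(p,R)$. Waist ratios. $n:=\lfloor N/2\rfloor$, $b_1:=1$. If $N=2$, $b_2:=0$ (a constant only); if $N=3$, $b_2:=1$. If $N\ge4$, $(b_2,\dots,b_n)=(b_i[N,k,\ell,m])$ is a solution of $-b_{i-1}+b_2b_i-b_{i+1}=-\frac{8\pi}{k\ell m^2}b_i\ln b_i$ for $2\le i\le n-1$, and $-2^{(N+1)\bmod2}b_{n-1}+(b_2-(N\bmod2))b_n=-\frac{8\pi}{k\ell m^2}b_n\ln b_n$; for $m$ large it is the solution near $d=(d_2,\dots,d_n)$ furnished by the inverse function theorem, with $b_i\to d_i$ as $m\to\infty$, where $d$ is Wiygul's solution of the same system with right-hand sides $0$ (and $d_1=1$), with $d_2\in(1,2)$ and, when $n\ge3$, $d_2<\dots<d_n$. Extend by $b_i:=b_{N-i}$ for $n<i\le N-1$. Limiting waist ratios: $b_i[N]:=d_i$, extended by $d_1=1$ and $d_i=d_{N-i}$ for $n<i\le N-1$, with $b_2[2]:=0$ and $b_2[3]:=1$; these are the limits of $b_i[N,k,\ell,m]$ as $m\to\infty$. Waist radii. For the parameter vector $\zeta=(\zeta_1,\dots,\zeta_{N-1})$: $\tau_1=\frac{e^{\zeta_1}}{10\ell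 m}\exp\!\big(-\frac{k\ell m^2}{4\pi}(1-\frac{b_2}2)\big)$, $\tau_i=e^{\zeta_i/(k\ell m^2)}b_i\tau_1$ for $1<i<N$; $a_i:=\operatorname{arcosh}(R/\tau_i)$. Initial surfaces. $\Sigma^0=\Sigma^0[N,k,\ell,m,\zeta,\xi]$ denotes the initial surface of Wiygul's construction of minimal surfaces in $\mathbb S^3$ by stacking Clifford tori, with parameter vectors $\zeta,\xi$ bounded by a constant $c=c[N,k,\ell]$ independent of $m$. The heights $z_1,\dots,z_N$ of the tori and $z^K_1,\dots,z^K_{N-1}$ of the necks are not free: they are the specific functions of $(N,k,\ell,m,\zeta,\xi)$ prescribed in that construction (their absolute values are at most $C[N,k,\ell]\,m^2\tau_1$). The surface $\Sigma^0$ is the union of: (a) toral regions $\mathcal T^0[j]$ ($1\le j\le N$), the images under $\Phi$ of the graphs $z=\phi_j(x,y)$ over $D_j$, where $\phi_j=z_j$ at distance $\ge2R$ from $Z_j$, and at distance $r\in[R,2R]$ from $p\in Z_j$, with $\tau,z^K$ the waist radius and height of the neck at $p$, $\phi_j=z^K+(z_j-z^K)\psi[R,2R](r)+\operatorname{sgn}(z_j-z^K)\,\tau\operatorname{arcosh}(r/\tau)\,\psi[2R,R](r)$; here $\psi[a,b]$ is a fixed smooth monotone cut-off equal to $0$ at $a$ and to $1$ at $b$; (b) catenoidal regions: the $\mathcal G$-images of $\kappa_i([-a_i,a_i]\times\mathbb S^1)$, $\kappa_i(t,\theta)=\Phi((i-1)X+\tau_i\cosh t\cos\theta,\ (i-1)Y+\tau_i\cosh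 t\sin\theta,\ z_i^K+\tau_it)$, $1\le i\le N-1$. Its induced metric is $g^0$. Stacked Clifford torus of type $(N,k,\ell,m)$ ($m\ge m_0[N,k,\ell]$): a closed embedded $\mathcal G[k,\ell,m]$-invariant minimal surface $\Sigma\subset\mathbb S^3$ with induced metric $g$ for which there are an initial surface $\Sigma^0=\Sigma^0[N,k,\ell,m,\zeta,\xi]$ with $|\zeta|,|\xi|\le c[N,k,\ell]$ and a $\mathcal G$-equivariant diffeomorphism $\Psi:\Sigma^0\to\Sigma$ with $(1-m^{-2})g^0\le\Psi^*g\le(1+m^{-2})g^0$ as quadratic forms on $T\Sigma^0$. The numbers $a_i$ are those of the witnessing $\Sigma^0$. Total conductance and weighted path graph model. $C_i:=M\pi/a_i$ for $1\le i\le N-1$ (not to be confused with the number $C_N$ defined in the claim); $\mathcal T[j]:=\Psi(\mathcal T^0[j])$, $\widetilde A_j:=|\mathcal T[j]|+M_j\pi R^2$ ($|\cdot|$ = area in $\Sigma$), and $\mu(\widetilde A,C):=\min\Big\{\dfrac{\sum_{i=1}^{N-1}C_i(c_i-c_{i+1})^2}{\sum_{j=1}^N\widetilde A_jc_j^2}: c\in\mathbb R^N\setminus\{0\},\ \sum_j\widetilde A_jc_j=0\Big\}.$ Graphs. $P_q$ denotes the path graph on $q$ vertices, $A(P_q)$ its adjacency matrix and $L(P_q)=\operatorname{diag}(\deg)-A(P_q)$ its combinatorial Laplacian. *)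

(* Defs.v *)
From HB Require Import structures.
From mathcomp Require Import all_boot all_order all_algebra.
From mathcomp Require Import all_classical all_reals all_analysis.
Set Implicit Arguments.
Unset Strict Implicit.
Unset Printing Implicit Defensive.
Import Order.TTheory GRing.Theory Num.Theory.
Import numFieldNormedType.Exports.
Local Open Scope classical_set_scope.
Local Open Scope ring_scope.

(* [R : realType] is an arbitrary model of the reals.
   Conventions.
   - C^2 is identified with R^4 = 'rV[R]_4, as (Re z1, Im z1, Re z2, Im z2).
   - Points of the flat torus R^2 / (sqrt 2 * pi * Z)^2 are represented by their
     lifts to R * R; integrals over the torus are taken over a fundamental
     square.
   - Families indexed by 1, ..., q are functions on [nat] whose values outside
     that range are never used. *)

(** * Spectra of path graphs *)

Definition path_edge (q : nat) : rel 'I_q :=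
  fun i j => (i.+1 == j :> nat) || (j.+1 == i :> nat).

Definition adjacency (R : realType) (q : nat) (e : rel 'I_q) : 'M[R]_q :=
  \matrix_(i, j) (e i j)%:R.

Definition degree (q : nat) (e : rel 'I_q) (i : 'I_q) : nat := #|[pred j | e i j]|.

Definition laplacian (R : realType) (q : nat) (e : rel 'I_q) : 'M[R]_q :=
  diag_mx (\row_i (degree e i)%:R) - adjacency R e.

Definition path_adjacency (R : realType) (q : nat) : 'M[R]_q :=
  adjacency R (@path_edge q).

Definition path_laplacian (R : realType) (q : nat) : 'M[R]_q :=
  laplacian R (@path_edge q).

Definition is_greatest (R : realType) (A : set R) (x : R) : Prop :=
  A x /\ forall y, A y -> y <= x.

Definition is_least (R : realType) (A : set R) (x : R) : Prop :=
  A x /\ forall y, A y -> x <= y.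

Definition spectrum (R : realType) (q : nat) (A : 'M[R]_q) : set R :=
  [set a | eigenvalue A a].

(* [get] returns a junk value if there is no least element. *)
Definition lambda1 (R : realType) (q : nat) (A : 'M[R]_q) : R :=
  get (is_least [set a | spectrum A a /\ a != 0]).

(** * Waist ratios *)

Section WaistRatios.
Variable R : realType.
Implicit Types (N k l m i : nat) (b d : nat -> R).

Definition normalized_ratios N b : Prop :=
  [/\ b 1%N = 1,
      (N = 2%N -> b 2%N = 0),
      (N = 3%N -> b 2%N = 1) &
      forall i, (N./2 < i)%N -> (i <= N.-1)%N -> b i = b (N - i)%N].

Definition balanced N (eps : R) b : Prop :=
  let n := N./2 in
  (forall i, (2 <= i)%N -> (i <= n.-1)%N ->
     - b i.-1 + b 2%N * b i - b i.+1 = - eps * b i * ln (b i)) /\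
  - (2 ^+ (N.+1 %% 2)) * b n.-1 + (b 2%N - (N %% 2)%:R) * b n
    = - eps * b n * ln (b n).

Definition limiting_ratios N d : Prop :=
  normalized_ratios N d /\
  ((4 <= N)%N ->
     [/\ balanced N 0 d,
         1 < d 2%N < 2 &
         ((3 <= N./2)%N -> forall i, (2 <= i)%N -> (i < N./2)%N -> d i < d i.+1)]).

(* The sequence b_i[N]; a junk value if the defining conditions had no
   solution. *)
Definition limiting_ratio N : nat -> R := xget (fun=> 0) (limiting_ratios N).

(* [b m i] is b_i[N,k,l,m].  By the inverse function theorem the solution near
   the limiting one exists and is unique for large m, hence the conditions
   below determine [b m] for all large m. *)
Definition waist_ratios N k l (b : nat -> nat -> R) : Prop :=
  (forall m, normalized_ratios N (b m)) /\
  ((4 <= N)%N ->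
     (\forall m \near \oo, balanced N (8 * pi / (k * l * m ^ 2)%:R) (b m)) /\
     (forall i, (2 <= i)%N -> (i <= N./2)%N ->
        (fun m => b m i) @ \oo --> limiting_ratio N i)).

Definition limit_conductance N : R := 8 * pi ^+ 2 / (2 - limiting_ratio N 2%N).

End WaistRatios.

(** * Smooth maps and minimal surfaces in the 3-sphere *)

Section Surfaces.
Variable R : realType.
Notation E := 'rV[R]_4.

(* C^n on an open set of a finite-dimensional space: the directional
   derivatives in all fixed directions are C^(n-1). *)
Fixpoint Ck (V W : normedModType R) (n : nat) (U : set V) (f : V -> W) : Prop :=
  if n is n'.+1 then
    (forall x, U x -> differentiable f x) /\
    (forall v, Ck n' U (fun x => 'D_v f x))
  else forall x, U x -> {for x, continuous f}.

Definition smooth (V W : normedModType R) (U : set V) (f : V -> W) : Prop :=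
  forall n, Ck n U f.

(* Smoothness on an arbitrary subset S: local smooth extendability. *)
Definition smooth_on_subset (V W : normedModType R) (S : set V) (f : V -> W) : Prop :=
  forall p, S p -> exists (U : set V) (F : V -> W),
    [/\ open U, U p, smooth U F & forall q, U q -> S q -> F q = f q].

Definition diffeomorphism (V W : normedModType R) (S : set V) (T : set W)
    (f : V -> W) : Prop :=
  exists g : W -> V,
    [/\ (forall p, S p -> T (f p) /\ g (f p) = p),
        (forall q, T q -> S (g q) /\ f (g q) = q),
        smooth_on_subset S f & smooth_on_subset T g].

(* F, restricted to W, parametrizes an open piece of S. *)
Definition local_parametrization (S : set E) (W : set 'rV[R]_2)
    (F : 'rV[R]_2 -> E) : Prop :=
  open W /\
  exists U : set E, [/\ open U, smooth W F & diffeomorphism W (S `&` U) F].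

Definition embedded_surface (S : set E) : Prop :=
  forall p, S p -> exists W F,
    local_parametrization S W F /\ exists2 w, W w & F w = p.

Definition dot (u v : E) : R := \sum_(i < 4) u ord0 i * v ord0 i.

Definition sphere3 : set E := [set p | dot p p = 1].

Definition pd (i : 'I_2) (F : 'rV[R]_2 -> E) : 'rV[R]_2 -> E :=
  fun w => 'D_(delta_mx ord0 i) F w.

(* Mean curvature at F w, in the direction of the unit normal nu. *)
Definition mean_curvature (F : 'rV[R]_2 -> E) (w : 'rV[R]_2) (nu : E) : R :=
  let u := ord0 in let v := ord_max in
  let gE := dot (pd u F w) (pd u F w) in
  let gF := dot (pd u F w) (pd v F w) in
  let gG := dot (pd v F w) (pd v F w) in
  let e := dot (pd u (pd u F) w) nu in
  let f := dot (pd u (pd v F) w) nu in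
  let g := dot (pd v (pd v F) w) nu in
  (e * gG - 2 * f * gF + g * gE) / (2 * (gE * gG - gF ^+ 2)).

Definition minimal_in_sphere3 (S : set E) : Prop :=
  forall W F, local_parametrization S W F -> forall w, W w -> forall nu : E,
    dot nu nu = 1 -> dot nu (F w) = 0 ->
    (forall i, dot nu (pd i F w) = 0) ->
    mean_curvature F w nu = 0.

Definition closed_embedded_minimal_surface (S : set E) : Prop :=
  [/\ S !=set0, S `<=` sphere3, compact S, embedded_surface S &
      minimal_in_sphere3 S].

(* (1 - eps) g0 <= f^* g <= (1 + eps) g0 on TS, where g0 and g are induced by
   the Euclidean metric: tangent vectors are velocities at 0 of curves c in S
   differentiable at 0, and f maps the velocity of c to that of f o c. *)
Definition metric_pinched (S : set E) (f : E -> E) (eps : R) : Prop :=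
  forall c : R -> E, derivable c 0 1 -> (\forall t \near 0, S (c t)) ->
    let v := derive1 c 0 in let w := derive1 (f \o c) 0 in
    (1 - eps) * dot v v <= dot w w <= (1 + eps) * dot v v.

(* Area of the image of an injective parametrization F on A. *)
Definition area_element (F : R * R -> E) (p : R * R) : R :=
  let Fx := derive1 (fun x => F (x, p.2)) p.1 in
  let Fy := derive1 (fun y => F (p.1, y)) p.2 in
  Num.sqrt (dot Fx Fx * dot Fy Fy - dot Fx Fy ^+ 2).

Definition parametrized_area (A : set (R * R)) (F : R * R -> E) : R :=
  Rintegral (@lebesgue_measure R \x @lebesgue_measure R)%E A (area_element F).

(** * The symmetry group *)

Definition pt (a b c d : R) : E := \row_(i < 4) nth 0 [:: a; b; c; d] i.

Definition crd (p : E) (i : nat) : R := p ord0 (inord i).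

Definition rotate1 (t : R) (p : E) : E :=
  pt (cos t * crd p 0 - sin t * crd p 1) (sin t * crd p 0 + cos t * crd p 1)
     (crd p 2) (crd p 3).

Definition rotate2 (t : R) (p : E) : E :=
  pt (crd p 0) (crd p 1)
     (cos t * crd p 2 - sin t * crd p 3) (sin t * crd p 2 + cos t * crd p 3).

Definition conj1 (p : E) : E := pt (crd p 0) (- crd p 1) (crd p 2) (crd p 3).

Definition conj2 (p : E) : E := pt (crd p 0) (crd p 1) (crd p 2) (- crd p 3).

Inductive generated (T : Type) (gens : set (T -> T)) : (T -> T) -> Prop :=
| gen_id : generated gens id
| gen_mul s g : gens s -> generated gens g -> generated gens (s \o g)
| gen_mulV s t g : gens s -> cancel s t -> cancel t s -> generated gens g ->
    generated gens (t \o g).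

Definition symmetry_group (k l m : nat) : set (E -> E) :=
  generated [set s | [\/ s = rotate1 (2 * pi / (k * m)%:R),
                         s = rotate2 (2 * pi / (l * m)%:R),
                         s = conj1 | s = conj2]].

Definition invariant_under (G : set (E -> E)) (S : set E) : Prop :=
  forall g, G g -> g @` S = S.

Definition equivariant (G : set (E -> E)) (S : set E) (f : E -> E) : Prop :=
  forall g p, G g -> S p -> f (g p) = g (f p).

End Surfaces.

(** * Initial surfaces *)

Definition cosh (R : realType) (t : R) : R := (expR t + expR (- t)) / 2.

Definition arcosh (R : realType) (x : R) : R := ln (x + Num.sqrt (x ^+ 2 - 1)).

(* A smooth monotone step from 0 at 0 to 1 at 1, rescaled by [cut] below. *)
Definition cutoff (R : realType) (psi : R -> R) : Prop :=
  [/\ smooth (V := R^o) (W := R^o) setT psi,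
      {homo psi : s t / s <= t},
      (forall s : R, s <= 0 -> psi s = 0) & (forall s : R, 1 <= s -> psi s = 1)].

Definition cut (R : realType) (psi : R -> R) (a b r : R) : R :=
  psi ((r - a) / (b - a)).

Definition dist2 (R : realType) (p q : R * R) : R :=
  Num.sqrt ((p.1 - q.1) ^+ 2 + (p.2 - q.2) ^+ 2).

Definition Phi (R : realType) (x y z : R) : 'rV[R]_4 :=
  let s := Num.sqrt 2 in
  pt (sin (z + pi / 4) * cos (s * x)) (sin (z + pi / 4) * sin (s * x))
     (cos (z + pi / 4) * cos (s * y)) (cos (z + pi / 4) * sin (s * y)).

(* Everything on which the initial surface and its regions depend. *)
Record stack_data (R : realType) := StackData {
  ntori : nat;
  kk : nat;
  ll : nat;
  mm : nat;
  step : R -> R;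
  waist_ratio : nat -> R;
  zeta : nat -> R;
  torus_height : nat -> R;
  neck_height : nat -> R
}.

Section InitialSurface.
Variables (R : realType) (D : stack_data R).
Notation N := (ntori D).
Notation k := (kk D).
Notation l := (ll D).
Notation m := (mm D).
Implicit Types (i j : nat) (p q : R * R).

Definition cellX : R := pi / (Num.sqrt 2 * (k * m)%:R).
Definition cellY : R := pi / (Num.sqrt 2 * (l * m)%:R).
Definition hole_radius : R := (10 * (l * m)%:R)^-1.
Definition lattice_size : nat := (k * l * m ^ 2)%N.

Definition tau1 : R :=
  expR (zeta D 1%N) / (10 * (l * m)%:R) *
  expR (- (lattice_size%:R / (4 * pi)) * (1 - waist_ratio D 2%N / 2)).

Definition tau i : R :=
  if i == 1%N then tau1
  else expR (zeta D i / lattice_size%:R) * waist_ratio D i * tau1.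

Definition neck_length i : R := arcosh (hole_radius / tau i).

Definition lattice (e : nat) : set (R * R) :=
  [set p | exists a b : int,
     p = (2 * cellX * a%:~R + e%:R * cellX, 2 * cellY * b%:~R + e%:R * cellY)].

Definition layer_lattice i : set (R * R) := lattice (i.+1 %% 2).

Definition removal_points j : set (R * R) :=
  if j == 1%N then lattice 0
  else if j == N then lattice (N %% 2)
  else lattice 0 `|` lattice 1.

(* Each of the two lattices has k l m^2 points in the torus. *)
Definition removal_count j : nat :=
  if (j == 1%N) || (j == N) then lattice_size else (2 * lattice_size)%N.

Definition perforated j : set (R * R) :=
  [set p | forall q, removal_points j q -> hole_radius <= dist2 p q].

Definition fundamental_square : set (R * R) :=
  `[0, Num.sqrt 2 * pi[%classic `*` `[0, Num.sqrt 2 * pi[%classic.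

Definition dist_layer i p : R := inf [set dist2 p q | q in layer_lattice i].

(* Transition from the neck of layer i to the torus j, at distance r from the
   axis of the neck. *)
Definition transition i j (r : R) : R :=
  let zK := neck_height D i in let z := torus_height D j in
  zK + (z - zK) * cut (step D) hole_radius (2 * hole_radius) r
  + Num.sg (z - zK) * tau i * arcosh (r / tau i)
    * cut (step D) (2 * hole_radius) hole_radius r.

(* The necks meeting torus j are those of the layers j - 1 and j. *)
Definition toral_graph j p : R :=
  if (1 < j)%N && (dist_layer j.-1 p <= 2 * hole_radius)
  then transition j.-1 j (dist_layer j.-1 p)
  else if (j < N)%N && (dist_layer j p <= 2 * hole_radius)
  then transition j j (dist_layer j p)
  else torus_height D j.

Definition toral_param j p : 'rV[R]_4 := Phi p.1 p.2 (toral_graph j p).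

Definition toral_region j : set 'rV[R]_4 := toral_param j @` perforated j.

Definition catenoid_param i (t th : R) : 'rV[R]_4 :=
  Phi (i.-1%:R * cellX + tau i * cosh t * cos th)
      (i.-1%:R * cellY + tau i * cosh t * sin th)
      (neck_height D i + tau i * t).

Definition catenoid_region i : set 'rV[R]_4 :=
  [set p | exists g t th, [/\ @symmetry_group R k l m g,
     - neck_length i <= t <= neck_length i & p = g (catenoid_param i t th)]].

Definition initial_surface : set 'rV[R]_4 :=
  (\bigcup_(j in [set j | (1 <= j <= N)%N]) toral_region j) `|`
  (\bigcup_(i in [set i | (1 <= i < N)%N]) catenoid_region i).

(* Sigma is a closed embedded invariant minimal surface and Psi a diffeomorphism
   exhibiting it as a stacked Clifford torus over the initial surface of D. *)
Definition stacked_clifford_torus (Sigma : set 'rV[R]_4)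
    (Psi : 'rV[R]_4 -> 'rV[R]_4) : Prop :=
  [/\ closed_embedded_minimal_surface Sigma,
      invariant_under (@symmetry_group R k l m) Sigma,
      diffeomorphism initial_surface Sigma Psi,
      equivariant (@symmetry_group R k l m) initial_surface Psi &
      metric_pinched initial_surface Psi (m%:R ^- 2)].

(** * Conductances and the weighted path graph model *)

Definition conductance i : R := lattice_size%:R * pi / neck_length i.

(* The area of Psi (toral_region j), computed in the parametrization
   Psi o toral_param j of that region. *)
Definition image_area (Psi : 'rV[R]_4 -> 'rV[R]_4) j : R :=
  parametrized_area (perforated j `&` fundamental_square) (Psi \o toral_param j).

Definition filled_area (Psi : 'rV[R]_4 -> 'rV[R]_4) j : R :=
  image_area Psi j + (removal_count j)%:R * pi * hole_radius ^+ 2.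

End InitialSurface.

(* Only c 1, ..., c N matter: c stands for a vector of R^N. *)
Definition rayleigh_quotients (R : realType) (N : nat) (A C : nat -> R) : set R :=
  [set r | exists c : nat -> R,
     [/\ (exists2 j, (1 <= j <= N)%N & c j != 0),
         \sum_(1 <= j < N.+1) A j * c j = 0 &
         r = (\sum_(1 <= i < N) C i * (c i - c i.+1) ^+ 2) /
             (\sum_(1 <= j < N.+1) A j * c j ^+ 2)]].

(* mu is the minimum mu(A, C); in particular it is attained. *)
Definition is_lowest_rayleigh (R : realType) (N : nat) (A C : nat -> R) (mu : R) : Prop :=
  is_least (rayleigh_quotients N A C) mu.

(** * Height prescriptions *)

(* A family of functions of N, k, l, m, the parameter vectors zeta and xi, and
   an index; finite parameter vectors are padded by zeros. *)
Definition prescription (R : realType) : Type :=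
  nat -> nat -> nat -> nat -> (nat -> R) -> (nat -> R) -> nat -> R.

Definition bounded_by (R : realType) (c : R) (v : nat -> R) : Prop :=
  forall i, `|v i| <= c.

Definition prescribed_data (R : realType) (psi : R -> R)
    (b : nat -> nat -> nat -> nat -> nat -> R) (zT zK : prescription R)
    (N k l m : nat) (ze xi : nat -> R) : stack_data R :=
  StackData N k l m psi (b N k l m) ze (zT N k l m ze xi) (zK N k l m ze xi).

(* The heights are at most C[N,k,l] m^2 tau_1 for large m and parameters at most
   c[N,k,l]. *)
Definition heights_bounded (R : realType) (psi : R -> R)
    (b : nat -> nat -> nat -> nat -> nat -> R)
    (c C : nat -> nat -> nat -> R) (zT zK : prescription R) : Prop :=
  forall N k l, (2 <= N)%N -> (1 <= k)%N -> (k <= l)%N ->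
  \forall m \near \oo, forall ze xi : nat -> R,
    bounded_by (c N k l) ze -> bounded_by (c N k l) xi ->
    let D := prescribed_data psi b zT zK N k l m ze xi in
    (forall j, (1 <= j <= N)%N ->
       `|torus_height D j| <= C N k l * m%:R ^+ 2 * tau1 D) /\
    (forall i, (1 <= i < N)%N ->
       `|neck_height D i| <= C N k l * m%:R ^+ 2 * tau1 D).

(* Main.v *)
(** Pairing the balancing equations with the Perron vector [sin (i pi / N)] of
    the path on [N - 1] vertices identifies the limiting waist ratios, and for
    finite [m] it bounds the distance of [b_2] to [2 cos (pi / N)] by
    [O(1 / (k l m^2))].  Since [arcosh x = ln x + O(1)], the parameter [a_i] is
    then [k l m^2 (2 - b_2[N]) / (8 pi) + O(1)], which gives the conductances.
    The toral regions are graphs whose heights and slopes are exponentially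
    small in [m^2], over a torus of area [2 pi^2] with disks removed, so pinching
    of the metrics gives filled areas [2 pi^2 (1 + O(m^-2))].  A perturbation
    of the discrete Wirtinger inequality, dual to the Jacobi inequality for
    [sin (i pi / N)], finally controls the Rayleigh quotient. *)
Require Import Defs.
From mathcomp Require Import all_boot all_order all_algebra.
From mathcomp Require Import all_classical all_reals all_analysis.
From mathcomp Require Import measurable_realfun ring lra zify.
Set Implicit Arguments.
Unset Strict Implicit.
Unset Printing Implicit Defensive.
Import Order.TTheory GRing.Theory Num.Theory.
Import numFieldNormedType.Exports.
Local Open Scope classical_set_scope.
Local Open Scope ring_scope.

(** * Discrete Jacobi and Wirtinger inequalities *)

(** Errors are measured against [M = k l m^2 >= m^2]. Each [a_i] grows linearly in [M], so a bounded
    absolute error of [a_i] is a relative error [O(m^-2)]. The exponent of [tau1] multiplies the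
    balancing constant by [M], so that constant has to be known up to [O(1/M)]; convergence alone
    would not do. The balancing system is nonlinear, since [b_2] is both an unknown and a
    coefficient. Pairing with a positive vector isolates it in one scalar identity, in which
    positive ratios single out the largest eigenvalue.

    For the areas, the obstacle is that the pinching hypothesis only speaks of curves that stay in
    the initial surface. Area elements are therefore compared strictly off the rims of the holes,
    where lines in the plane stay in the domain for small times, and the rims are discarded as a
    null set. The exponential smallness of the waists is deliberately weakened to a bound of order
    [m^-2], the size of the pinching error. *)

Section PathSums.
Variable R : realType.
Implicit Types (w c f g u : nat -> R) (N n i j : nat).

Lemma sinDB (x t : R) : sin (x + t) + sin (x - t) = 2 * cos t * sin x.
Proof. by rewrite sinD sinB; ring. Qed.

Lemma cosDB (x t : R) : cos (x + t) + cos (x - t) = 2 * cos t * cos x.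
Proof. by rewrite cosD cosB; ring. Qed.

Definition sine N i : R := sin (i%:R * (pi / N%:R)).

Lemma sine0 N : sine N 0 = 0.
Proof. by rewrite /sine mul0r sin0. Qed.

Lemma sineN N : (0 < N)%N -> sine N N = 0.
Proof.
by move=> N0; rewrite /sine mulrC divfK ?sinpi// pnatr_eq0; lia.
Qed.

Lemma sineSS N i :
  sine N i + sine N i.+2 = 2 * cos (pi / N%:R) * sine N i.+1.
Proof.
rewrite /sine; set t := pi / _; rewrite -sinDB addrC.
by congr (sin _ + sin _); rewrite -!natr1; ring.
Qed.

Lemma sine_gt0 N i : (0 < i)%N -> (i < N)%N -> 0 < sine N i.
Proof.
move=> i0 iN; apply: sin_gt0_pi; rewrite mulr_gt0 ?divr_gt0 ?pi_gt0 ?ltr0n//=.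
  rewrite mulrCA gtr_pMr ?pi_gt0// ltr_pdivrMr ?mul1r ?ltr_nat// ltr0n; lia.
by lia.
Qed.

Lemma sine_sym N i : (0 < N)%N -> (i <= N)%N -> sine N (N - i) = sine N i.
Proof.
move=> N0 iN; rewrite /sine natrB// mulrBl.
have -> : N%:R * (pi / N%:R) = pi :> R by rewrite mulrC divfK// pnatr_eq0; lia.
by rewrite sinB sinpi cospi; ring.
Qed.

(* Picone's identity: with the positive solution [sine N] of the Jacobi
   equation, the defect in each step is a square. *)
Lemma jacobi_partial N w n : w 0%N = 0 -> (n.+1 < N)%N ->
  w n.+1 ^+ 2 * ((sine N n.+1 - sine N n) / sine N n.+1) <=
  \sum_(0 <= i < n.+1)
     ((w i.+1 - w i) ^+ 2 - (2 - 2 * cos (pi / N%:R)) * w i ^+ 2).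
Proof.
move=> w0; elim: n => [|n IH] nN.
  rewrite big_nat1 sine0 w0 !subr0 expr0n/= mulr0 subr0 divff ?mulr1//.
  by rewrite gt_eqF// sine_gt0.
rewrite big_nat_recr//=; have {}IH := IH (ltnW nN).
apply: le_trans (lerD IH (lexx _)).
have E := sineSS N n.
have p1 : 0 < sine N n.+1 by apply: sine_gt0 => //; lia.
have p2 : 0 < sine N n.+2 by apply: sine_gt0 => //; lia.
set a := sine N n.+1 in E p1 *; set b := sine N n.+2 in E p2 *.
set x := w n.+1; set y := w n.+2.
have -> : sine N n = 2 * cos (pi / N%:R) * a - b by rewrite -E addrK.
rewrite -subr_ge0.
set k := cos _.
have -> : x ^+ 2 * ((a - (2 * k * a - b)) / a) +
   ((y - x) ^+ 2 - (2 - 2 * k) * x ^+ 2) - y ^+ 2 * ((b - a) / b)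
   = (b * x - a * y) ^+ 2 / (a * b).
  by field; rewrite !gt_eqF.
by rewrite divr_ge0 ?sqr_ge0// mulr_ge0// ltW.
Qed.

(** [jacobi_partial] divides by [sine], which vanishes at [N], so it stops one step early. In the
    last step [w N = 0] and [sine N N = 0] make the remaining term cancel the boundary term
    exactly. *)
Lemma jacobi_ineq N w : (2 <= N)%N -> w 0%N = 0 -> w N = 0 ->
  (2 - 2 * cos (pi / N%:R)) * (\sum_(0 <= i < N) w i ^+ 2) <=
  \sum_(0 <= i < N) (w i.+1 - w i) ^+ 2.
Proof.
case: N => [//|[//|n]] _ w0 wN.
rewrite -subr_ge0 mulr_sumr -sumrB big_nat_recr//= wN.
have H := @jacobi_partial n.+2 w n w0 (ltnSn _).
apply: le_trans (lerD H (lexx _)).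
have E := sineSS n.+2 n; rewrite sineN// addr0 in E.
have p1 : 0 < sine n.+2 n.+1 by apply: sine_gt0.
rewrite E.
set a := sine n.+2 n.+1 in p1 *; set k := cos _; set x := w n.+1.
have -> // : x ^+ 2 * ((a - 2 * k * a) / a) + ((0 - x) ^+ 2 - (2 - 2 * k) * x ^+ 2) = 0.
by field; rewrite gt_eqF.
Qed.

Lemma lambda_gt0 N : (2 <= N)%N -> 0 < 2 - 2 * cos (pi / N%:R) :> R.
Proof.
move=> N2; rewrite subr_gt0 gtr_pMr// -[X in _ < X]cos0.
have N0 : 0 < N%:R :> R by rewrite ltr0n; lia.
have p := pi_gt0 R.
rewrite ltr_cos ?divr_gt0// in_itv/=; first by rewrite lexx ltW.
by rewrite ltW ?divr_gt0//= ler_pdivrMr// ler_peMr ?ler1n ?ltW//; lia.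
Qed.

(* [c] is the increment of its partial sums, which vanish at both ends. *)
Lemma wirtinger N c : (2 <= N)%N -> \sum_(1 <= j < N.+1) c j = 0 ->
  (2 - 2 * cos (pi / N%:R)) * (\sum_(1 <= j < N.+1) c j ^+ 2) <=
  \sum_(1 <= i < N) (c i - c i.+1) ^+ 2.
Proof.
move=> N2 c0.
pose w n := \sum_(1 <= j < n.+1) c j.
have w0 : w 0%N = 0 by rewrite /w big_geq.
have wS i : w i.+1 - w i = c i.+1 by rewrite /w big_nat_recr//= addrC addrK.
have J := jacobi_ineq N2 w0 c0.
have E : \sum_(1 <= j < N.+1) c j ^+ 2 = \sum_(0 <= i < N) (w i.+1 - w i) ^+ 2.
  by rewrite big_add1; apply: eq_bigr => i _; rewrite wS.
(* Summation by parts; at [n = N] the boundary term disappears because the partial sum [w N] is the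
   total, which is zero. *)
have abel n : (0 < n)%N -> \sum_(1 <= j < n.+1) c j ^+ 2 =
    w n * c n + \sum_(1 <= i < n) w i * (c i - c i.+1).
  elim: n => // -[|n] IH _; rewrite big_nat_recr//=.
    by rewrite !big_geq// add0r addr0 -(wS 0%N) w0 subr0.
  by rewrite IH// [in RHS]big_nat_recr//= -(wS n.+1); ring.
have lam := lambda_gt0 N2; set l := 2 - 2 * _ in J lam *.
move: (abel N); rewrite [w N]c0 mul0r add0r => /(_ (ltnW N2)) A.
rewrite -E in J; set Q := \sum_(1 <= j < N.+1) c j ^+ 2 in J A *.
(* Summed form of the square of [l * w i - (c i - c i.+1)] being nonnegative. The Jacobi inequality
   bounds the first term on the right by [l * Q], which leaves [l * Q] below the energy. *)
have Y : 2 * l * Q <= l * (l * (\sum_(0 <= i < N) w i ^+ 2)) +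
     \sum_(1 <= i < N) (c i - c i.+1) ^+ 2.
  have -> : \sum_(0 <= i < N) w i ^+ 2 = \sum_(1 <= i < N) w i ^+ 2.
    by rewrite big_ltn 1?ltnW// w0 expr0n/= add0r.
  rewrite A !mulr_sumr -big_split/=; apply: ler_sum => i _.
  have := sqr_ge0 (l * w i - (c i - c i.+1)).
  by set x := w i; set y := c i - _; lra.
have := ler_wpM2l (ltW lam) J; nra.
Qed.

(** Discrete Green formula. The ghost values [g 0] and [g N.+1] occur only in the two end terms,
    which vanish when [g] is reflected at the ends. *)
Lemma green_neumann N g : (0 < N)%N ->
  \sum_(1 <= j < N.+1) g j * (2 * g j - g j.-1 - g j.+1) =
  \sum_(1 <= i < N) (g i - g i.+1) ^+ 2 + g 1%N * (g 1%N - g 0%N)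
  + g N * (g N - g N.+1).
Proof.
elim: N => // -[|n] IH _.
  by rewrite big_nat1 big_geq//=; ring.
by rewrite big_nat_recr//= IH// [in RHS]big_nat_recr//=; ring.
Qed.

Lemma sum_laplace N g :
  \sum_(1 <= j < N.+1) (2 * g j - g j.-1 - g j.+1) =
  (g 1%N - g 0%N) + (g N - g N.+1).
Proof.
elim: N => [|n IH]; first by rewrite big_geq//=; ring.
by rewrite big_nat_recr//= IH; ring.
Qed.

(** The summand is the increment of the discrete Wronskian [u i * f i.+1 - u i.+1 * f i], so the sum
    telescopes. *)
Lemma green_dirichlet n f u : f 0%N = 0 -> u 0%N = 0 ->
  \sum_(1 <= i < n.+1) (u i * (f i.-1 + f i.+1) - (u i.-1 + u i.+1) * f i) =
  u n * f n.+1 - u n.+1 * f n.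
Proof.
move=> f0 u0; elim: n => [|n IH]; first by rewrite big_geq// f0 u0; ring.
by rewrite big_nat_recr//= IH; ring.
Qed.

(** Self-adjointness of the path adjacency under zero end values: the operator moves from [f] to
    [sine], its eigenvector. *)
Lemma sine_pairing N f : (0 < N)%N -> f 0%N = 0 -> f N = 0 ->
  \sum_(1 <= i < N) sine N i * (f i.-1 + f i.+1) =
  2 * cos (pi / N%:R) * \sum_(1 <= i < N) sine N i * f i.
Proof.
case: N => // n _ f0 fN; apply/eqP; rewrite -subr_eq0; apply/eqP.
rewrite mulr_sumr -sumrB.
have := @green_dirichlet n f (sine n.+1) f0 (sine0 _).
rewrite fN sineN// mulr0 mul0r subr0; apply: etrans.
apply: eq_big_nat => -[//|i] _ /=.
by rewrite sineSS mulrA.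
Qed.

(** The half-integer shift makes the sequence symmetric about both ends ([cosine01], [cosineNS]); it
    is the lowest nonconstant Neumann mode, the counterpart of the Dirichlet mode [sine]. *)
Definition cosine N j : R := cos ((j%:R - 2^-1) * (pi / N%:R)).

Lemma cosineSS N i :
  cosine N i + cosine N i.+2 = 2 * cos (pi / N%:R) * cosine N i.+1.
Proof.
rewrite /cosine; set t := pi / _; rewrite -cosDB addrC.
by congr (cos _ + cos _); rewrite -!natr1; ring.
Qed.

Lemma cosine01 N : cosine N 0 = cosine N 1.
Proof. by rewrite /cosine -cosN; congr cos; rewrite -mulNr; congr (_ * _); field. Qed.

Lemma cosineNS N : (0 < N)%N -> cosine N N.+1 = cosine N N.
Proof.
move=> N0; have Nn : N%:R != 0 :> R by rewrite pnatr_eq0; lia.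
rewrite /cosine; set t := pi / N%:R.
have Nt : N%:R * t = pi by rewrite /t mulrC divfK.
have -> : (N.+1%:R - 2^-1) * t = 2^-1 * t + pi.
  by rewrite -Nt -natr1; field.
rewrite mulrBl Nt cosDpi cosB cospi sinpi; ring.
Qed.

Lemma cosine1_gt0 N : (2 <= N)%N -> 0 < cosine N 1.
Proof.
move=> N2; rewrite /cosine; apply: cos_gt0_pihalf.
have -> : 1%:R - 2^-1 = 2^-1 :> R by field.
have p := pi_gt0 R.
have t0 : 0 < pi / N%:R :> R by rewrite divr_gt0 ?ltr0n//; lia.
have t1 : pi / N%:R <= pi / 2 :> R.
  by rewrite ler_pM2l// lef_pV2 ?posrE ?ltr0n ?ler_nat//; lia.
by apply/andP; split; lra.
Qed.

(** The second differences of a sequence reflected at both ends sum to zero, and here they are a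
    nonzero multiple of the sequence itself. *)
Lemma sum_cosine N : (2 <= N)%N -> \sum_(1 <= j < N.+1) cosine N j = 0.
Proof.
move=> N2; have lam := lambda_gt0 N2.
have := sum_laplace N (cosine N).
rewrite cosine01 cosineNS 1?ltnW// !subrr addr0.
rewrite (eq_big_nat _ _ (F2 := fun j => (2 - 2 * cos (pi / N%:R)) * cosine N j)).
  by rewrite -mulr_sumr => /eqP; rewrite mulf_eq0 gt_eqF//= => /eqP.
move=> [//|i] _ /=; rewrite mulrBl -cosineSS; ring.
Qed.

Lemma energy_cosine N : (2 <= N)%N ->
  \sum_(1 <= i < N) (cosine N i - cosine N i.+1) ^+ 2 =
  (2 - 2 * cos (pi / N%:R)) * \sum_(1 <= j < N.+1) cosine N j ^+ 2.
Proof.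
move=> N2; have := green_neumann (cosine N) (ltnW N2).
rewrite cosine01 cosineNS 1?ltnW// !subrr !mulr0 !addr0 => <-.
rewrite mulr_sumr; apply: eq_big_nat => -[//|i] _ /=.
by rewrite expr2 mulrA mulrBl -cosineSS; ring.
Qed.

End PathSums.

(** * Path spectra and balanced waist ratios *)

Section PathSpectrum.
Variable R : realType.

(* 1-based extension by zero: entry [i : 'I_q] sits at the natural number [i.+1]. *)
Definition extend (q : nat) (v : 'I_q -> R) (n : nat) : R :=
  \sum_(i < q) v i * (i.+1 == n)%:R.

Lemma extendE q (v : 'I_q -> R) (i : 'I_q) : extend v i.+1 = v i.
Proof.
rewrite /extend (bigD1 i)//= eqxx mulr1 big1 ?addr0// => j ji.
by rewrite eqSS (negbTE (ji : val j != val i)) mulr0.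
Qed.

Lemma extend_out q (v : 'I_q -> R) n : (n == 0%N) || (q < n)%N -> extend v n = 0.
Proof.
move=> nq; rewrite /extend big1// => i _.
have -> : (i.+1 == n) = false by have := ltn_ord i; lia.
by rewrite mulr0.
Qed.

(** The second neighbour is written [i.+1 == j.+2] so that both terms are weights occurring in
    [extend]. *)
Lemma path_edgeE q (i j : 'I_q) :
  (path_edge i j)%:R = (i.+1 == j)%:R + (i.+1 == j.+2)%:R :> R.
Proof.
rewrite /path_edge -natrD; congr (_%:R).
by rewrite eqSS [_ == j.+1]eq_sym; case: eqP => [<-|]; case: eqP => //=; lia.
Qed.

Lemma path_edgeC q (i j : 'I_q) : path_edge i j = path_edge j i.
Proof. by rewrite /path_edge orbC. Qed.

Lemma mul_path_adjacency q (v : 'rV[R]_q) (j : 'I_q) :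
  (v *m path_adjacency R q) ord0 j = extend (v ord0) j + extend (v ord0) j.+2.
Proof.
rewrite mxE /extend -big_split/=; apply: eq_bigr => i _.
by rewrite !mxE path_edgeE mulrDr.
Qed.

Lemma path_degree q (j : 'I_q) :
  (degree (@path_edge q) j)%:R = (0 < j)%:R + (j.+1 < q)%:R :> R.
Proof.
rewrite /degree -sum1_card natr_sum big_mkcond/=.
transitivity (extend (fun _ : 'I_q => 1) j + extend (fun _ : 'I_q => 1) j.+2).
  rewrite /extend -big_split/=; apply: eq_bigr => i _.
  rewrite !mul1r -path_edgeE path_edgeC.
  by rewrite inE; case: ifP.
congr (_ + _).
  case: (posnP j) => [j0|]; first by rewrite j0 extend_out.
  case: j => -[//|j] jq /= _; have jq' : (j < q)%N by lia.
  exact: (extendE _ (Ordinal jq')).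
case: (ltnP j.+1 q) => [jq|jq].
  exact: (extendE _ (Ordinal jq)).
by rewrite extend_out.
Qed.

(** Ghost entries repeating the end entries absorb the smaller degree of the end vertices, so that
    the Laplacian becomes the same second difference at every vertex. *)
Definition neumann q (v : 'I_q -> R) (n : nat) : R :=
  if n == 0%N then extend v 1 else if n == q.+1 then extend v q else extend v n.

Lemma mul_path_laplacian q (v : 'rV[R]_q) (j : 'I_q) :
  let g := neumann (v ord0) in
  (v *m path_laplacian R q) ord0 j = 2 * g j.+1 - g j - g j.+2.
Proof.
move=> g; rewrite /path_laplacian /laplacian mulmxBr.
rewrite mxE [X in _ + X]mxE mul_path_adjacency mul_mx_diag !mxE path_degree.
rewrite -[v ord0 j](extendE (v ord0)) /g /neumann /= eqSS.
have jq := ltn_ord j; rewrite (ltn_eqF jq).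
case: (posnP j) => [j0|j0].
  rewrite j0 (@extend_out _ _ 0)//= eqSS.
  have [q1|q1] := eqVneq q 1%N.
    have -> : (1 < q)%N = false by lia.
    have -> : extend (v ord0) q = extend (v ord0) 1 by congr extend.
    rewrite (@extend_out _ _ 2); last by rewrite q1.
    by rewrite /= mulr0n; ring.
  have -> : (1 < q)%N by lia.
  by rewrite /= mulr1n; ring.
rewrite ifN; last lia.
rewrite eqSS; have [jE|jN] := eqVneq j.+1 q.
  rewrite jE ltnn (@extend_out _ _ q.+1) ?ltnSn ?orbT//.
    by rewrite /= mulr1n mulr0n; ring.
have -> : (j.+1 < q)%N by lia.
by rewrite /= !mulr1n; ring.
Qed.

Lemma eigen_sine N : (2 <= N)%N ->
  spectrum (path_adjacency R N.-1) (2 * cos (pi / N%:R)).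
Proof.
case: N => [|[|n]]// _ /=; apply/eigenvalueP.
pose v : 'rV[R]_n.+1 := \row_i sine R n.+2 i.+1.
have vE k : (k <= n.+2)%N -> extend (v ord0) k = sine R n.+2 k.
  case: k => [_|k]; first by rewrite extend_out// sine0.
  rewrite ltnS leq_eqVlt => /orP[/eqP ->|kn].
    by rewrite extend_out ?sineN// ltnSn orbT.
  by rewrite (extendE _ (Ordinal kn)) mxE.
exists v; last first.
  apply/eqP => /rowP /(_ ord0); rewrite !mxE => /eqP.
  by rewrite gt_eqF// sine_gt0.
apply/rowP => j; rewrite mul_path_adjacency !vE; last 2 first.
- by have := ltn_ord j; lia.
- by have := ltn_ord j; lia.
by rewrite sineSS !mxE.
Qed.

(** An eigenvector extended by zero has Dirichlet energy [2 - a] times its squared norm, so the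
    Jacobi inequality bounds [2 - a] from below. *)
Lemma path_adjacency_le N (a : R) : (2 <= N)%N ->
  spectrum (path_adjacency R N.-1) a -> a <= 2 * cos (pi / N%:R).
Proof.
case: N => [|[|n]]// _ /= /eigenvalueP[v va v0].
pose w := extend (v ord0).
have w0 : w 0%N = 0 by rewrite /w extend_out.
have wN : w n.+2 = 0 by rewrite /w extend_out// ltnSn orbT.
have J := jacobi_ineq (isT : (2 <= n.+2)%N) w0 wN.
have rel i : (0 < i)%N -> (i < n.+2)%N -> w i.-1 + w i.+1 = a * w i.
  case: i => // i _ iN /=; rewrite ltnS in iN.
  have := congr1 (fun A : 'rV[R]_n.+1 => A ord0 (Ordinal iN)) va.
  rewrite mul_path_adjacency mxE/= => ->.
  by rewrite /w (extendE _ (Ordinal iN)).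
have E : \sum_(0 <= i < n.+2) (w i.+1 - w i) ^+ 2 =
    (2 - a) * \sum_(0 <= i < n.+2) w i ^+ 2.
  have tel k : (k < n.+2)%N -> \sum_(0 <= i < k) (w i.+1 - w i) ^+ 2 =
      (2 - a) * (\sum_(0 <= i < k) w i ^+ 2) + w k * (w k - w k.-1)
      + (a - 2) * w 0%N ^+ 2.
    elim: k => [_|k IH kn].
      by rewrite !big_geq// w0; ring.
    rewrite !big_nat_recr//= IH; last lia.
    case: k {IH} kn => [|k] kn.
      by rewrite w0 /=; ring.
    have := rel k.+1 isT (ltnW kn) => /= r.
    have -> : w k.+2 = a * w k.+1 - w k by rewrite -r; ring.
    by ring.
  rewrite big_nat_recr//= tel// [in RHS]big_nat_recr//= wN w0.
  have := rel n.+1 isT (ltnSn _); rewrite /= wN addr0 => ->.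
  by ring.
rewrite E in J.
suff S0 : 0 < \sum_(0 <= i < n.+2) w i ^+ 2.
  by move: J; rewrite ler_pM2r// lerD2l lerN2.
have Sge : 0 <= \sum_(0 <= i < n.+2) w i ^+ 2 by apply: sumr_ge0 => i _; exact: sqr_ge0.
rewrite lt_def Sge andbT; apply: contra v0.
rewrite big_mkord psumr_eq0; last by move=> i _; exact: sqr_ge0.
move=> /allP H; apply/eqP/rowP => j; rewrite mxE.
have jN : (j.+1 < n.+2)%N by rewrite ltnS.
have := H (Ordinal jN) (mem_index_enum _).
by rewrite /= sqrf_eq0 /w extendE => /eqP.
Qed.

Lemma eigen_cosine N : (2 <= N)%N ->
  spectrum (path_laplacian R N) (2 - 2 * cos (pi / N%:R)).
Proof.
move=> N2; apply/eigenvalueP.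
pose v : 'rV[R]_N := \row_i cosine R N i.+1.
have vE k : (0 < k <= N)%N -> extend (v ord0) k = cosine R N k.
  case: k => // k /= kN; by rewrite (extendE _ (Ordinal kN)) mxE.
have gE k : (k <= N.+1)%N -> neumann (v ord0) k = cosine R N k.
  move=> kN; rewrite /neumann; case: eqP => [->|k0].
    by rewrite vE ?cosine01//; lia.
  case: eqP => [->|kN'].
    by rewrite vE ?leqnn ?andbT ?cosineNS//; lia.
  by rewrite vE//; lia.
have N0 : (0 < N)%N by lia.
exists v; last first.
  apply/eqP => /rowP /(_ (Ordinal N0)); rewrite !mxE => /eqP.
  by rewrite gt_eqF// cosine1_gt0.
apply/rowP => j; have jN := ltn_ord j.
rewrite mul_path_laplacian !gE; try lia.
by rewrite !mxE mulrBl -cosineSS; ring.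
Qed.

(** An eigenvector for a nonzero eigenvalue has zero sum, so the Wirtinger inequality applies to it;
    its energy is [a] times its squared norm by [green_neumann]. *)
Lemma path_laplacian_ge N (a : R) : (2 <= N)%N ->
  spectrum (path_laplacian R N) a -> a != 0 -> 2 - 2 * cos (pi / N%:R) <= a.
Proof.
move=> N2 /eigenvalueP[v va v0] a0.
pose g := neumann (v ord0).
have gE k : (0 < k <= N)%N -> g k = extend (v ord0) k.
  by move=> kN; rewrite /g /neumann ifN ?ifN//; lia.
have g01 : g 0%N = g 1%N by rewrite [in RHS]gE ?N2//; lia.
have gN : g N.+1 = g N.
  by rewrite [in RHS]gE ?leqnn ?andbT/=; [rewrite /g /neumann eqxx | lia].
have rel j : (0 < j <= N)%N -> 2 * g j - g j.-1 - g j.+1 = a * g j.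
  case: j => // j jN /=.
  have := congr1 (fun A : 'rV[R]_N => A ord0 (Ordinal jN)) va.
  by rewrite mul_path_laplacian mxE/= => ->; rewrite gE// (extendE _ (Ordinal jN)).
have S0 : \sum_(1 <= j < N.+1) g j = 0.
  have := sum_laplace N g; rewrite g01 gN !subrr addr0.
  rewrite (eq_big_nat _ _ (F2 := fun j => a * g j)).
    by rewrite -mulr_sumr => /eqP; rewrite mulf_eq0 (negbTE a0)/= => /eqP.
  by move=> j jN; rewrite rel//; lia.
have E := green_neumann g (ltnW N2).
rewrite g01 gN !subrr !mulr0 !addr0 in E.
have W := wirtinger N2 S0; rewrite -E in W.
have aE : \sum_(1 <= j < N.+1) g j * (2 * g j - g j.-1 - g j.+1) =
    a * \sum_(1 <= j < N.+1) g j ^+ 2.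
  rewrite mulr_sumr; apply: eq_big_nat => j jN.
  by rewrite rel 1?mulrCA -?expr2//; lia.
rewrite aE in W.
suff Sp : 0 < \sum_(1 <= j < N.+1) g j ^+ 2 by move: W; rewrite ler_pM2r.
have Sge : 0 <= \sum_(1 <= j < N.+1) g j ^+ 2 by apply: sumr_ge0 => i _; exact: sqr_ge0.
rewrite lt_def Sge andbT; apply: contra v0.
rewrite big_add1 big_mkord psumr_eq0; last by move=> i _; exact: sqr_ge0.
move=> /allP H; apply/eqP/rowP => j; rewrite mxE.
have := H j (mem_index_enum _).
by rewrite /= sqrf_eq0 gE ?extendE ?ltn_ord// => /eqP.
Qed.

Lemma cos_pi_is_greatest N : (2 <= N)%N ->
  is_greatest (spectrum (path_adjacency R N.-1)) (2 * cos (pi / N%:R)).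
Proof.
by move=> N2; split; [exact: eigen_sine | move=> y; exact: path_adjacency_le].
Qed.

Lemma cos_pi_is_least N : (2 <= N)%N ->
  is_least [set a | spectrum (path_laplacian R N) a /\ a != 0]
    (2 - 2 * cos (pi / N%:R)).
Proof.
move=> N2; split; first by split; [exact: eigen_cosine | rewrite gt_eqF ?lambda_gt0].
by move=> y [sy y0]; exact: path_laplacian_ge.
Qed.

(** A least element exists, so the [get] in [lambda1] returns one instead of a junk value. *)
Lemma lambda1_is_least N : (2 <= N)%N ->
  is_least [set a | spectrum (path_laplacian R N) a /\ a != 0]
    (lambda1 (path_laplacian R N)).
Proof. by move=> N2; exact: (getI (cos_pi_is_least N2)). Qed.

Lemma lambda1_path N : (2 <= N)%N ->
  lambda1 (path_laplacian R N) = 2 - 2 * cos (pi / N%:R).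
Proof.
move=> N2; have [h1 h2] := lambda1_is_least N2.
have [k1 k2] := cos_pi_is_least N2.
by apply/eqP; rewrite eq_le h2// k2.
Qed.

End PathSpectrum.

(** * Balancing equations and the limiting waist ratios *)

Section LimitingRatios.
Variable R : realType.
Implicit Types (N i : nat) (b d : nat -> R).

(** Values of [b] outside [1, ..., N - 1] are arbitrary; replacing them by zero supplies Dirichlet
    end values, under which the equations of the half chain become one recurrence on the whole
    chain. *)
Definition full_ratios N b i : R := if (0 < i < N)%N then b i else 0.

Lemma full_ratios_sym N b i : normalized_ratios N b -> (i <= N)%N ->
  full_ratios N b (N - i) = full_ratios N b i.
Proof.
move=> [_ _ _ bs] iN; rewrite /full_ratios.
have -> : (0 < N - i < N)%N = (0 < i < N)%N by lia.
case: ifP => // iN'.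
have [ni|ni] := ltnP N./2 i; first by rewrite (bs i)//; lia.
have [ni'|ni'] := ltnP N./2 (N - i).
  by rewrite [LHS]bs//; [congr b; lia | lia].
by congr b; lia.
Qed.

(** At [i = 1] the equation is an identity, because the ratio is [1] and its logarithm vanishes. The
    equations up to the middle are those of [balanced], and reflection gives the upper half. *)
Lemma full_ratios_balanced N eps b i : (4 <= N)%N ->
  normalized_ratios N b -> balanced N eps b -> (0 < i < N)%N ->
  full_ratios N b i.-1 + full_ratios N b i.+1 =
  b 2%N * full_ratios N b i + eps * (full_ratios N b i * ln (full_ratios N b i)).
Proof.
move=> N4 nb; have [b1 _ _ _] := nb; move=> [bal1 bal2].
have low j : (0 < j <= N./2)%N ->
    full_ratios N b j.-1 + full_ratios N b j.+1 =
    b 2%N * full_ratios N b j + eps * (full_ratios N b j * ln (full_ratios N b j)).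
  move=> jn; have [j1|j1] := eqVneq j 1%N.
    rewrite j1 /full_ratios/= !ifT; try lia.
    by rewrite b1 ln1; ring.
  have [jn1|jn1] := ltnP j N./2.
    have := bal1 j ltac:(lia) ltac:(lia); rewrite /full_ratios !ifT; try lia.
    by move=> H; lra.
  have jE : j = N./2 by lia.
  (* At the middle index the right neighbour reflects to the index itself for odd [N] and to its
     left neighbour for even [N]. This accounts for the parity-dependent coefficients of the last
     balancing equation. *)
  have fS : full_ratios N b j.+1 =
      if odd N then full_ratios N b j else full_ratios N b j.-1.
    rewrite -full_ratios_sym//; last lia.
    by case: ifP => oN; congr full_ratios; lia.
  move: bal2; rewrite -jE !modn2 /= fS.
  case: ifP => oN /=; rewrite /full_ratios !ifT; try lia.
    by rewrite expr0 => H; lra.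
  by rewrite expr1 => H; lra.
move=> iN; have [iN2|iN2] := leqP i N./2; first by apply: low; lia.
have := low (N - i)%N ltac:(lia).
rewrite (full_ratios_sym nb); last lia.
have -> : (N - i).-1 = (N - i.+1)%N by lia.
have -> : (N - i).+1 = (N - i.-1)%N by lia.
by rewrite !(full_ratios_sym nb); [rewrite addrC | lia | lia].
Qed.

Lemma sum_sine_gt0 N (f : nat -> R) : (2 <= N)%N ->
  (forall i, (0 < i < N)%N -> 0 < f i) -> 0 < \sum_(1 <= i < N) sine R N i * f i.
Proof.
move=> N2 fp; rewrite big_ltn//.
rewrite ltr_pwDl ?mulr_gt0 ?sine_gt0 ?fp//; try lia.
rewrite big_nat; apply: sumr_ge0 => i iN.
by rewrite ltW// mulr_gt0 ?sine_gt0 ?fp//; lia.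
Qed.

(* Pairing the balancing equations with the Perron vector [sine R N] of the path
   compares the balancing constant with [2 * cos (pi / N)] without inverting
   the linearized system. *)
Lemma balanced_defect N (eps L : R) b : (4 <= N)%N -> 0 <= eps ->
  normalized_ratios N b -> balanced N eps b ->
  (forall i, (0 < i < N)%N -> 0 < b i) ->
  (forall i, (0 < i < N)%N -> `|ln (b i)| <= L) ->
  `|b 2%N - 2 * cos (pi / N%:R)| <= eps * L.
Proof.
move=> N4 e0 nb bal bp bL; pose f := full_ratios N b.
have fE i : (0 < i < N)%N -> f i = b i by move=> iN; rewrite /f /full_ratios iN.
have P : 0 < \sum_(1 <= i < N) sine R N i * f i.
  by apply: sum_sine_gt0 => [|i iN]; [lia | rewrite fE// bp].
have f0 : f 0%N = 0 by [].
have fN : f N = 0 by rewrite /f /full_ratios ltnn andbF.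
have := @sine_pairing R N f ltac:(lia) f0 fN.
rewrite (eq_big_nat _ _ (F2 := fun i => b 2%N * (sine R N i * f i) +
   eps * (sine R N i * f i * ln (b i)))); last first.
  move=> i iN; rewrite (full_ratios_balanced N4 nb bal)//.
  by rewrite -/f fE//; ring.
rewrite big_split/= -!mulr_sumr => H.
have {}H : (b 2%N - 2 * cos (pi / N%:R)) * (\sum_(1 <= i < N) sine R N i * f i)
   = - (eps * \sum_(1 <= i < N) sine R N i * f i * ln (b i)).
  by rewrite mulrBl -H; ring.
(* All weights [sine R N i * f i] are positive with sum the factor on the left, so the right side is
   [eps] times a weighted average of logarithms times that same sum. *)
rewrite -(ler_pM2r P) -[X in `|_| * X](gtr0_norm P) -normrM H normrN normrM.
rewrite (ger0_norm e0) -mulrA ler_wpM2l// (le_trans (ler_norm_sum _ _ _))//.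
rewrite mulr_sumr big_nat [leRHS]big_nat; apply: ler_sum => i iN.
have p : 0 < sine R N i * f i by rewrite mulr_gt0 ?sine_gt0 ?fE ?bp//; lia.
by rewrite normrM (gtr0_norm p) mulrC ler_wpM2r ?bL ?ltW//; lia.
Qed.

Lemma limiting_positive N d : (4 <= N)%N -> limiting_ratios N d ->
  forall i, (0 < i < N)%N -> 0 < d i.
Proof.
move=> N4 [nd /(_ N4)[_ /andP[d2 _] dmono]].
have [d1 _ _ _] := nd.
have low i : (0 < i <= N./2)%N -> 0 < d i.
  elim: i => // i IH iN.
  have [->|i0] := eqVneq i 0%N; first by rewrite d1.
  have [->|i1] := eqVneq i 1%N; first by rewrite (lt_trans ltr01 d2).
  by apply: lt_trans (dmono _ i _ _); [apply: IH; lia | lia | lia | lia].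
move=> i iN; have [iN2|iN2] := leqP i N./2; first by apply: low; lia.
have := full_ratios_sym nd (i := i) ltac:(lia).
by rewrite /full_ratios iN ifT; [move=> <-; apply: low; lia | lia].
Qed.

(** With [eps = 0] the defect bound vanishes and fixes [d 2]; the recurrence then propagates the two
    initial values, as it does for [sine]. *)
Lemma limiting_unique N d : (2 <= N)%N -> limiting_ratios N d ->
  d 2%N = 2 * cos (pi / N%:R) /\
  forall i, (1 <= i <= N.-1)%N -> d i = sine R N i / sine R N 1.
Proof.
move=> N2 ld; have [nd h4] := ld.
have s1 : 0 < sine R N 1 by apply: sine_gt0; lia.
have d2 : d 2%N = 2 * cos (pi / N%:R).
  have [d1 dN2 dN3 _] := nd.
  have [NE|N2'] := eqVneq N 2%N; first by rewrite dN2// NE cos_pihalf mulr0.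
  have [NE|N3'] := eqVneq N 3%N.
    rewrite dN3// NE; have := @sineSS R 3 0; rewrite sine0 add0r.
    have -> : sine R 3 2 = sine R 3 1 by rewrite -(@sine_sym R 3 1).
    by rewrite NE in s1; rewrite -[LHS]mul1r => /(mulIf (lt0r_neq0 s1)).
  have N4 : (4 <= N)%N by lia.
  have [bal _ _] := h4 N4.
  (* Any finite bound on the logarithms serves here, since it is multiplied by [eps = 0]; the sum of
     their absolute values is one. *)
  have := @balanced_defect N 0 (\sum_(i < N) `|ln (d i)|) d N4 (lexx _) nd bal
    (limiting_positive N4 ld).
  rewrite mul0r normr_le0 subr_eq0 => H; apply/eqP; apply: H => i /andP[_ iN].
  by rewrite (bigD1 (Ordinal iN))//= lerDl sumr_ge0.
split=> //.
have [d1 dN2 dN3 _] := nd.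
suff H k : (1 < k <= N)%N -> (forall i, (0 < i < k)%N -> d i = sine R N i / sine R N 1).
  by move=> i iN; apply: (H N); lia.
elim: k => // k IH kN i ik.
have [i1|i1] := eqVneq i 1%N; first by rewrite i1 d1 divff ?gt_eqF.
have [i2|i2] := eqVneq i 2%N.
  rewrite i2 d2; have := sineSS R N 0; rewrite sine0 add0r => ->.
  by rewrite mulfK// gt_eqF.
have [ik'|ik'] := ltnP i k; first by apply: IH; lia.
have N4 : (4 <= N)%N by lia.
have [bal _ _] := h4 N4.
case: i ik i1 i2 ik' => [|[|i]]// ik i1 i2 ik'.
have := @full_ratios_balanced N 0 d i.+1 N4 nd bal ltac:(lia).
rewrite mul0r addr0 /full_ratios/= !ifT; try lia.
have := sineSS R N i.
rewrite (IH ltac:(lia) i ltac:(lia)) (IH ltac:(lia) i.+1 ltac:(lia)) d2.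
move=> H1 /(canRL (addKr _)) ->; rewrite mulrA -H1; ring.
Qed.

(** Existence makes the [xget] in [limiting_ratio] meaningful. The bound [1 < d 2] compares
    [cos (pi / N)] with [cos (pi / 3)], and monotonicity holds because the angles up to the middle
    index stay below [pi / 2]. *)
Lemma limiting_exists N : (2 <= N)%N ->
  limiting_ratios N (fun i => sine R N i / sine R N 1).
Proof.
move=> N2; set d := fun i => _.
have s1 : 0 < sine R N 1 by apply: sine_gt0; lia.
have rec i : d i + d i.+2 = 2 * cos (pi / N%:R) * d i.+1.
  by rewrite /d -mulrDl sineSS mulrA.
have d0 : d 0%N = 0 by rewrite /d sine0 mul0r.
have d1 : d 1%N = 1 by rewrite /d divff// gt_eqF.
have d2 : d 2%N = 2 * cos (pi / N%:R) by have := rec 0%N; rewrite d0 d1 add0r mulr1.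
have ds i : (i <= N)%N -> d (N - i)%N = d i by move=> iN; rewrite /d sine_sym//; lia.
split.
  split => //.
  - by move=> NE; rewrite d2 NE cos_pihalf mulr0.
  - by move=> NE; rewrite -ds ?NE//= d1.
  - by move=> i i1 i2; rewrite ds//; lia.
move=> N4; split.
- split.
    move=> [|i]// i1 i2 /=; rewrite d2 -rec; ring.
  rewrite d2; case nE: N./2 => [|n] /=; first by lia.
  rewrite oppr0 !mul0r mulrBl -rec.
  have : d n.+2 = if odd N then d n.+1 else d n.
    by rewrite -ds; [case: ifP => oN; congr d; lia | lia].
  rewrite !modn2/= => ->; case: odd => /=.
    by rewrite expr0; ring.
  by rewrite expr1; ring.
- rewrite d2; have := @lambda_gt0 R N N2; rewrite subr_gt0 => ->; rewrite andbT.
  have p := pi_gt0 R.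
  have N0 : 0 < N%:R :> R by rewrite ltr0n; lia.
  have c3 : 2 * cos (pi / 3%:R) = 1 :> R.
    have := @sineSS R 3 0; rewrite sine0 add0r.
    have -> : sine R 3 2 = sine R 3 1 by rewrite -(@sine_sym R 3 1).
    have s3 : 0 < sine R 3 1 by apply: sine_gt0.
    by rewrite -[LHS]mul1r => /(mulIf (lt0r_neq0 s3)).
  have mem k : (1 <= k)%N -> pi / k%:R \in `[0, pi :> R]%R.
    move=> k1; have k0 : 0 < k%:R :> R by rewrite ltr0n.
    rewrite in_itv/= ltW ?divr_gt0//= ler_pdivrMr// ler_peMr ?ler1n//.
    exact: ltW.
  rewrite -[X in X < _]c3 ltr_pM2l// ltr_cos ?mem//; last lia.
  by rewrite ltr_pM2l// ltf_pV2 ?posrE ?ltr_nat.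
- move=> n3 i i2 iN; rewrite /d ltr_pM2r ?invr_gt0// /sine.
  have p := pi_gt0 R.
  have N0 : 0 < N%:R :> R by rewrite ltr0n; lia.
  have hs k : (k <= N./2)%N -> k%:R * (pi / N%:R) \in `[- (pi / 2), pi / 2 :> R]%R.
    move=> kN; set t := pi / N%:R; have t0 : 0 < t by exact: divr_gt0.
    have Nt : N%:R * t = pi by rewrite /t mulrC divfK// gt_eqF.
    have k2 : k%:R * 2 <= N%:R :> R by rewrite -natrM ler_nat; lia.
    have kt0 : 0 <= k%:R * t by apply: mulr_ge0; [rewrite ler0n | exact: ltW].
    have := ler_wpM2r (ltW t0) k2; rewrite Nt in_itv/= => H.
    by apply/andP; split; lra.
  rewrite ltr_sin ?hs//; try lia.
  by rewrite ltr_pM2r ?ltr_nat// divr_gt0.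
Qed.

Lemma limiting_ratioP N : (2 <= N)%N -> limiting_ratios N (limiting_ratio R N).
Proof. by move=> N2; exact: (xgetI _ (limiting_exists N2)). Qed.

Lemma limiting_ratio2 N : (2 <= N)%N -> limiting_ratio R N 2 = 2 * cos (pi / N%:R).
Proof. by move=> N2; case: (limiting_unique N2 (limiting_ratioP N2)). Qed.

Lemma limiting_ratioE N i : (2 <= N)%N -> (1 <= i <= N.-1)%N ->
  limiting_ratio R N i = sin (i%:R * pi / N%:R) / sin (pi / N%:R).
Proof.
move=> N2 iN; case: (limiting_unique N2 (limiting_ratioP N2)) => _ -> //.
by rewrite /sine mul1r mulrA.
Qed.

Lemma limiting_ratio_gt0 N i : (2 <= N)%N -> (0 < i < N)%N -> 0 < limiting_ratio R N i.
Proof.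
move=> N2 iN; case: (limiting_unique N2 (limiting_ratioP N2)) => _ ->; last lia.
by rewrite divr_gt0 ?sine_gt0//; lia.
Qed.

End LimitingRatios.

(** * Lowest Rayleigh quotient of a weighted path *)

Section Rayleigh.
Variable R : realType.
Implicit Types (N : nat) (A C c : nat -> R).

Definition energy N C c : R := \sum_(1 <= i < N) C i * (c i - c i.+1) ^+ 2.
Definition mass N A c : R := \sum_(1 <= j < N.+1) A j * c j ^+ 2.
Definition mean N A c : R := \sum_(1 <= j < N.+1) A j * c j.

Lemma energyZ N C c k : energy N C (fun j => k * c j) = k ^+ 2 * energy N C c.
Proof. by rewrite /energy mulr_sumr; apply: eq_bigr => i _; ring. Qed.

Lemma massZ N A c k : mass N A (fun j => k * c j) = k ^+ 2 * mass N A c.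
Proof. by rewrite /mass mulr_sumr; apply: eq_bigr => i _; ring. Qed.

Lemma meanZ N A c k : mean N A (fun j => k * c j) = k * mean N A c.
Proof. by rewrite /mean mulr_sumr; apply: eq_bigr => i _; ring. Qed.

Lemma mass_gt0 N A c : (forall j, (1 <= j <= N)%N -> 0 < A j) ->
  (exists2 j, (1 <= j <= N)%N & c j != 0) -> 0 < mass N A c.
Proof.
move=> Ap [j jN cj]; rewrite /mass big_add1/= big_mkord.
have jN' : (j.-1 < N)%N by lia.
have jE : j.-1.+1 = j by lia.
rewrite (bigD1 (Ordinal jN'))//= jE ltr_pwDl//.
  by rewrite mulr_gt0 ?Ap// lt_def sqr_ge0 sqrf_eq0 cj.
by apply: sumr_ge0 => i _; rewrite mulr_ge0 ?sqr_ge0// ltW// Ap//; have := ltn_ord i; lia.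
Qed.

Lemma continuous_sumr (T : topologicalType) (I : Type) (r : seq I) (F : I -> T -> R) :
  (forall i, continuous (F i)) -> continuous (fun x => \sum_(i <- r) F i x).
Proof. by move=> cF; apply: continuous_big => [|i _]; [exact: add_continuous | exact: cF]. Qed.

Lemma continuous_extend q n : continuous (fun v : 'rV[R]_q => extend (v ord0) n).
Proof.
rewrite /extend; apply: continuous_sumr => i v.
exact: (cvgM (coord_continuous (i := ord0) (j := i) (x := v)) (cvg_cst _)).
Qed.

(** The quotient is homogeneous of degree zero, so it suffices to minimize a continuous function on
    the unit sphere intersected with the hyperplane of zero weighted mean, which is compact. *)
Lemma lowest_rayleigh_exists N A C : (2 <= N)%N ->
  (forall j, (1 <= j <= N)%N -> 0 < A j) ->
  exists mu, is_lowest_rayleigh N A C mu.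
Proof.
move=> N2 Ap.
pose ext (v : 'rV[R]_N) := extend (v ord0).
pose S := [set v : 'rV[R]_N | `|v| = 1] `&` [set v | mean N A (ext v) = 0].
have cmean : continuous (fun v : 'rV[R]_N => mean N A (ext v)).
  rewrite /mean.
  apply: continuous_sumr => i v.
  exact: (cvgM (cvg_cst (A i)) (@continuous_extend N i v)).
have cenergy : continuous (fun v : 'rV[R]_N => energy N C (ext v)).
  rewrite /energy.
  apply: continuous_sumr => i v.
  have D : ext w i - ext w i.+1 @[w --> v] --> ext v i - ext v i.+1.
    exact: cvgB (@continuous_extend N i v) (@continuous_extend N i.+1 v).
  exact: (cvgM (cvg_cst (C i)) (cvgM D D)).
have cmass : continuous (fun v : 'rV[R]_N => mass N A (ext v)).
  rewrite /mass.
  apply: continuous_sumr => i v.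
  have D : ext w i @[w --> v] --> ext v i.
    exact: (@continuous_extend N i v).
  exact: (cvgM (cvg_cst (A i)) (cvgM D D)).
have cS : compact S.
  apply: bounded_closed_compact.
    exists 1; split; first exact: num_real.
    by move=> M M1 v [/= -> _]; exact: ltW.
  apply: closedI.
    have := (continuous_closedP (fun v : 'rV[R]_N => `|v|)).1 (@norm_continuous _ _).
    by move=> /(_ [set x | x = 1] (@closed_eq _ _)).
  by have := (continuous_closedP _).1 cmean; move=> /(_ [set x | x = 0] (@closed_eq _ _)).
have norm_in c : (exists2 j, (1 <= j <= N)%N & c j != 0) -> mean N A c = 0 ->
    exists2 v, S v & energy N C c / mass N A c = energy N C (ext v) / mass N A (ext v).
  move=> [j jN cj] c0; pose w : 'rV[R]_N := \row_i c i.+1.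
  have wE k : (1 <= k <= N)%N -> ext w k = c k.
    by case: k => // k kN; rewrite /ext (extendE _ (Ordinal kN)) mxE.
  have w0 : w != 0.
    have jN' : (j.-1 < N)%N by lia.
    apply: contra cj => /eqP /rowP /(_ (Ordinal jN')); rewrite !mxE/= => <-.
    by apply/eqP; congr c; lia.
  have k0 : `|w|^-1 != 0 by rewrite invr_eq0 normr_eq0.
  pose v := `|w|^-1 *: w.
  have vE : ext v = fun k => `|w|^-1 * ext w k.
    apply/funext => k; rewrite /ext /extend mulr_sumr.
    by apply: eq_bigr => i _; rewrite !mxE mulrA.
  exists v.
    split; first by rewrite /= normrZ normfV normr_id mulVf// normr_eq0.
    rewrite /=.
    have -> : mean N A (ext v) = `|w|^-1 * mean N A c; last by rewrite c0 mulr0.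
    rewrite vE meanZ; congr (_ * _).
    by rewrite /mean; apply: eq_big_nat => k kN; rewrite wE.
  rewrite vE energyZ massZ -mulf_div divff ?sqrf_eq0// mul1r; congr (_ / _).
    by rewrite /energy; apply: eq_big_nat => k kN; rewrite !wE//; lia.
  by rewrite /mass; apply: eq_big_nat => k kN; rewrite !wE.
have S_ne v : S v -> exists2 j, (1 <= j <= N)%N & ext v j != 0.
  move=> [/= v1 _]; apply: contrapT => H.
  suff v0 : v = 0 by move: v1; rewrite v0 normr0 => /eqP; rewrite eq_sym oner_eq0.
  apply/rowP => i; rewrite mxE; apply/eqP/negPn/negP => vi.
  by apply: H; exists i.+1; [rewrite ltn_ord | rewrite /ext extendE].
have S0 : S !=set0.
  (* The vector [(A 2, - A 1, 0, ...)] has zero weighted mean and shows that the constraint set is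
     nonempty. *)
  pose c j : R := if j == 1%N then A 2%N else if j == 2%N then - A 1%N else 0.
  have [||v Sv _] := norm_in c; last by exists v.
  - by exists 1%N; [lia | rewrite /c/= gt_eqF ?Ap//; lia].
  - rewrite /mean big_ltn 1?big_ltn; [|lia..].
    rewrite big_nat big1 ?addr0 /c/=; first by ring.
    by move=> [|[|[|i]]]//= _; rewrite mulr0.
have cq : {within S, continuous (fun v => energy N C (ext v) / mass N A (ext v))}.
  apply: continuous_in_subspaceT => v; rewrite inE => Sv.
  have m0 : mass N A (ext v) != 0 by rewrite gt_eqF// mass_gt0//; exact: S_ne.
  exact: (cvgM (cenergy v) (cvgV m0 (cmass v))).
have [v0 v0S v0min] := EVT_min_rV S0 cS cq.
rewrite inE in v0S; exists (energy N C (ext v0) / mass N A (ext v0)); split.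
  by exists (ext v0); split => //; [exact: S_ne | case: v0S].
move=> r [c [c1 c2 ->]]; have [v Sv ->] := norm_in c c1 c2.
by apply: v0min; rewrite inE.
Qed.

Lemma wirtinger_shift N c : (2 <= N)%N ->
  (2 - 2 * cos (pi / N%:R)) * (\sum_(1 <= j < N.+1) (c j - (\sum_(1 <= j < N.+1) c j) / N%:R) ^+ 2) <=
  \sum_(1 <= i < N) (c i - c i.+1) ^+ 2.
Proof.
move=> N2; set s := (\sum_(1 <= j < N.+1) c j) / N%:R.
have := @wirtinger R N (fun j => c j - s) N2.
rewrite sumrB sumr_const_nat subSS subn0 -[s *+ N]mulr_natr /s divfK ?subrr.
  move=> /(_ erefl) H; apply: le_trans H _; apply: ler_sum => i _.
  by rewrite le_eqVlt; apply/orP; left; apply/eqP; ring.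
by rewrite pnatr_eq0; lia.
Qed.

(** Two one-sided comparisons, [(1 - d) * l <= (1 + d) * mu] and [(1 - d) * mu <= (1 + d) * l],
    suffice: since [d <= 1 / 2], the relative error [2 * d / (1 - d)] is at most [4 * d]. *)
Lemma lowest_rayleigh_near N A C (a k d l mu : R) : (2 <= N)%N ->
  l = k / a * (2 - 2 * cos (pi / N%:R)) -> 0 < a -> 0 < k -> 0 <= d <= 1 / 2 ->
  (forall j, (1 <= j <= N)%N -> `|A j - a| <= d * a) ->
  (forall i, (1 <= i < N)%N -> `|C i - k| <= d * k) ->
  is_lowest_rayleigh N A C mu ->
  `|mu - l| <= 4 * d * l.
Proof.
move=> N2 ldef a0 k0 /andP[d0 d1] Ha Hk [[c [c1 c2 muE]] mumin].
have lam := lambda_gt0 R N2; set lm := 2 - 2 * _ in lam ldef *.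
have Ap j : (1 <= j <= N)%N -> 0 < A j by move=> /Ha; rewrite ler_norml; nra.
have l0 : 0 < l by rewrite ldef mulr_gt0 ?divr_gt0.
have mc := mass_gt0 Ap c1.
rewrite -[\sum_(1 <= j < N.+1) A j * c j]/(mean N A c) in c2.
rewrite -[\sum_(1 <= j < N.+1) _]/(mass N A c) -[\sum_(1 <= j < N) _]/(energy N C c) in muE.
have lE : l * a = k * lm by rewrite ldef; field; rewrite gt_eqF.
(* the weighted mean minimizes the weighted variance *)
have lower : (1 - d) * l <= (1 + d) * mu.
  have W := wirtinger_shift c N2; rewrite -/lm in W.
  move: W; set s := _ / N%:R => W; set V := \sum_(1 <= j < N.+1) _ in W.
  set Q := \sum_(1 <= i < N) _ in W.
  have mV : mass N A c <= (1 + d) * a * V.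
    have -> : mass N A c = mass N A (fun j => c j - s) - s ^+ 2 * \sum_(1 <= j < N.+1) A j.
      transitivity (mass N A c - 2 * s * mean N A c).
        by rewrite c2 mulr0 subr0.
      rewrite /mass /mean !mulr_sumr -!sumrB.
      by apply: eq_bigr => j _; ring.
    rewrite lerBlDr ler_wpDr//.
      rewrite mulr_ge0 ?sqr_ge0// big_nat sumr_ge0// => j jN.
      by rewrite ltW ?Ap.
    rewrite /mass /V mulr_sumr big_nat [leRHS]big_nat; apply: ler_sum => j jN.
    by rewrite ler_wpM2r ?sqr_ge0//; have := Ha j jN; rewrite ler_norml; nra.
  have eQ : (1 - d) * k * Q <= energy N C c.
    rewrite /energy /Q mulr_sumr big_nat [leRHS]big_nat; apply: ler_sum => j jN.
    by rewrite ler_wpM2r ?sqr_ge0//; have := Hk j jN; rewrite ler_norml; nra.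
  have mueq : mu * mass N A c = energy N C c by rewrite muE divfK ?gt_eqF.
  have mu0 : 0 <= mu.
    rewrite muE divr_ge0 ?(ltW mc)//; apply: le_trans eQ.
    by rewrite !mulr_ge0 ?subr_ge0 ?(ltW k0)//; [lra | apply: sumr_ge0 => i _; exact: sqr_ge0].
  have V0 : 0 < V.
    have := lt_le_trans mc mV; rewrite pmulr_rgt0// mulr_gt0//; lra.
  rewrite -(ler_pM2r V0) -(ler_pM2r a0).
  have h1 : mu * mass N A c <= mu * ((1 + d) * a * V) by rewrite ler_wpM2l.
  have h2 : (1 - d) * k * (lm * V) <= (1 - d) * k * Q.
    by rewrite ler_wpM2l// mulr_ge0 ?(ltW k0)//; lra.
  have -> : (1 - d) * l * V * a = (1 - d) * k * (lm * V).
    by rewrite -[RHS]mulrA [k * _]mulrA -lE; ring.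
  by apply: le_trans h2 _; apply: le_trans eQ _; rewrite -mueq; lra.
(* test vector: a shift of the lowest Neumann eigenvector *)
have upper : (1 - d) * mu <= (1 + d) * l.
  pose g := cosine R N; pose sA := \sum_(1 <= j < N.+1) A j.
  have sA0 : 0 < sA.
    rewrite /sA big_ltn; last lia.
    rewrite ltr_pwDl ?Ap//; first lia.
    by rewrite big_nat sumr_ge0// => j jN; rewrite ltW ?Ap//; lia.
  pose s := mean N A g / sA; pose h j := g j - s.
  have h0 : mean N A h = 0.
    have -> : mean N A h = mean N A g - s * sA.
      by rewrite /mean /sA mulr_sumr -sumrB; apply: eq_bigr => j _; rewrite /h; ring.
    by rewrite /s divfK ?subrr ?gt_eqF.
  pose Q := \sum_(1 <= j < N.+1) g j ^+ 2.
  have Q0 : 0 < Q.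
    rewrite /Q big_ltn; last lia.
    rewrite ltr_pwDl//; first by rewrite exprn_gt0// cosine1_gt0.
    by apply: sumr_ge0 => i _; exact: sqr_ge0.
  have g0 := sum_cosine R N2; rewrite -/g in g0.
  (* [g] has zero sum, so shifting it by a constant can only increase its sum of squares. *)
  have QV : Q <= \sum_(1 <= j < N.+1) h j ^+ 2.
    have -> : \sum_(1 <= j < N.+1) h j ^+ 2 = Q - 2 * s * (\sum_(1 <= j < N.+1) g j)
        + \sum_(1 <= j < N.+1) s ^+ 2.
      rewrite /Q mulr_sumr -sumrB -big_split/=; apply: eq_bigr => j _.
      by rewrite /h; ring.
    rewrite g0 mulr0 subr0 lerDl; apply: sumr_ge0 => i _; exact: sqr_ge0.
  have mh : (1 - d) * a * Q <= mass N A h.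
    apply: (@le_trans _ _ ((1 - d) * a * \sum_(1 <= j < N.+1) h j ^+ 2)).
      by rewrite ler_wpM2l// mulr_ge0 ?(ltW a0)//; lra.
    rewrite /mass mulr_sumr big_nat [leRHS]big_nat; apply: ler_sum => j jN.
    by rewrite ler_wpM2r ?sqr_ge0//; have := Ha j jN; rewrite ler_norml; nra.
  have mh0 : 0 < mass N A h.
    by apply: lt_le_trans mh; rewrite !mulr_gt0//; lra.
  have eh : energy N C h <= (1 + d) * k * (lm * Q).
    have -> : lm * Q = \sum_(1 <= i < N) (g i - g i.+1) ^+ 2 by rewrite energy_cosine.
    rewrite /energy mulr_sumr big_nat [leRHS]big_nat; apply: ler_sum => j jN.
    have -> : h j - h j.+1 = g j - g j.+1 by rewrite /h; ring.
    by rewrite ler_wpM2r ?sqr_ge0//; have := Hk j jN; rewrite ler_norml; nra.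
  have hne : exists2 j, (1 <= j <= N)%N & h j != 0.
    apply: contrapT => H; move: mh0; rewrite /mass big_nat big1 ?ltxx// => j jN.
    have [->|hj] := eqVneq (h j) 0; first by rewrite expr0n/= mulr0.
    by exfalso; apply: H; exists j.
  have : mu <= energy N C h / mass N A h by apply: mumin; exists h.
  rewrite ler_pdivlMr// => le1.
  have mu0 : 0 <= mu by have : 0 <= (1 + d) * mu; [apply: le_trans lower; apply: mulr_ge0; [lra | exact: ltW] | rewrite pmulr_rge0//; lra].
  rewrite -(ler_pM2r Q0) -(ler_pM2r a0).
  have -> : (1 + d) * l * Q * a = (1 + d) * k * (lm * Q).
    by rewrite -[RHS]mulrA [k * _]mulrA -lE; ring.
  apply: le_trans eh; apply: le_trans le1.
  have := ler_wpM2l mu0 mh; lra.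
rewrite ler_norml; apply/andP; split; nra.
Qed.

End Rayleigh.

(** * Integrals and areas in the plane *)

Section Integrals.
Local Open Scope ereal_scope.
Import HBNNSimple.

(* [f] need not be measurable: both bounds come from the definition of the
   integral as a supremum over simple functions below [f]. *)
Lemma integral_sandwich d (T : measurableType d) (R : realType)
  (mu : {measure set T -> \bar R}) (D N : set T) (f : T -> R) (lo hi : R) :
  measurable D -> measurable N -> mu N = 0 -> (0 <= lo)%R -> (0 <= hi)%R ->
  (forall x, D x -> (0 <= f x)%R) ->
  (forall x, D x -> ~ N x -> (lo <= f x <= hi)%R) ->
  lo%:E * mu D <= \int[mu]_(x in D) (f x)%:E <= hi%:E * mu D.
Proof.
move=> mD mN N0 lo0 hi0 f0 fb; apply/andP; split.
- have -> : mu D = mu (D `\` N).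
    apply/eqP; rewrite eq_le; apply/andP; split; last first.
      by apply: le_measure; rewrite ?inE//; exact: measurableD.
    rewrite [leRHS](_ : _ = mu (D `\` N) + mu N); last by rewrite N0 adde0.
    apply: le_trans (measureU2 _ _ _) => //; last exact: measurableD.
    apply: le_measure; rewrite ?inE//; first by apply: measurableU => //; exact: measurableD.
    by move=> x Dx; have [Nx|Nx] := pselect (N x); [right | left].
  (* This simple function lies below [f] on all of [D], also on [N], where only [0 <= f] is known
     and [h] is zero. *)
  pose h := mul_nnsfun (cst_nnsfun T (NngNum lo0)) (indic_nnsfun R (measurableD mD mN)).
  have hE x : h x = (lo * \1_(D `\` N) x)%R by [].
  rewrite ge0_integralE; last by move=> x Dx; rewrite lee_fin f0.
  apply: ereal_sup_ubound => /=; exists h.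
    move=> x; rewrite hE indicE /patch.
    have [Dx|Dx] := boolP (x \in D); last first.
      rewrite memNset ?mulr0//= => -[Dx' _].
      by move/negP: Dx; apply; rewrite inE.
    rewrite inE in Dx; have [Nx|Nx] := pselect (N x).
      by rewrite memNset ?mulr0 ?lee_fin ?f0//= => -[_]; apply.
    by rewrite mem_set// mulr1 lee_fin; case/andP: (fb _ Dx Nx).
  have -> : (h : T -> R) = (cst lo \* indic_nnsfun R (measurableD mD mN))%R :> (T -> R).
    by [].
  by rewrite (sintegralrM mu lo (indic_nnsfun R (measurableD mD mN))) sintegral_indic//; exact: measurableD.
- rewrite ge0_integralE; last by move=> x Dx; rewrite lee_fin f0.
  apply: ge_ereal_sup => /= _ [h hf <-].
  rewrite -integralT_nnsfun -integral_cst//.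
  rewrite [leRHS]integral_mkcond.
  apply: ae_ge0_le_integral => //.
  - by move=> x _; rewrite lee_fin; exact: fun_ge0.
  - exact/measurable_EFinP.
  - by move=> x _; rewrite /patch; case: ifP => // _; rewrite lee_fin.
  - by apply: (measurable_restrictT _ _).1 => //; exact: measurable_cst.
  exists N; split => // x /=; apply: contra_notP => Nx _.
  apply: le_trans (hf x) _; rewrite /patch; case: ifP => //.
  by rewrite inE => Dx; rewrite lee_fin; case/andP: (fb _ Dx Nx).
Qed.

End Integrals.

Section Plane.
Variable R : realType.
Local Notation mu1 := (@lebesgue_measure R).
Local Notation mu2 := (@lebesgue_measure R \x @lebesgue_measure R)%E.

Lemma lebesgue_measure_shift (a : R) (A : set R) : measurable A ->
  pushforward mu1 (fun x : R => (x + a : measurableTypeR R)) A = mu1 A.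
Proof.
move=> mA.
have mf : measurable_fun setT (fun x : R => (x + a : measurableTypeR R)).
  by apply: measurable_funD; [exact: measurable_id | exact: measurable_cst].
apply/esym/lebesgue_measure_unique => //=.
move=> _ [[u v]] _ <-.
rewrite /pushforward.
have -> : (fun x => x + a) @^-1` `]u, v] = `]u - a, v - a]%classic.
  by apply/seteqP; split => x; rewrite /= !in_itv/= ltrBlDr lerBrDr.
by rewrite /= !lebesgue_measure_itv/= !lte_fin ltrD2r; case: ifP => //; rewrite -!EFinD => _; congr EFin; ring.
Qed.

Lemma plane_measure_shift (a b : R) (A : set (R * R)) : measurable A ->
  mu2 ((fun p : R * R => (p.1 + a, p.2 + b)) @^-1` A) = mu2 A.
Proof.
move=> mA.
pose f (p : measurableTypeR R * measurableTypeR R) :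
  measurableTypeR R * measurableTypeR R := (p.1 + a, p.2 + b).
have mf : measurable_fun setT f.
  apply/measurable_fun_pairP; split.
    by apply: measurable_funD; [exact: measurable_fst | exact: measurable_cst].
  by apply: measurable_funD; [exact: measurable_snd | exact: measurable_cst].
rewrite -[LHS]/(pushforward mu2 f A).
apply/esym/product_measure_unique => //= U V mU mV.
have mshift (c : R) (W : set (measurableTypeR R)) : measurable W ->
    measurable ((fun x : measurableTypeR R => (x + c : measurableTypeR R)) @^-1` W).
  move=> mW; rewrite -[X in measurable X]setTI.
  have mc : measurable_fun setT (fun x : measurableTypeR R => (x + c : measurableTypeR R)).
    by apply: measurable_funD; [exact: measurable_id | exact: measurable_cst].
  exact: mc.
rewrite -[LHS]/(mu2 (((fun x : R => x + a) @^-1` U) `*` ((fun x : R => x + b) @^-1` V))).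
rewrite product_measure1E; [|exact: mshift|exact: mshift].
by congr (_ * _)%E; exact: lebesgue_measure_shift.
Qed.

Lemma measurable_dist2 (c : R * R) :
  measurable_fun setT (fun p : measurableTypeR R * measurableTypeR R => dist2 p c).
Proof.
apply: (measurableT_comp (f := @Num.sqrt R)).
  by apply: continuous_measurable_fun; exact: sqrt_continuous.
apply: measurable_funD; apply: measurable_funX; apply: measurable_funB.
- exact: measurable_fst.
- exact: measurable_cst.
- exact: measurable_snd.
- exact: measurable_cst.
Qed.

Definition disc (c : R * R) (r : R) : set (measurableTypeR R * measurableTypeR R) :=
  [set p | dist2 p c < r].

Definition circle (c : R * R) (r : R) : set (measurableTypeR R * measurableTypeR R) :=
  [set p | dist2 p c = r].

Lemma measurable_disc c r : measurable (disc c r).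
Proof.
rewrite -[X in measurable X]setTI.
have -> : disc c r = (fun p => dist2 p c) @^-1` `]-oo, r[%classic.
  by apply/seteqP; split => p; rewrite /disc /= in_itv.
by apply: measurable_dist2 => //; exact: measurable_itv.
Qed.

Lemma measurable_circle c r : measurable (circle c r).
Proof.
rewrite -[X in measurable X]setTI.
have -> : circle c r = (fun p => dist2 p c) @^-1` [set r] by [].
by apply: measurable_dist2 => //; exact: measurable_set1.
Qed.

(** Every vertical section has at most two points, so Fubini gives measure zero. *)
Lemma circle_null c r : mu2 (circle c r) = 0%E.
Proof.
rewrite /product_measure1 integral0_eq// => x _ /=.
apply: countable_lebesgue_measure0.
set s := Num.sqrt (r ^+ 2 - (x - c.1) ^+ 2).
apply: (@sub_countable _ _ _ [set c.2 + s; c.2 - s]); last exact: finite_set_countable.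
apply: subset_card_le => y; rewrite /xsection/= inE /circle /dist2/= => E.
have : (y - c.2) ^+ 2 = s ^+ 2.
  have H : (x - c.1) ^+ 2 + (y - c.2) ^+ 2 = r ^+ 2.
    by rewrite -E sqr_sqrtr// addr_ge0// sqr_ge0.
  by rewrite /s sqr_sqrtr -H addrAC subrr add0r// sqr_ge0.
move=> /eqP; rewrite eqf_sqr => /orP[] /eqP H; [left|right]; rewrite /=; lra.
Qed.

Lemma half_chord_integral (r : R) : 0 < r ->
  (\int[mu1]_(x in `[(- r)%R, r]) (2 * Num.sqrt (r ^+ 2 - x ^+ 2))%:E = (pi * r ^+ 2)%:E)%E.
Proof.
move=> r0.
pose F (t : R) := r * sin t.
have dF (t : R) : is_derive t 1 F (r * cos t).
  by rewrite /F; apply: is_deriveZ.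
have F'E : (derive1 F) = (fun t => r * cos t) by apply/funext => t; rewrite derive1E derive_val.
have p := pi_gt0 R.
have cF' : continuous (derive1 F).
  by rewrite F'E => t; apply: cvgMl_tmp; exact: continuous_cos.
have cF : continuous F.
  by move=> t; apply: cvgMl_tmp; exact: continuous_sin.
have cG : continuous (fun x : R => 2 * Num.sqrt (r ^+ 2 - x ^+ 2)).
  have c1 : continuous (fun x : R => r ^+ 2 - x ^+ 2).
    by move=> x; apply: cvgB; [exact: cvg_cst | exact: exprn_continuous].
  have c2 : continuous (Num.sqrt \o (fun x : R => r ^+ 2 - x ^+ 2)).
    by move=> x; apply: (continuous_comp (c1 x)); exact: sqrt_continuous.
  by move=> x; apply: cvgMl_tmp; exact: c2.
have F1 : F (- (pi / 2)) = - r by rewrite /F sinN sin_pihalf mulrN1.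
have F2 : F (pi / 2) = r by rewrite /F sin_pihalf mulr1.
rewrite -[X in `[X, _]]F1 -[X in `[_, X]]F2.
rewrite integration_by_substitution_increasing; last 7 first.
- lra.
- move=> x y xI yI xy; rewrite /F ltr_pM2l//.
  by rewrite ltr_sin.
- by move=> x _; exact: cF'.
- by apply/cvg_ex; exists ((derive1 F) (- (pi / 2))); apply: cvg_at_right_filter; exact: cF'.
- by apply/cvg_ex; exists ((derive1 F) (pi / 2)); apply: cvg_at_left_filter; exact: cF'.
- split; first by move=> x _; apply: ex_derive.
    by apply: cvg_at_right_filter; exact: cF.
  by apply: cvg_at_left_filter; exact: cF.
- exact: (continuous_subspaceT cG).
pose H (t : R) := r ^+ 2 * (t + sin t * cos t).
have dH (t : R) : is_derive t 1 H (r ^+ 2 * (1 + (sin t * - sin t + cos t * cos t))).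
  rewrite /H; apply: is_deriveZ.
have cH : continuous H.
  by move=> t; apply: differentiable_continuous; apply/derivable1_diffP; apply: ex_derive.
pose h (t : R) := 2 * r ^+ 2 * cos t ^+ 2.
have ch : continuous h.
  by move=> t; apply: cvgMl_tmp; apply: cvgM; exact: continuous_cos.
transitivity (\int[mu1]_(x in `[(- (pi / 2))%R, (pi / 2)%R]) (h x)%:E)%E.
  apply: eq_integral => t; rewrite inE/= in_itv/= => tI; congr EFin.
  rewrite F'E /h -[LHS]/(2 * Num.sqrt (r ^+ 2 - (r * sin t) ^+ 2) * (r * cos t)).
  have -> : r ^+ 2 - (r * sin t) ^+ 2 = (r * cos t) ^+ 2.
    by rewrite !exprMn cos2sin2; ring.
  rewrite sqrtr_sqr ger0_norm; last by rewrite mulr_ge0 ?(ltW r0)// cos_ge0_pihalf.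
  by ring.
rewrite (@continuous_FTC2 _ h H).
- rewrite /H cos_pihalf cosN cos_pihalf -EFinB; congr EFin.
  by rewrite !mulr0 !addr0 -mulrBr opprK -splitr mulrC.
- lra.
- exact: (continuous_subspaceT ch).
- split; first by move=> x _; apply: ex_derive.
    by apply: cvg_at_right_filter; exact: cH.
  by apply: cvg_at_left_filter; exact: cH.
- move=> t _; rewrite derive1E derive_val /h.
  have := cos2Dsin2 t; set c := cos t; set s := sin t => E.
  by rewrite -[1 in LHS]E; ring.
Qed.

Lemma disc_measure0 (r : R) : 0 < r -> mu2 (disc (0, 0) r) = (pi * r ^+ 2)%:E.
Proof.
move=> r0; rewrite -half_chord_integral// [RHS]integral_mkcond /product_measure1.
apply: eq_integral => x _ /=.
set s := Num.sqrt (r ^+ 2 - x ^+ 2).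
(* [Num.sqrt] is zero at negative arguments, so this describes the empty section for [x] beyond the
   radius as well. *)
have -> : xsection (disc (0, 0) r) x = `](- s), s[%classic.
  apply/seteqP; split => y; rewrite /xsection/= inE /disc/= /dist2/= in_itv/= !subr0 -ltr_norml -sqrtr_sqr.
    rewrite -{1}(gtr0_norm r0) -sqrtr_sqr ltr_sqrt ?exprn_gt0// => H.
    rewrite ltr_sqrt; first lra.
    by have := sqr_ge0 y; lra.
  rewrite -[X in _ -> _ < X](gtr0_norm r0) -[X in _ -> _ < X]sqrtr_sqr [in X in _ -> X]ltr_sqrt ?exprn_gt0//.
  have [le0|gt0] := leP (r ^+ 2 - x ^+ 2) 0.
    by rewrite /s (ler0_sqrtr le0) => H; have := sqrtr_ge0 (y ^+ 2); rewrite leNgt H.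
  by rewrite ltr_sqrt//; lra.
rewrite lebesgue_measure_itv/= lte_fin patchE.
have s0 : 0 <= s := sqrtr_ge0 _.
have -> : (if - s < s then (s%:E - (- s)%:E)%E else 0%E) = (2 * s)%:E.
  case: ifP => [_|]; first by rewrite -EFinB; congr EFin; ring.
  by move=> /negbT; rewrite -leNgt => ss; congr EFin; lra.
case: ifPn => //; rewrite notin_setE/= in_itv/= -ler_norml => /negP; rewrite -ltNge => xr.
suff -> : s = 0 by rewrite mulr0.
rewrite /s ler0_sqrtr// subr_le0 -(real_normK (num_real x)).
by rewrite lerXn2r// ?nnegrE ?(ltW r0)// ltW.
Qed.

Lemma disc_measure c (r : R) : 0 < r -> mu2 (disc c r) = (pi * r ^+ 2)%:E.
Proof.
move=> r0; have := @plane_measure_shift (- c.1) (- c.2) _ (@measurable_disc (0, 0) r).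
rewrite (disc_measure0 r0) => <-; congr product_measure1.
by apply/seteqP; split => p; rewrite /disc /dist2/= !subr0.
Qed.

Lemma rectangle_measure (a b c d : R) : a <= b -> c <= d ->
  mu2 (`[a, b[%classic `*` `[c, d[%classic) = ((b - a) * (d - c))%:E.
Proof.
have E x y : x <= y -> mu1 `[x, y[%classic = (y - x)%:E.
  move=> xy; rewrite lebesgue_measure_itv/= lte_fin.
  by move: xy; rewrite le_eqVlt => /predU1P[->|->]; rewrite ?ltxx ?subrr// EFinB.
move=> ab cd; transitivity (mu1 `[a, b[%classic * mu1 `[c, d[%classic)%E.
  by apply: product_measure1E; exact: measurable_itv.
by rewrite !E// EFinM.
Qed.

End Plane.

(** * Measures of periodic sets *)

Section Periodic.
Context d (T : measurableType d) (R : realType) (mu : {measure set T -> \bar R}).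
Variables (h : T -> R) (tau : T -> T) (p : R) (B : set T).
Hypotheses (p0 : 0 < p) (mh : measurable_fun setT h) (mB : measurable B).
Hypotheses (htau : forall x, h (tau x) = h x + p).
Hypotheses (mutau : forall A, measurable A -> mu (tau @^-1` A) = mu A).
Hypothesis Btau : tau @^-1` B = B.

Let slab s t := B `&` h @^-1` `[s, t[%classic.

Let measurable_slab s t : measurable (slab s t).
Proof. by apply: measurableI => //; rewrite -[X in measurable X]setTI; exact: mh. Qed.

Let slab_cat s t u : s <= t -> t <= u -> mu (slab s u) = (mu (slab s t) + mu (slab t u))%E.
Proof.
move=> st tu; rewrite -measureU//; last first.
  by apply/seteqP; split => // x []; rewrite /slab/= !in_itv/= => -[_ /andP[_ a]] [_ /andP[b _]]; lra.
congr (mu _); apply/seteqP; split => x; rewrite /slab/= !in_itv/=.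
  by move=> [Bx /andP[a b]]; case: (ltP (h x) t) => ht; [left|right]; split => //; apply/andP.
by move=> [] [Bx /andP[a b]]; split => //; apply/andP; split; lra.
Qed.

Let slab_shift s t : mu (slab (s + p) (t + p)) = mu (slab s t).
Proof.
rewrite -mutau//; congr (mu _); rewrite /slab preimage_setI Btau; congr (_ `&` _).
by apply/seteqP; split => x; rewrite /= !in_itv/= htau lerD2r ltrD2r.
Qed.

(** The window of length [p] may start at [s] instead of [0]: translating the part in [[s, 0[] by
    one period completes the rest of the window to [[0, p[]. The freedom in [s] allows a window
    centred at a lattice node. *)
Lemma periodic_measure (s : R) n : - p <= s <= 0 ->
  mu (B `&` h @^-1` `[0, n%:R * p[%classic) =
  (mu (B `&` h @^-1` `[s, (s + p)%R[%classic) *+ n)%R.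
Proof.
move=> /andP[sp s0]; rewrite -/(slab _ _) -/(slab _ _).
have base : mu (slab 0 p) = mu (slab s (s + p)).
  have e1 := @slab_cat 0 (s + p) p ltac:(lra) ltac:(lra).
  have e2 := @slab_cat s 0 (s + p) ltac:(lra) ltac:(lra).
  have e3 := slab_shift s 0; rewrite add0r in e3.
  by rewrite e1 e2 e3 addeC.
rewrite -base; elim: n => [|n IH].
  rewrite mul0r mulr0n; have -> : slab 0 0 = set0; last exact: measure0.
  by apply/seteqP; split => // x [_]; rewrite /= in_itv/= => /andP[]; lra.
have n0 : 0 <= n%:R * p by rewrite mulr_ge0 ?(ltW p0).
rewrite (slab_cat (t := p)); [|lra|rewrite -natr1 mulrDl mul1r; lra].
have e : mu (slab p (n.+1%:R * p)) = mu (slab 0 (n%:R * p)).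
  by rewrite -[RHS]slab_shift add0r -natr1 mulrDl mul1r.
by rewrite e IH mulrS.
Qed.

End Periodic.

(** * Geometry of the toral graphs *)

Section Distance.
Variable R : realType.
Implicit Types p q : R * R.

Lemma dist2_ge0 p q : 0 <= dist2 p q.
Proof. exact: sqrtr_ge0. Qed.

Lemma dist2C p q : dist2 p q = dist2 q p.
Proof. by rewrite /dist2 -sqrrN opprB -[X in _ + X]sqrrN opprB. Qed.

Lemma dist2_ge1 p q : `|p.1 - q.1| <= dist2 p q.
Proof. by rewrite -sqrtr_sqr ler_wsqrtr// lerDl sqr_ge0. Qed.

Lemma dist2_ge2 p q : `|p.2 - q.2| <= dist2 p q.
Proof. by rewrite -sqrtr_sqr ler_wsqrtr// lerDr sqr_ge0. Qed.

Lemma sqrt_sum_triangle (a b c d : R) :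
  Num.sqrt ((a + c) ^+ 2 + (b + d) ^+ 2) <=
  Num.sqrt (a ^+ 2 + b ^+ 2) + Num.sqrt (c ^+ 2 + d ^+ 2).
Proof.
have A0 : 0 <= a ^+ 2 + b ^+ 2 by rewrite addr_ge0 ?sqr_ge0.
have C0 : 0 <= c ^+ 2 + d ^+ 2 by rewrite addr_ge0 ?sqr_ge0.
have := sqr_sqrtr A0; have := sqr_sqrtr C0.
have := sqrtr_ge0 (a ^+ 2 + b ^+ 2); have := sqrtr_ge0 (c ^+ 2 + d ^+ 2).
set u := Num.sqrt (a ^+ 2 + _); set v := Num.sqrt (c ^+ 2 + _) => v0 u0 vE uE.
have uv0 : 0 <= u + v by rewrite addr_ge0.
rewrite -(ger0_norm uv0) -sqrtr_sqr ler_wsqrtr//.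
suff H : a * c + b * d <= u * v by nra.
have uv : 0 <= u * v by rewrite mulr_ge0.
apply: le_trans (ler_norm _) _.
rewrite -(ger0_norm uv) -!sqrtr_sqr ler_wsqrtr// exprMn uE vE.
by have := sqr_ge0 (a * d - b * c); lra.
Qed.

Lemma dist2_triangle p q s : dist2 p s <= dist2 p q + dist2 q s.
Proof.
have := sqrt_sum_triangle (p.1 - q.1) (p.2 - q.2) (q.1 - s.1) (q.2 - s.2).
by rewrite /dist2 !addrA !subrK.
Qed.

End Distance.

Section Lattice.
Variables (R : realType) (D : stack_data R).
Notation N := (ntori D).
Notation k := (kk D).
Notation l := (ll D).
Notation m := (mm D).
Notation X := (cellX D).
Notation Y := (cellY D).
Notation r0 := (hole_radius D).
Hypotheses (k1 : (1 <= k)%N) (kl : (k <= l)%N) (m1 : (1 <= m)%N).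
Implicit Types (p q : R * R) (e : nat).

Let km0 : 0 < (k * m)%:R :> R.
Proof. by rewrite ltr0n muln_gt0 k1 m1. Qed.
Let lm0 : 0 < (l * m)%:R :> R.
Proof. by rewrite ltr0n muln_gt0 m1 andbT (leq_trans k1). Qed.
Let s20 : 0 < Num.sqrt 2 :> R. Proof. by rewrite sqrtr_gt0. Qed.

Lemma cellX_gt0 : 0 < X.
Proof. by rewrite /cellX divr_gt0 ?pi_gt0// mulr_gt0. Qed.

Lemma cellY_gt0 : 0 < Y.
Proof. by rewrite /cellY divr_gt0 ?pi_gt0// mulr_gt0. Qed.

Lemma hole_radius_gt0 : 0 < r0.
Proof. by rewrite /hole_radius invr_gt0 mulr_gt0. Qed.

Lemma hole_radius_le1 : r0 <= 1.
Proof.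
rewrite /hole_radius invf_le1; last by rewrite mulr_gt0.
have : 1 <= (l * m)%:R :> R by rewrite ler1n -(ltr0n R).
lra.
Qed.

Lemma cellY_le_cellX : Y <= X.
Proof.
rewrite /cellX /cellY ler_pM2l ?pi_gt0// lef_pV2 ?posrE ?mulr_gt0//.
by rewrite ler_pM2l// ler_nat leq_mul2r kl orbT.
Qed.

Lemma hole_radius_small : 4 * r0 < Y.
Proof.
have s2 : Num.sqrt 2 < 2 :> R.
  have s22 : Num.sqrt 2 ^+ 2 = 2 :> R by rewrite sqr_sqrtr.
  by rewrite ltNge; apply/negP => h; nra.
rewrite /hole_radius /cellY !invfM mulrA [X in _ < X]mulrA ltr_pM2r ?invr_gt0//.
rewrite ltr_pdivlMr//.
have := pi_ge2 R; lra.
Qed.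

Lemma periodX : (k * m)%:R * (2 * X) = Num.sqrt 2 * pi.
Proof.
rewrite /cellX; move: km0; move: ((k * m)%:R : R) => u u0.
have s22 : Num.sqrt 2 ^+ 2 = 2 :> R by rewrite sqr_sqrtr.
move: s20 s22; move: (Num.sqrt 2 : R) => s s0 s22.
have s0' := lt0r_neq0 s0; have u0' := lt0r_neq0 u0.
transitivity (2 / s * pi); first by field; rewrite s0' u0'.
by rewrite -s22 expr2 mulfK.
Qed.

Lemma periodY : (l * m)%:R * (2 * Y) = Num.sqrt 2 * pi.
Proof.
rewrite /cellY; move: lm0; move: ((l * m)%:R : R) => u u0.
have s22 : Num.sqrt 2 ^+ 2 = 2 :> R by rewrite sqr_sqrtr.
move: s20 s22; move: (Num.sqrt 2 : R) => s s0 s22.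
have s0' := lt0r_neq0 s0; have u0' := lt0r_neq0 u0.
transitivity (2 / s * pi); first by field; rewrite s0' u0'.
by rewrite -s22 expr2 mulfK.
Qed.

Definition node e (a b : int) : R * R :=
  (2 * X * a%:~R + e%:R * X, 2 * Y * b%:~R + e%:R * Y).

Lemma intr_dist_ge1 (a b : int) : a != b -> 1 <= `|a%:~R - b%:~R : R|.
Proof.
move=> ab; rewrite -rmorphB/= -intr_norm ler1z.
by have : 0 < `|a - b| by rewrite normr_gt0 subr_eq0; lia.
Qed.

(** In the box with half-sides [X], [Y] about a node, another node differs by a full period [2 * X]
    or [2 * Y] in some coordinate, hence is at distance at least [X] or [Y]; [Y] is the smaller by
    [k <= l]. *)
Lemma lattice_far e (a b : int) p q :
  `|p.1 - (node e a b).1| <= X -> `|p.2 - (node e a b).2| <= Y ->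
  lattice D e q -> q <> node e a b -> Y <= dist2 p q.
Proof.
move=> pX pY [a' [b' ->]] ne.
have X0 := cellX_gt0; have Y0 := cellY_gt0; have YX := cellY_le_cellX.
have [aa|aa] := eqVneq a' a.
  have bb : b' != b by apply/eqP => bb; apply: ne; rewrite aa bb.
  apply: le_trans (dist2_ge2 _ _); rewrite /= in pY *.
  have := ler_wpM2l (ltW Y0) (intr_dist_ge1 bb).
  rewrite mulr1 -{2}(gtr0_norm Y0) -normrM => H.
  move: pY H; rewrite ler_norml => /andP[h1 h2].
  by rewrite !ler_normr => /orP[] h3; apply/orP; [right|left]; lra.
apply: le_trans YX _; apply: le_trans (dist2_ge1 _ _); rewrite /= in pX *.
have := ler_wpM2l (ltW X0) (intr_dist_ge1 aa).
rewrite mulr1 -{2}(gtr0_norm X0) -normrM => H.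
move: pX H; rewrite ler_norml => /andP[h1 h2].
by rewrite !ler_normr => /orP[] h3; apply/orP; [right|left]; lra.
Qed.

Lemma round_ex (u x : R) : 0 < u -> exists a : int, `|x - 2 * u * a%:~R| <= u.
Proof.
move=> u0; exists (Num.floor (x / (2 * u) + 2^-1)).
set y := x / (2 * u); have xE : x = 2 * u * y by rewrite /y mulrC divfK// gt_eqF// mulr_gt0.
have /andP[] := floor_itv (y + 2^-1); set n := (Num.floor _)%:~R.
rewrite intrD -/n => h1 h2.
by rewrite xE ler_norml; apply/andP; split; nra.
Qed.

Lemma nearest_node e p : exists q, lattice D e q /\
  forall q', lattice D e q' -> q' <> q -> Y <= dist2 p q'.
Proof.
have [a Ha] := round_ex (p.1 - e%:R * X) cellX_gt0.
have [b Hb] := round_ex (p.2 - e%:R * Y) cellY_gt0.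
exists (node e a b); split; first by exists a, b.
move=> q' lq' ne; apply: (lattice_far (e := e) (a := a) (b := b)) lq' ne => /=.
  by move: Ha; rewrite -addrA -opprD [e%:R * X + _]addrC.
by move: Hb; rewrite -addrA -opprD [e%:R * Y + _]addrC.
Qed.

(** First coordinates are even multiples of [X] in one lattice and odd multiples in the other, so
    they differ by at least [X]. *)
Lemma lattice_separated q q' : lattice D 0 q -> lattice D 1 q' -> Y <= dist2 q q'.
Proof.
move=> [a [b ->]] [a' [b' ->]].
have X0 := cellX_gt0; have YX := cellY_le_cellX.
apply: le_trans YX _; apply: le_trans (dist2_ge1 _ _) => /=.
have ne : 2 * a != 2 * a' + 1 by lia.
have := ler_wpM2l (ltW X0) (intr_dist_ge1 ne).
rewrite mulr1 -{2}(gtr0_norm X0) -normrM !rmorphD !rmorphM/=.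
move=> /le_trans; apply; rewrite le_eqVlt; apply/orP; left; apply/eqP.
by congr `|_|; ring.
Qed.

Definition tunnels e : set (measurableTypeR R * measurableTypeR R) :=
  [set p | exists2 q, lattice D e q & dist2 p q < r0].

Lemma tunnels_disjoint p : tunnels 0 p -> tunnels 1 p -> False.
Proof.
move=> [q lq pq] [q' lq' pq'].
have := lattice_separated lq lq'; have := dist2_triangle q p q'.
rewrite (dist2C q p); have := hole_radius_small; have := hole_radius_gt0; lra.
Qed.

Lemma measurable_tunnels e : measurable (tunnels e).
Proof.
have -> : tunnels e = \bigcup_(ab : int * int) disc (node e ab.1 ab.2) r0.
  apply/seteqP; split => p.
    by move=> [_ [a [b ->]] pq]; exists (a, b).
  by move=> [[a b] _ pq]; exists (node e a b) => //; exists a, b.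
apply: countable_bigcupT_measurable; first exact: countableP.
by move=> ab; exact: measurable_disc.
Qed.

Lemma tunnels_periodic e (a b : int) :
  (fun p : R * R => (p.1 + 2 * X * a%:~R, p.2 + 2 * Y * b%:~R)) @^-1` (tunnels e) = tunnels e.
Proof.
apply/seteqP; split => p.
  move=> [_ [a' [b' ->]]] /= H; exists (node e (a' - a) (b' - b)); first by exists (a' - a), (b' - b).
  move: H; rewrite /dist2/= !rmorphB/=; congr (_ < _).
  by congr (Num.sqrt (_ ^+ 2 + _ ^+ 2)); ring.
move=> [_ [a' [b' ->]]] /= H; exists (node e (a' + a) (b' + b)); first by exists (a' + a), (b' + b).
move: H; rewrite /dist2/= !rmorphD/=; congr (_ < _).
by congr (Num.sqrt (_ ^+ 2 + _ ^+ 2)); ring.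
Qed.

Local Notation mu2 := (@lebesgue_measure R \x @lebesgue_measure R)%E.

Lemma tunnels_measure e : (e < 2)%N ->
  mu2 (tunnels e `&` @fundamental_square R) =
  ((lattice_size D)%:R * (pi * r0 ^+ 2))%:E.
Proof.
move=> e2.
have X0 := cellX_gt0; have Y0 := cellY_gt0; have YX := cellY_le_cellX.
have rs := hole_radius_small; have rp := hole_radius_gt0.
have eR : 0 <= (e%:R : R) <= 1 by rewrite ler0n lern1.
(* Starting points of the periods centred at [node e 0 0]; [e < 2] keeps them in the range that
   [periodic_measure] allows. By [lattice_far] such a cell meets only the one disc, and there are
   [k * m] times [l * m] cells. *)
pose sX := (e%:R - 1) * X; pose sY := (e%:R - 1) * Y.
have sXb : - (2 * X) <= sX <= 0 by rewrite /sX; apply/andP; split; nra.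
have sYb : - (2 * Y) <= sY <= 0 by rewrite /sY; apply/andP; split; nra.
pose T := (measurableTypeR R * measurableTypeR R)%type.
pose slab1 (a b : R) : set T := (fst : T -> R) @^-1` `[a, b[%classic.
pose slab2 (a b : R) : set T := (snd : T -> R) @^-1` `[a, b[%classic.
have m1' a b : measurable (slab1 a b).
  rewrite -[X in measurable X]setTI; apply: measurable_fst => //; exact: measurable_itv.
have m2' a b : measurable (slab2 a b).
  rewrite -[X in measurable X]setTI; apply: measurable_snd => //; exact: measurable_itv.
have mU := measurable_tunnels e.
have step1 := @periodic_measure _ T R mu2 fst (fun p => (p.1 + 2 * X, p.2 + 0)) (2 * X)
  (tunnels e `&` slab2 0 (Num.sqrt 2 * pi)) ltac:(lra) measurable_fst
  (measurableI _ _ mU (m2' _ _)) (fun x => erefl)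
  (fun A mA => plane_measure_shift (2 * X) 0 mA) _ sX (k * m) sXb.
have step2 := @periodic_measure _ T R mu2 snd (fun p => (p.1 + 0, p.2 + 2 * Y)) (2 * Y)
  (tunnels e `&` slab1 sX (sX + 2 * X)) ltac:(lra) measurable_snd
  (measurableI _ _ mU (m1' _ _)) (fun x => erefl)
  (fun A mA => plane_measure_shift 0 (2 * Y) mA) _ sY (l * m) sYb.
rewrite periodX in step1; rewrite periodY in step2.
have -> : tunnels e `&` @fundamental_square R =
   tunnels e `&` slab2 0 (Num.sqrt 2 * pi) `&` fst @^-1` `[0, (Num.sqrt 2 * pi)[%classic.
  by rewrite -setIA; congr (_ `&` _); rewrite setIC.
rewrite step1; last first.
  rewrite preimage_setI; congr (_ `&` _).
    have := tunnels_periodic e 1 0; rewrite mulr0 mulr1; exact.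
  by apply/seteqP; split => p; rewrite /slab2/= addr0.
have -> : tunnels e `&` slab2 0 (Num.sqrt 2 * pi) `&` fst @^-1` `[sX, (sX + 2 * X)[%classic
  = tunnels e `&` slab1 sX (sX + 2 * X) `&` snd @^-1` `[0, (Num.sqrt 2 * pi)[%classic.
  by rewrite -!setIA; congr (_ `&` _); rewrite setIC.
rewrite step2; last first.
  rewrite preimage_setI; congr (_ `&` _).
    have := tunnels_periodic e 0 1; rewrite mulr0 mulr1; exact.
  by apply/seteqP; split => p; rewrite /slab1/= addr0.
have -> : tunnels e `&` slab1 sX (sX + 2 * X) `&` snd @^-1` `[sY, (sY + 2 * Y)[%classic
  = disc (node e 0 0) r0.
  clear step1 step2 m1' m2' mU; apply/seteqP; split => p; rewrite /slab1/=.
    move=> [[[q lq pq] /=]]; rewrite !in_itv/= => /andP[h1 h2] /andP[h3 h4].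
    have [qE|qN] := pselect (q = node e 0 0); first by rewrite /disc/= -qE.
    have := lattice_far (e := e) (a := 0) (b := 0) (p := p) _ _ lq qN.
    rewrite /node/= !mulr0 !add0r /sX /sY in h1 h2 h3 h4 *.
    move=> /(_ ltac:(rewrite ler_norml; apply/andP; split; lra) ltac:(rewrite ler_norml; apply/andP; split; lra)).
    lra.
  rewrite /disc/= => H; split; first split.
  - by exists (node e 0 0) => //; exists 0, 0.
  - have := le_lt_trans (dist2_ge1 _ _) H; rewrite /node/= mulr0 add0r ltr_norml in_itv/= /sX.
    by move=> /andP[h1 h2]; apply/andP; split; lra.
  - have := le_lt_trans (dist2_ge2 _ _) H; rewrite /node/= mulr0 add0r ltr_norml in_itv/= /sY.
    by move=> /andP[h1 h2]; apply/andP; split; lra.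
apply: (etrans (congr1 (fun x : \bar R => (x *+ (l * m) *+ (k * m))%R)
  (disc_measure (node e 0 0) rp))).
rewrite -mulrnA.
have EFin_natmul (x : R) n : (x%:E *+ n)%R = (x *+ n)%:E.
  by elim: n => // n IH; rewrite !mulrS IH.
by rewrite EFin_natmul mulnACA [(l * k)%N]mulnC mulnn -/(lattice_size D) -[LHS]/(_%:E) mulr_natl.
Qed.

Lemma square_measure : mu2 (@fundamental_square R) = (2 * pi ^+ 2)%:E.
Proof.
have p := pi_gt0 R.
have sp : 0 <= Num.sqrt 2 * pi :> R by rewrite mulr_ge0 ?ltW.
rewrite /fundamental_square rectangle_measure// !subr0; congr EFin.
by rewrite -expr2 exprMn sqr_sqrtr.
Qed.

Lemma measurable_square :
  measurable (@fundamental_square R : set (measurableTypeR R * measurableTypeR R)).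
Proof. by apply: measurableX; exact: measurable_itv. Qed.

Definition holes j : set (measurableTypeR R * measurableTypeR R) :=
  if j == 1%N then tunnels 0
  else if j == N then tunnels (N %% 2)
  else tunnels 0 `|` tunnels 1.

Lemma perforatedE j : perforated D j = ~` holes j.
Proof.
rewrite /perforated /removal_points /holes; apply/seteqP; split => p /=.
  case: ifP => _; [|case: ifP => _].
  - by move=> H [q lq]; rewrite ltNge H.
  - by move=> H [q lq]; rewrite ltNge H.
  - by move=> H [] [q lq]; rewrite ltNge H//; [left|right].
case: ifP => _; [|case: ifP => _].
- by move=> H q lq; rewrite leNgt; apply/negP => pq; apply: H; exists q.
- by move=> H q lq; rewrite leNgt; apply/negP => pq; apply: H; exists q.
- by move=> H q [] lq; rewrite leNgt; apply/negP => pq; apply: H; [left|right]; exists q.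
Qed.

Lemma measurable_holes j : measurable (holes j).
Proof.
rewrite /holes; case: ifP => _; [|case: ifP => _]; try exact: measurable_tunnels.
by apply: measurableU; exact: measurable_tunnels.
Qed.

Lemma holes_measure j :
  mu2 (holes j `&` @fundamental_square R) =
  ((removal_count D j)%:R * (pi * r0 ^+ 2))%:E.
Proof.
rewrite /holes /removal_count.
case: ifP => j1 /=; first exact: tunnels_measure.
case: ifP => jN /=; first by apply: tunnels_measure; rewrite ltn_mod.
rewrite setIUl measureU; last first.
- apply/seteqP; split => // p [[h0 _] [h1 _]]; exact: tunnels_disjoint h0 h1.
- by apply: measurableI; [exact: measurable_tunnels | exact: measurable_square].
- by apply: measurableI; [exact: measurable_tunnels | exact: measurable_square].
apply: (etrans (congr2 adde (tunnels_measure (e := 0) isT) (tunnels_measure (e := 1) isT))).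
apply: (etrans (esym (EFinD _ _))).
by rewrite natrM; congr EFin; ring.
Qed.

Lemma measurable_perforated j :
  measurable (perforated D j `&` @fundamental_square R
    : set (measurableTypeR R * measurableTypeR R)).
Proof.
rewrite perforatedE; apply: measurableI; last exact: measurable_square.
by apply: measurableC; exact: measurable_holes.
Qed.

Lemma perforated_measure j :
  mu2 (perforated D j `&` @fundamental_square R) =
  (2 * pi ^+ 2 - (removal_count D j)%:R * pi * r0 ^+ 2)%:E.
Proof.
have H := holes_measure j; rewrite setIC in H.
rewrite perforatedE setIC -setDE measureD.
- apply: (etrans (congr2 (fun x y => x - y)%E square_measure H)).
  apply: (etrans (esym (EFinB _ _))).
  by rewrite mulrA.
- exact: measurable_square.
- exact: measurable_holes.
- exact: (eq_ind_r (fun x => x < +oo)%E (ltry _) square_measure).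
Qed.

End Lattice.

(** * Calculus of the cut-off and of the neck profile *)

Section Calculus.
Variable R : realType.
Implicit Types (x r s t : R) (psi : R -> R).

Lemma cutoff_ge0 psi s : cutoff psi -> 0 <= psi s.
Proof.
move=> [_ mono p0 _]; have [s0|s0] := leP s 0; first by rewrite p0.
by rewrite -(p0 0 (lexx _)); exact: mono (ltW s0).
Qed.

Lemma cutoff_le1 psi s : cutoff psi -> psi s <= 1.
Proof.
move=> [_ mono _ p1]; have [s1|s1] := leP 1 s; first by rewrite p1.
by rewrite -(p1 1 (lexx _)); exact: mono (ltW s1).
Qed.

Lemma cutoff_derivable psi s : cutoff psi -> derivable psi s 1.
Proof.
move=> [/(_ 1%N) /= [df _] _ _ _]; apply/derivable1_diffP.
exact: (df s I).
Qed.

(** The bound depends on [psi] alone, hence is uniform in [m]. *)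
Lemma cutoff_derive_bound psi : cutoff psi ->
  exists2 P, 0 <= P & forall s, 0 <= s <= 1 -> `|derive1 psi s| <= P.
Proof.
move=> [/(_ 2%N) /= [_ /(_ 1)] [df _] _ _ _].
have cont : continuous (fun s => `|derive1 psi s|).
  move=> s; apply: cvg_norm.
  have -> : derive1 psi = 'D_1 psi by apply/funext => u; rewrite derive1E.
  exact: (differentiable_continuous (df s I)).
have [c _ cmax] := EVT_max ler01 (continuous_subspaceT cont).
exists `|derive1 psi c|; first exact: normr_ge0.
by move=> s s01; apply: cmax; rewrite in_itv.
Qed.

Lemma ler_ln_arcosh x : 1 <= x -> ln x <= arcosh x.
Proof.
move=> x1; have x0 : 0 < x by rewrite (lt_le_trans ltr01).
rewrite /arcosh ler_ln ?posrE ?ltr_wpDr ?sqrtr_ge0//.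
by rewrite lerDl sqrtr_ge0.
Qed.

Lemma ler_arcosh_ln x : 1 <= x -> arcosh x <= ln (2 * x).
Proof.
move=> x1; have x0 : 0 < x by rewrite (lt_le_trans ltr01).
rewrite /arcosh ler_ln ?posrE ?ltr_wpDr ?sqrtr_ge0 ?mulr_gt0//.
have : Num.sqrt (x ^+ 2 - 1) <= Num.sqrt (x ^+ 2) by rewrite ler_wsqrtr// gerBl.
rewrite sqrtr_sqr ger0_norm ?(ltW x0)//; lra.
Qed.

Lemma arcosh_ge0 x : 1 <= x -> 0 <= arcosh x.
Proof. by move=> x1; apply: le_trans (ler_ln_arcosh x1); exact: ln_ge0. Qed.

Lemma ler_normM x y r s : `|x| <= r -> `|y| <= s -> `|x * y| <= r * s.
Proof. by move=> xr ys; rewrite normrM ler_pM. Qed.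

Lemma is_derive_chain (f g : R -> R) x y (a b : R) : g x = y ->
  is_derive y 1 f a -> is_derive x 1 g b -> is_derive x 1 (fun t => f (g t)) (a * b).
Proof. by move=> <-; exact: is_derive1_comp. Qed.

Lemma is_derive_arcosh x : 1 < x ->
  is_derive x 1 (@arcosh R) (Num.sqrt (x ^+ 2 - 1))^-1.
Proof.
move=> x1; have x0 : 0 < x by rewrite (lt_trans ltr01).
have y0 : 0 < x ^+ 2 - 1 by rewrite subr_gt0 exprn_egt1.
have s0 : 0 < Num.sqrt (x ^+ 2 - 1) by rewrite sqrtr_gt0.
have d1 : is_derive x 1 (fun x : R => x ^+ 2 - 1) (2 * x).
  apply: is_derive_eq; by rewrite /GRing.scale/=; ring.
have d2 := is_derive_chain (g := fun x : R => x ^+ 2 - 1) erefl (is_derive1_sqrt y0) d1.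
have d3 : is_derive x 1 (fun x : R => x + Num.sqrt (x ^+ 2 - 1))
    (1 + (2 * Num.sqrt (x ^+ 2 - 1))^-1 * (2 * x)).
  exact: is_deriveD.
have u0 : 0 < x + Num.sqrt (x ^+ 2 - 1) by rewrite addr_gt0.
have d4 := is_derive_chain (g := fun x : R => x + Num.sqrt (x ^+ 2 - 1)) erefl (is_derive1_ln u0) d3.
rewrite /arcosh; apply: is_derive_eq d4 _.
move: s0 u0; move: (Num.sqrt _) => s s0 u0.
by field; rewrite (gt_eqF s0) gt_eqF.
Qed.

Lemma is_derive_dist2_line (p q : R * R) (a b : R) : 0 < dist2 p q ->
  is_derive (0 : R) 1 (fun t : R => dist2 (p.1 + t * a, p.2 + t * b) q)
    (a * ((p.1 - q.1) / dist2 p q) + b * ((p.2 - q.2) / dist2 p q)).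
Proof.
move=> d0.
have sq0 : 0 < (p.1 + 0 * a - q.1) ^+ 2 + (p.2 + 0 * b - q.2) ^+ 2.
  by move: d0; rewrite /dist2 sqrtr_gt0 !mul0r !addr0.
have d1 : is_derive (0 : R) 1
    (fun t : R => (p.1 + t * a - q.1) ^+ 2 + (p.2 + t * b - q.2) ^+ 2)
    (2 * (p.1 - q.1) * a + 2 * (p.2 - q.2) * b).
  apply: is_derive_eq; rewrite /= !mul0r !addr0 !subr0 !add0r !scaler0 !add0r.
  by rewrite /GRing.scale/=; ring.
have := is_derive_chain (g := fun t : R =>
    (p.1 + t * a - q.1) ^+ 2 + (p.2 + t * b - q.2) ^+ 2) erefl (is_derive1_sqrt sq0) d1.
move=> H; apply: is_derive_eq; move: d0; rewrite /dist2 !mul0r !addr0.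
by move: (Num.sqrt _) => s s0; field; rewrite gt_eqF.
Qed.

End Calculus.

Section Transition.
Variables (R : realType) (D : stack_data R).
Notation N := (ntori D).
Notation r0 := (hole_radius D).
Hypotheses (hpsi : cutoff (step D)) (r0p : 0 < r0).
Implicit Types (i j : nat) (r : R).

Lemma cut_arg1 r : (r - r0) / (2 * r0 - r0) = r / r0 - 1.
Proof. by field; rewrite gt_eqF. Qed.

Lemma cut_arg2 r : (r - 2 * r0) / (r0 - 2 * r0) = 2 - r / r0.
Proof. have -> : r0 - 2 * r0 = - r0 by ring.
by rewrite invrN mulrN; field; rewrite gt_eqF. Qed.

Lemma transition_far i j r : 2 * r0 <= r -> transition D i j r = torus_height D j.
Proof.
move=> hr; have [_ _ c0 c1] := hpsi.
have h : 2 <= r / r0 by rewrite ler_pdivlMr.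
rewrite /transition /Defs.cut cut_arg1 cut_arg2 c1; last lra.
by rewrite c0; [ring | lra].
Qed.

Definition height_gap i j : R := `|torus_height D j| + `|neck_height D i|.

(** Bound for [tau * arcosh (r / tau)] on [r <= 2 * r0], obtained from [arcosh x <= ln (2 * x)]. *)
Definition neck_size i : R := tau D i * ln (4 * r0 / tau D i).

(** Differentiating a cut-off costs [P / r0]. The catenoid profile [tau * arcosh (r / tau)] has
    slope [1 / sqrt ((r / tau)^2 - 1)], which [2 * tau <= r0] keeps below [2 * tau / r0]. *)
Lemma transition_estimate i j r P :
  0 <= P -> (forall s, 0 <= s <= 1 -> `|derive1 (step D) s| <= P) ->
  0 < tau D i -> 2 * tau D i <= r0 -> r0 < r ->
  (exists2 dT : R, is_derive r 1 (transition D i j) dT &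
    `|dT| <= (height_gap i j + neck_size i) * P / r0 + 2 * tau D i / r0) /\
  `|transition D i j r - torus_height D j| <= height_gap i j + neck_size i.
Proof.
move=> P0 dP t0 tr rr; set t := tau D i in t0 tr *.
set z := torus_height D j; set zK := neck_height D i.
have H0 : 0 <= height_gap i j by rewrite addr_ge0.
have Lpos : 0 <= neck_size i.
  rewrite mulr_ge0 ?(ltW t0)// ln_ge0// ler_pdivlMr// -/t; lra.
have B0 : 0 <= (height_gap i j + neck_size i) * P / r0 + 2 * t / r0.
  by rewrite addr_ge0// divr_ge0 ?mulr_ge0 ?addr_ge0// ltW.
(* Beyond [2 * r0] the transition is locally constant; the point [r = 2 * r0] itself belongs to the
   second case. *)
have [rf|rn] := ltP (2 * r0) r.
  split; last by rewrite transition_far ?subrr ?normr0 ?addr_ge0// ltW.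
  exists 0; last by rewrite normr0.
  have dc : is_derive r 1 (fun _ : R => z) 0 by exact: is_derive_cst.
  apply: near_eq_is_derive dc.
    near=> y; rewrite transition_far//.
    by apply: ltW; near: y; exact: lt_nbhsr.
have zgap : `|z - zK| <= height_gap i j by exact: ler_normB.
have sg1 : `|Num.sg (z - zK)| <= 1 by rewrite normr_sg; case: (_ != 0).
have rt1 : 1 < r / t by rewrite ltr_pdivlMr//; lra.
have acL : t * arcosh (r / t) <= neck_size i.
  rewrite /neck_size -/t ler_pM2l//; apply: le_trans (ler_arcosh_ln (ltW rt1)) _.
  have q1 : 0 < 2 * (r / t) by lra.
  have q2 : 0 < 4 * r0 / t by apply: divr_gt0 => //; lra.
  rewrite ler_ln ?posrE//.
  by rewrite mulrA ler_pM2r ?invr_gt0//; lra.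
have ac0 : 0 <= t * arcosh (r / t) by rewrite mulr_ge0 ?(ltW t0)// arcosh_ge0 ?ltW.
have rr0 : 1 < r / r0 <= 2 by rewrite ltr_pdivlMr// mul1r rr ler_pdivrMr.
have [h1 h2] := andP rr0.
split; last first.
  rewrite /transition -/z -/zK -/t /Defs.cut cut_arg1 cut_arg2.
  have := cutoff_ge0 (r / r0 - 1) hpsi; have := cutoff_le1 (r / r0 - 1) hpsi.
  have := cutoff_ge0 (2 - r / r0) hpsi; have := cutoff_le1 (2 - r / r0) hpsi.
  set u := step D (r / r0 - 1); set v := step D (2 - r / r0) => v1 v0 u1 u0.
  have -> : zK + (z - zK) * u + Num.sg (z - zK) * t * arcosh (r / t) * v - z
     = - ((z - zK) * (1 - u)) + Num.sg (z - zK) * (t * arcosh (r / t)) * v by ring.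
  move: acL ac0; move: (t * arcosh (r / t)) => A acL ac0.
  apply: le_trans (ler_normD _ _) _; rewrite normrN !normrM.
  rewrite (ger0_norm ac0) (ger0_norm v0) (@ger0_norm _ (1 - u)) ?subr_ge0//.
  apply: lerD.
    by rewrite -[leRHS]mulr1 ler_pM// ?subr_ge0//; lra.
  rewrite -[leRHS]mulr1 ler_pM ?mulr_ge0//.
  by rewrite -[leRHS]mul1r ler_pM.
pose d1 := derive1 (step D) (r / r0 - 1); pose d2 := derive1 (step D) (2 - r / r0).
have D1 : is_derive r 1 (fun y : R => step D ((y - r0) / (2 * r0 - r0))) (d1 * r0^-1).
  have e1 : is_derive r 1 (fun y : R => y / r0 - 1) r0^-1.
    by apply: is_derive_eq; rewrite subr0 scaler0 add0r /GRing.scale/= mulr1.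
  have e2 : is_derive (r / r0 - 1) 1 (step D) d1.
    by rewrite /d1 derive1E; apply: derivableP; exact: cutoff_derivable.
  have := is_derive_chain (g := fun y : R => y / r0 - 1) erefl e2 e1.
  by under eq_fun do rewrite -cut_arg1.
have D2 : is_derive r 1 (fun y : R => step D ((y - 2 * r0) / (r0 - 2 * r0))) (d2 * - r0^-1).
  have e1 : is_derive r 1 (fun y : R => 2 - y / r0) (- r0^-1).
    by apply: is_derive_eq; rewrite /GRing.scale/=; ring.
  have e2 : is_derive (2 - r / r0) 1 (step D) d2.
    by rewrite /d2 derive1E; apply: derivableP; exact: cutoff_derivable.
  have := is_derive_chain (g := fun y : R => 2 - y / r0) erefl e2 e1.
  by under eq_fun do rewrite -cut_arg2.
have D3 : is_derive r 1 (fun y : R => arcosh (y / t)) ((Num.sqrt ((r / t) ^+ 2 - 1))^-1 * t^-1).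
  have e1 : is_derive r 1 (fun y : R => y / t) t^-1.
    by apply: is_derive_eq; rewrite /GRing.scale/=; ring.
  exact: (is_derive_chain (g := fun y : R => y / t) erefl (is_derive_arcosh rt1) e1).
pose v := step D (2 - r / r0).
pose S := Num.sqrt ((r / t) ^+ 2 - 1).
exists ((z - zK) * (d1 * r0^-1) +
   (Num.sg (z - zK) * t * arcosh (r / t) * (d2 * - r0^-1)
    + v * (Num.sg (z - zK) * t * (S^-1 * t^-1)))).
  rewrite /transition -/z -/zK -/t /Defs.cut.
  apply: is_derive_eq.
  by rewrite /= cut_arg2 -/v -/S add0r /GRing.scale/=; ring.
have d1P : `|d1| <= P by apply: dP; lra.
have d2P : `|d2| <= P by apply: dP; lra.
have v0 : 0 <= v by exact: cutoff_ge0.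
have v1 : v <= 1 by exact: cutoff_le1.
have r0i : 0 < r0^-1 by rewrite invr_gt0.
have S0 : 0 < S by rewrite sqrtr_gt0 subr_gt0 exprn_egt1.
(* With [q = r0 / (2 * t) >= 1] one has [r / t >= 2 * q], and [4 * q^2 - 1 >= q^2]. *)
have Sb : r0 / (2 * t) <= S.
  have q0 : 0 <= r0 / (2 * t) by rewrite divr_ge0 ?mulr_ge0 ?(ltW r0p) ?(ltW t0).
  rewrite -(ger0_norm q0) -sqrtr_sqr ler_wsqrtr//.
  have a1 : 1 <= r0 / (2 * t) by rewrite ler_pdivlMr ?mulr_gt0// mul1r.
  have a2 : 2 * (r0 / (2 * t)) <= r / t.
    have -> : 2 * (r0 / (2 * t)) = r0 / t by field; rewrite gt_eqF.
    by rewrite ler_pM2r ?invr_gt0// ltW.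
  nra.
have Sinv : S^-1 <= 2 * t / r0.
  by rewrite -[leRHS]invrK lef_pV2 ?posrE ?invf_div ?divr_gt0 ?mulr_gt0.
have tti : t * (S^-1 * t^-1) = S^-1 by field; rewrite !gt_eqF.
apply: le_trans (ler_normD _ _) _.
have -> : (height_gap i j + neck_size i) * P / r0 + 2 * t / r0 =
  height_gap i j * (P / r0) + (neck_size i * (P / r0) + 2 * t / r0) by ring.
have r0n : `|r0^-1| <= r0^-1 by rewrite gtr0_norm.
have r0N : `|- r0^-1| <= r0^-1 by rewrite normrN.
apply: lerD; first exact: ler_normM zgap (ler_normM d1P r0n).
apply: le_trans (ler_normD _ _) _; apply: lerD.
  have -> : Num.sg (z - zK) * t * arcosh (r / t) * (d2 * - r0^-1) =
    Num.sg (z - zK) * (t * arcosh (r / t)) * (d2 * - r0^-1) by ring.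
  apply: ler_normM (ler_normM d2P r0N); rewrite -[neck_size i]mul1r.
  by apply: ler_normM => //; rewrite ger0_norm.
rewrite -[Num.sg _ * t * _]mulrA tti -[2 * t / r0]mul1r.
apply: ler_normM; first by rewrite ger0_norm.
rewrite -[2 * t / r0]mul1r; apply: ler_normM => //.
by rewrite gtr0_norm ?invr_gt0.
Unshelve. all: by end_near. Qed.

End Transition.

(** * Taylor bounds for sine and cosine *)

Section Trigonometry.
Variable R : realType.
Implicit Types x t : R.

(** Each of the bounds below is the derivative bound for the next one, starting from
    [cos x <= 1]. *)
Lemma nonneg_derive_ge0 (f df : R -> R) : (forall x, is_derive x 1 f (df x)) ->
  f 0 = 0 -> (forall x, 0 <= x -> 0 <= df x) -> forall x, 0 <= x -> 0 <= f x.
Proof.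
move=> dfx f0 df0 x; rewrite le_eqVlt => /predU1P[<-|x0]; first by rewrite f0.
have cf : continuous f.
  move=> y; apply: differentiable_continuous; apply/derivable1_diffP.
  exact: (@ex_derive _ _ _ _ _ _ _ (dfx y)).
have [c] := @MVT R f df 0 x x0 (fun y _ => dfx y) (continuous_subspaceT cf).
rewrite in_itv/= f0 !subr0 => /andP[c0 _] ->.
by rewrite mulr_ge0 ?df0// ltW.
Qed.

Lemma sin_le x : 0 <= x -> sin x <= x.
Proof.
move=> x0; rewrite -subr_ge0.
apply: (@nonneg_derive_ge0 (fun y => y - sin y) (fun y => 1 - cos y)) => //.
by rewrite sin0 subrr.
Qed.

Lemma cos_ge_quadratic x : 1 - x ^+ 2 / 2 <= cos x.
Proof.
wlog x0 : x / 0 <= x.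
  move=> H; have [x0|x0] := leP 0 x; first exact: H.
  by rewrite -cosN -sqrrN; apply: H; rewrite oppr_ge0 ltW.
rewrite -subr_ge0.
apply: (@nonneg_derive_ge0 (fun y => cos y - (1 - y ^+ 2 / 2)) (fun y => y - sin y)) => //.
- by move=> y; apply: is_derive_eq; rewrite /GRing.scale/=; field.
- by rewrite cos0 expr0n/= mul0r subr0 subrr.
- by move=> y y0; rewrite subr_ge0 sin_le.
Qed.

Lemma sin_ge_cubic x : 0 <= x -> x - x ^+ 3 / 6 <= sin x.
Proof.
move=> x0; rewrite -subr_ge0.
apply: (@nonneg_derive_ge0 (fun y => sin y - (y - y ^+ 3 / 6)) (fun y => cos y - (1 - y ^+ 2 / 2))) => //.
- by move=> y; apply: is_derive_eq; rewrite /GRing.scale/=; field.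
- by rewrite sin0 expr0n/= mul0r subr0 subrr.
- by move=> y y0; rewrite subr_ge0 cos_ge_quadratic.
Qed.

Lemma cos_le_quartic x : cos x <= 1 - x ^+ 2 / 2 + x ^+ 4 / 24.
Proof.
wlog x0 : x / 0 <= x.
  move=> H; have [x0|x0] := leP 0 x; first exact: H.
  have := H (- x); rewrite cosN sqrrN [_ ^+ 4](_ : _ = x ^+ 4); first by apply; rewrite oppr_ge0 ltW.
  by ring.
rewrite -subr_ge0.
apply: (@nonneg_derive_ge0 (fun y => 1 - y ^+ 2 / 2 + y ^+ 4 / 24 - cos y) (fun y => sin y - (y - y ^+ 3 / 6))) => //.
- by move=> y; apply: is_derive_eq; rewrite /GRing.scale/=; field.
- by rewrite cos0 !expr0n/= !mul0r subr0 addr0 subrr.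
- by move=> y y0; rewrite subr_ge0 sin_ge_cubic.
Qed.

End Trigonometry.

(** * Gram determinants and velocities on the graphs *)

Section QuadraticForms.
Variable R : realType.
Implicit Types E F G c : R.

Definition form E F G (a b : R) : R := E * a ^+ 2 + 2 * F * a * b + G * b ^+ 2.

Lemma form_det_ge0 E F G : (forall a b, 0 <= form E F G a b) ->
  [/\ 0 <= E, 0 <= G & F ^+ 2 <= E * G].
Proof.
move=> H.
have E0 : 0 <= E by have := H 1 0; rewrite /form; lra.
have G0 : 0 <= G by have := H 0 1; rewrite /form; lra.
split=> //.
have [E1|E1] := eqVneq E 0.
  have [->|F0] := eqVneq F 0; first by rewrite expr0n/= mulr_ge0.
  (* If [E = 0] and [F] is nonzero, the form is affine in [a] at [b = 1], and this [a] makes it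
     equal to [-1]. *)
  have := H (- (G + 1) / (2 * F)) 1; rewrite /form E1.
  have -> : 0 * (- (G + 1) / (2 * F)) ^+ 2 + 2 * F * (- (G + 1) / (2 * F)) * 1 + G * 1 ^+ 2 = -1.
    by field.
  by rewrite ler0N1.
have Ep : 0 < E by rewrite lt_def E1.
have := H (- F) E; rewrite /form.
have -> : E * (- F) ^+ 2 + 2 * F * - F * E + G * E ^+ 2 = E * (E * G - F ^+ 2) by ring.
by rewrite pmulr_rge0// subr_ge0.
Qed.

(** The determinant is monotone on nonnegative forms; this converts pinching of metrics into
    pinching of area elements. *)
Lemma form_det_mono E F G E' F' G' : (forall a b, 0 <= form E F G a b) ->
  (forall a b, form E F G a b <= form E' F' G' a b) ->
  E * G - F ^+ 2 <= E' * G' - F' ^+ 2.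
Proof.
move=> H0 H.
have [e0 g0 fd] := @form_det_ge0 (E' - E) (F' - F) (G' - G) (fun a b => ltac:(have := H a b; rewrite /form; lra)).
have [E0 G0 Fd] := form_det_ge0 H0.
set e := E' - E in e0 fd; set f := F' - F in fd; set g := G' - G in g0 fd.
have -> : E' = E + e by rewrite /e; ring.
have -> : F' = F + f by rewrite /f; ring.
have -> : G' = G + g by rewrite /g; ring.
(* The determinant of the sum exceeds that of [(E, F, G)] by this mixed term plus [e * g - f ^+ 2].
   Times [g], the mixed term is the first form at [(g, - f)] plus [G * (e * g - f ^+ 2)]. *)
suff M : 0 <= E * g + G * e - 2 * F * f by lra.
have [g1|g1] := eqVneq g 0.
  have f1 : f = 0 by apply/eqP; rewrite -sqrf_eq0 eq_le sqr_ge0 andbT; move: fd; rewrite g1 mulr0.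
  by rewrite g1 f1 !mulr0 add0r subr0 mulr_ge0.
have gp : 0 < g by rewrite lt_def g1.
rewrite -(pmulr_rge0 _ gp).
have := H0 g (- f); rewrite /form => Q.
have : 0 <= G * (e * g - f ^+ 2) by rewrite mulr_ge0// subr_ge0.
by nra.
Qed.

Lemma form_det_scale E F G c : (c * E) * (c * G) - (c * F) ^+ 2 = c ^+ 2 * (E * G - F ^+ 2).
Proof. by ring. Qed.

End QuadraticForms.

Section Coordinates.
Variable R : realType.
Local Notation V4 := 'rV[R]_4.

Lemma is_derive_pt (f0 f1 f2 f3 : R -> R) (t d0 d1 d2 d3 : R) :
  is_derive t 1 f0 d0 -> is_derive t 1 f1 d1 -> is_derive t 1 f2 d2 -> is_derive t 1 f3 d3 ->
  is_derive t 1 (fun s => pt (f0 s) (f1 s) (f2 s) (f3 s)) (pt d0 d1 d2 d3).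
Proof.
move=> h0 h1 h2 h3.
have coord (i : 'I_1) (j : 'I_4) : is_derive t 1 (fun s => pt (f0 s) (f1 s) (f2 s) (f3 s) i j)
    (pt d0 d1 d2 d3 i j).
  under eq_fun do rewrite mxE.
  rewrite mxE; case: j => -[|[|[|[|//]]]] /= _ //.
have D : derivable (fun s => pt (f0 s) (f1 s) (f2 s) (f3 s)) t 1.
  apply/derivable_mxP => i j; exact: (@ex_derive _ _ _ _ _ _ _ (coord i j)).
apply: DeriveDef => //; rewrite derive_mx//; apply/matrixP => i j; rewrite mxE.
exact: (@derive_val _ _ _ _ _ _ _ (coord i j)).
Qed.

Lemma dot_pt (a b c d a' b' c' d' : R) :
  dot (pt a b c d) (pt a' b' c' d') = a * a' + b * b' + c * c' + d * d'.
Proof. by rewrite /dot !big_ord_recl big_ord0 !mxE/=; ring. Qed.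

Lemma dotDZ (a b : R) (u v : V4) :
  dot (a *: u + b *: v) (a *: u + b *: v) =
  form (dot u u) (dot u v) (dot v v) a b.
Proof.
rewrite /form /dot !mulr_sumr !mulr_suml -!big_split/=.
by apply: eq_bigr => i _; rewrite !mxE; ring.
Qed.

Lemma dot_ge0 (u : V4) : 0 <= dot u u.
Proof. by apply: sumr_ge0 => i _; rewrite -expr2 sqr_ge0. Qed.

Lemma pt_lin (a b : R) (x0 x1 x2 x3 y0 y1 y2 y3 : R) :
  a *: pt x0 x1 x2 x3 + b *: pt y0 y1 y2 y3 =
  pt (a * x0 + b * y0) (a * x1 + b * y1) (a * x2 + b * y2) (a * x3 + b * y3).
Proof.
apply/matrixP => i j; rewrite !mxE.
by case: j => -[|[|[|[|//]]]].
Qed.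

(* Velocity of a curve [t |-> Phi (x + t a) (y + t b) (z t)] with [z'(0) = w]. *)
Definition velocity (x y z a b w : R) : V4 :=
  let s := Num.sqrt 2 in
  let S := sin (z + pi / 4) in let C := cos (z + pi / 4) in
  pt (C * w * cos (s * x) - S * (s * a) * sin (s * x))
     (C * w * sin (s * x) + S * (s * a) * cos (s * x))
     (- S * w * cos (s * y) - C * (s * b) * sin (s * y))
     (- S * w * sin (s * y) + C * (s * b) * cos (s * y)).

Lemma is_derive_Phi (x y a b w : R) (z : R -> R) : is_derive (0 : R) 1 z w ->
  is_derive (0 : R) 1 (fun t => Phi (x + t * a) (y + t * b) (z t))
    (velocity x y (z 0) a b w).
Proof.
move=> dz; rewrite /Phi /velocity; set s := Num.sqrt 2.
have dzp : is_derive (0 : R) 1 (fun t => z t + pi / 4) w.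
  by apply: is_derive_eq; rewrite addr0.
have dS := is_derive_chain (g := fun t => z t + pi / 4) erefl (is_derive_sin (z 0 + pi / 4)) dzp.
have dC := is_derive_chain (g := fun t => z t + pi / 4) erefl (is_derive_cos (z 0 + pi / 4)) dzp.
have lin (u v : R) : is_derive (0 : R) 1 (fun t : R => s * (u + t * v)) (s * v).
  by apply: is_derive_eq; rewrite /GRing.scale/=; ring.
have at0 (u v : R) : s * (u + 0 * v) = s * u by rewrite mul0r addr0.
have cx (u v : R) := is_derive_chain (g := fun t : R => s * (u + t * v)) (at0 u v) (is_derive_cos (s * u)) (lin u v).
have sx (u v : R) := is_derive_chain (g := fun t : R => s * (u + t * v)) (at0 u v) (is_derive_sin (s * u)) (lin u v).
apply: is_derive_pt.
- have := is_deriveM dS (cx x a); move=> H; apply: is_derive_eq H _.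
  by rewrite /GRing.scale/= !mul0r !addr0; ring.
- have := is_deriveM dS (sx x a); move=> H; apply: is_derive_eq H _.
  by rewrite /GRing.scale/= !mul0r !addr0; ring.
- have := is_deriveM dC (cx y b); move=> H; apply: is_derive_eq H _.
  by rewrite /GRing.scale/= !mul0r !addr0; ring.
- have := is_deriveM dC (sx y b); move=> H; apply: is_derive_eq H _.
  by rewrite /GRing.scale/= !mul0r !addr0; ring.
Qed.

Lemma velocity_lin (x y z gx gy a b : R) :
  velocity x y z a b (a * gx + b * gy) =
  a *: velocity x y z 1 0 gx + b *: velocity x y z 0 1 gy.
Proof. by rewrite /velocity pt_lin; congr pt; ring. Qed.

Lemma dot_velocity (x y z a b w a' b' w' : R) :
  dot (velocity x y z a b w) (velocity x y z a' b' w') =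
  w * w' + 2 * sin (z + pi / 4) ^+ 2 * a * a' + 2 * cos (z + pi / 4) ^+ 2 * b * b'.
Proof.
rewrite /velocity dot_pt.
set s := Num.sqrt 2; have s2 : s ^+ 2 = 2 by rewrite sqr_sqrtr.
have := cos2Dsin2 (z + pi / 4); have := cos2Dsin2 (s * x); have := cos2Dsin2 (s * y).
set S := sin (z + _); set C := cos (z + _).
set c1 := cos (s * x); set s1 := sin (s * x); set c2 := cos (s * y); set s3 := sin (s * y).
move=> h2 h1 h0.
transitivity (C ^+ 2 * w * w' * (c1 ^+ 2 + s1 ^+ 2) + S ^+ 2 * (s ^+ 2) * a * a' * (c1 ^+ 2 + s1 ^+ 2)
  + S ^+ 2 * w * w' * (c2 ^+ 2 + s3 ^+ 2) + C ^+ 2 * (s ^+ 2) * b * b' * (c2 ^+ 2 + s3 ^+ 2)); first by ring.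
rewrite h1 h2 s2 !mulr1.
transitivity (w * w' * (C ^+ 2 + S ^+ 2) + 2 * S ^+ 2 * a * a' + 2 * C ^+ 2 * b * b'); first by ring.
by rewrite h0 mulr1.
Qed.

(** Squared area element of a graph: [cos (2 z)] is that of the torus at constant height, and the
    slopes contribute the other two terms. *)
Lemma velocity_gram (x y z gx gy : R) :
  let u := velocity x y z 1 0 gx in let v := velocity x y z 0 1 gy in
  dot u u * dot v v - dot u v ^+ 2 =
  cos (z * 2) ^+ 2 + 2 * cos (z + pi / 4) ^+ 2 * gx ^+ 2 + 2 * sin (z + pi / 4) ^+ 2 * gy ^+ 2.
Proof.
move=> u v; rewrite /u /v !dot_velocity.
have -> : cos (z * 2) = 2 * (cos (z + pi / 4) * sin (z + pi / 4)).
  have := sin_mulr2n (z + pi / 4).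
  have -> : (z + pi / 4) *+ 2 = z * 2 + pi / 2 by rewrite mulr2n; field.
  by rewrite (sinD (z * 2)) cos_pihalf sin_pihalf mulr0 mulr1 add0r => ->; rewrite mulr2n; ring.
by ring.
Qed.

End Coordinates.

(** * Local description and slopes of the toral graphs *)

Section ToralGraph.
Variables (R : realType) (D : stack_data R).
Notation N := (ntori D).
Notation X := (cellX D).
Notation Y := (cellY D).
Notation r0 := (hole_radius D).
Hypotheses (hpsi : cutoff (step D)) (N2 : (2 <= N)%N).
Hypotheses (k1 : (1 <= kk D)%N) (kl : (kk D <= ll D)%N) (m1 : (1 <= mm D)%N).
Implicit Types (i j : nat) (p q : R * R).

Let r0p : 0 < r0. Proof. exact: hole_radius_gt0 kl m1. Qed.

(** Matches the parity cases of the definition with the necks of the layers [j - 1] and [j] that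
    meet torus [j]. *)
Lemma removal_pointsE j q : (1 <= j <= N)%N -> removal_points D j q <->
  ((1 < j)%N /\ layer_lattice D j.-1 q) \/ ((j < N)%N /\ layer_lattice D j q).
Proof.
move=> jN; rewrite /removal_points /layer_lattice prednK; last lia.
case: eqP => [->|/eqP j1].
  by rewrite /=; split=> [lq|[[]|[]]//]; right; split.
case: eqP => [->|/eqP jN'].
  by rewrite ltnn; split=> [lq|[[]|[]]//]; left; split.
have j1' : (1 < j)%N by lia.
have jN1 : (j < N)%N by lia.
have [e|e] : (j %% 2 = 0 /\ j.+1 %% 2 = 1 \/ j %% 2 = 1 /\ j.+1 %% 2 = 0)%N by lia.
  by rewrite e.1 e.2; split=> [[]|[[]|[]]]; [left|right|left|right].
by rewrite e.1 e.2; split=> [[]|[[]|[]]]; [right|left|right|left].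
Qed.

Lemma layers_separated j q q' :
  layer_lattice D j.-1 q -> layer_lattice D j q' -> (0 < j)%N -> Y <= dist2 q q'.
Proof.
move=> + + j0; rewrite /layer_lattice prednK//.
have [e|e] : (j %% 2 = 0 /\ j.+1 %% 2 = 1 \/ j %% 2 = 1 /\ j.+1 %% 2 = 0)%N by lia.
  by rewrite e.1 e.2; exact: (lattice_separated k1 kl m1).
by rewrite e.1 e.2 dist2C => h1 h2; exact: (lattice_separated k1 kl m1).
Qed.

Lemma dist_layer_close i p q0 s : layer_lattice D i q0 -> 2 * r0 < s ->
  (forall q, layer_lattice D i q -> q <> q0 -> s <= dist2 p q) ->
  (dist2 p q0 <= 2 * r0 -> dist_layer D i p = dist2 p q0) /\
  (2 * r0 < dist2 p q0 -> 2 * r0 < dist_layer D i p).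
Proof.
move=> l0 sr far.
have ne : [set dist2 p q | q in layer_lattice D i] !=set0 by exists (dist2 p q0); exists q0.
have lb c : c <= s -> c <= dist2 p q0 -> c <= dist_layer D i p.
  move=> cs cq; apply: lb_le_inf => // _ [q lq <-].
  have [->//|qq] := pselect (q = q0).
  by apply: le_trans cs _; exact: far.
split=> h.
  apply/eqP; rewrite eq_le lb//; last by apply: le_trans h _; exact: ltW.
  rewrite andbT; apply: ge_inf; last by exists q0.
  by exists 0 => _ [q _ <-]; exact: dist2_ge0.
apply: (@lt_le_trans _ _ (Order.min s (dist2 p q0))).
  by rewrite lt_min sr h.
by apply: lb; rewrite ge_min lexx ?orbT.
Qed.

(* Deviation of the graph over torus [j] from its height caused by the neck of
   layer [i] at [q]; [c] tells whether there is such a layer. *)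
Definition bump (c : bool) i j q p : R :=
  if c then transition D i j (dist2 p q) - torus_height D j else 0.

(** The nested conditionals become a sum because a point within [2 * r0] of necks of both layers
    would force [Y <= 4 * r0]. With [q0] and [q1] fixed, the sum can be differentiated without
    following the infimum in [dist_layer]. *)
Lemma toral_graph_local j p q0 q1 s : (1 <= j <= N)%N -> 2 * r0 < s ->
  ((1 < j)%N -> layer_lattice D j.-1 q0 /\
     forall q, layer_lattice D j.-1 q -> q <> q0 -> s <= dist2 p q) ->
  ((j < N)%N -> layer_lattice D j q1 /\
     forall q, layer_lattice D j q -> q <> q1 -> s <= dist2 p q) ->
  toral_graph D j p =
  torus_height D j + (bump (1 < j)%N j.-1 j q0 p + bump (j < N)%N j j q1 p).
Proof.
move=> jN sr H0 H1; rewrite /toral_graph /bump.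
have far i q : 2 * r0 <= dist2 p q -> transition D i j (dist2 p q) - torus_height D j = 0.
  by move=> h; rewrite transition_far ?subrr.
have next : (2 * r0 <= dist2 p q0 \/ ~~ (1 < j)%N) ->
  (if (j < N)%N && (dist_layer D j p <= 2 * r0) then transition D j j (dist_layer D j p)
   else torus_height D j) = torus_height D j + (bump (1 < j)%N j.-1 j q0 p + bump (j < N)%N j j q1 p).
  move=> h; rewrite {1}/bump.
  have -> : (if (1 < j)%N then transition D j.-1 j (dist2 p q0) - torus_height D j else 0) = 0.
    by case: ifP => // j1; rewrite far//; case: h => //; rewrite j1.
  rewrite add0r /bump; case: ifP => [/andP[jN' le2]|].
    rewrite jN'; have [l1 f1] := H1 jN'; have [e1 e2] := dist_layer_close l1 sr f1.
    have [a|a] := leP (dist2 p q1) (2 * r0); first by rewrite e1//; ring.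
    by have := e2 a; rewrite ltNge le2.
  case: (ltnP j N) => jN' /=; last by rewrite addr0.
  have [l1 f1] := H1 jN'; have [e1 e2] := dist_layer_close l1 sr f1.
  move=> /negbT; rewrite -ltNge => a.
  have [b|b] := leP (dist2 p q1) (2 * r0); last by rewrite far ?addr0// ltW.
  by move: a; rewrite e1// ltNge b.
case: ifP => [/andP[j1 le2]|].
  rewrite j1; have [l0 f0] := H0 j1; have [e1 e2] := dist_layer_close l0 sr f0.
  have [a|a] := leP (dist2 p q0) (2 * r0); last by have := e2 a; rewrite ltNge le2.
  rewrite e1//; case: ifP => [jN'|_]; last by ring.
  have [l1 _] := H1 jN'.
  rewrite [X in _ + (_ + X)]far; first by ring.
  have := layers_separated l0 l1 ltac:(lia).
  have := dist2_triangle q0 p q1; rewrite (dist2C q0 p).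
  have := hole_radius_small k1 kl m1; lra.
move=> h; apply: next; case: (ltnP 1 j) h => j1 /=; last by right.
have [l0 f0] := H0 j1; have [e1 e2] := dist_layer_close l0 sr f0.
move=> /negbT; rewrite -ltNge => a; left.
have [b|b] := leP (2 * r0) (dist2 p q0) => //.
by move: a; rewrite e1 ?ltW// ltNge ltW.
Qed.

Lemma bump_estimate (c : bool) i j q p P d : 0 <= P -> 0 <= d ->
  (forall s, 0 <= s <= 1 -> `|derive1 (step D) s| <= P) ->
  (c -> [/\ 0 < tau D i, 2 * tau D i <= r0, r0 < dist2 p q,
    (height_gap D i j + neck_size D i) * P / r0 + 2 * tau D i / r0 <= d &
    height_gap D i j + neck_size D i <= d]) ->
  exists gx gy : R, [/\ `|gx| <= d, `|gy| <= d, `|bump c i j q p| <= d &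
    forall a b : R, is_derive (0 : R) 1 (fun t : R => bump c i j q (p.1 + t * a, p.2 + t * b))
      (a * gx + b * gy)].
Proof.
move=> P0 d0 dP; rewrite /bump; case: c => [/(_ isT)|_]; last first.
  exists 0, 0; rewrite normr0; split=> // a b; rewrite !mulr0 addr0; exact: is_derive_cst.
move=> [t0 tr pr h1 h2].
have [[dT dTd dTb] Tb] := transition_estimate hpsi r0p j P0 dP t0 tr pr.
have dp : 0 < dist2 p q by rewrite (lt_trans r0p).
exists (dT * ((p.1 - q.1) / dist2 p q)), (dT * ((p.2 - q.2) / dist2 p q)).
have u1 : `|(p.1 - q.1) / dist2 p q| <= 1.
  by rewrite normrM normfV (gtr0_norm dp) ler_pdivrMr// mul1r dist2_ge1.
have u2 : `|(p.2 - q.2) / dist2 p q| <= 1.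
  by rewrite normrM normfV (gtr0_norm dp) ler_pdivrMr// mul1r dist2_ge2.
have dTd' : `|dT| <= d by exact: le_trans h1.
split.
- by rewrite -[d]mulr1; exact: ler_normM.
- by rewrite -[d]mulr1; exact: ler_normM.
- exact: le_trans h2.
move=> a b.
have p0 : (p.1 + 0 * a, p.2 + 0 * b) = p by rewrite !mul0r !addr0; case: (p).
have D1 := is_derive_dist2_line a b dp.
have D2 := is_derive_chain (g := fun t : R => dist2 (p.1 + t * a, p.2 + t * b) q)
  (congr1 (fun p => dist2 p q) p0) dTd D1.
have dc : is_derive (0 : R) (1 : R) (fun _ : R => torus_height D j) 0 by exact: is_derive_cst.
have := is_deriveB D2 dc; move=> H; apply: is_derive_eq H _.
by rewrite subr0; ring.
Qed.

Lemma dist2_line p (t a b : R) :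
  dist2 (p.1 + t * a, p.2 + t * b) p <= `|t| * (`|a| + `|b|).
Proof.
rewrite /dist2 /= ![_ + _ - _]addrAC !subrr !add0r.
have := sqrt_sum_triangle (t * a) 0 0 (t * b).
by rewrite !addr0 !add0r !expr0n/= !addr0 !add0r !sqrtr_sqr !normrM -mulrDr.
Qed.

Lemma near_line (p : R * R) (a b e : R) : 0 < e ->
  \forall t \near (0 : R), dist2 (p.1 + t * a, p.2 + t * b) p <= e.
Proof.
move=> e0; pose n := `|a| + `|b| + 1.
have n0 : 0 < n by rewrite ltr_wpDl// addr_ge0.
apply/nbhs_ballP; exists (e / n) => /=; first exact: divr_gt0.
move=> t; rewrite /ball/= sub0r normrN => te.
apply: le_trans (dist2_line _ _ _ _) _.
apply: (@le_trans _ _ (`|t| * n)); first by rewrite ler_wpM2l// lerDl.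
by rewrite -ler_pdivlMr// ltW.
Qed.

Lemma toral_graph_estimate j p P d : (1 <= j <= N)%N -> 0 <= P -> 0 <= d ->
  (forall s, 0 <= s <= 1 -> `|derive1 (step D) s| <= P) ->
  (forall i, (1 <= i < N)%N -> [/\ 0 < tau D i, 2 * tau D i <= r0,
    (height_gap D i j + neck_size D i) * P / r0 + 2 * tau D i / r0 <= d &
    height_gap D i j + neck_size D i <= d]) ->
  (forall q, removal_points D j q -> r0 < dist2 p q) ->
  exists gx gy : R, [/\ `|gx| <= 2 * d, `|gy| <= 2 * d,
    `|toral_graph D j p - torus_height D j| <= 2 * d &
    forall a b : R,
      is_derive (0 : R) 1 (fun t : R => toral_graph D j (p.1 + t * a, p.2 + t * b))
        (a * gx + b * gy) /\
      \forall t \near (0 : R), perforated D j (p.1 + t * a, p.2 + t * b)].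
Proof.
move=> jN P0 d0 dP small good.
have r0s := hole_radius_small k1 kl m1.
have [q0 [l0 far0]] := nearest_node k1 kl m1 (j.-1.+1 %% 2) p.
have [q1 [l1 far1]] := nearest_node k1 kl m1 (j.+1 %% 2) p.
rewrite -/(layer_lattice D j.-1 q0) in l0; rewrite -/(layer_lattice D j q1) in l1.
have g0 : (1 < j)%N -> r0 < dist2 p q0 by move=> j1; apply: good; apply/removal_pointsE => //; left.
have g1 : (j < N)%N -> r0 < dist2 p q1 by move=> j1; apply: good; apply/removal_pointsE => //; right.
have [x0 [y0 [x0d y0d b0d D0]]] := @bump_estimate (1 < j)%N j.-1 j q0 p P d P0 d0 dP
  (fun hj => ltac:(have [? ? ? ?] := small j.-1 ltac:(lia); split => //; exact: g0)).
have [x1 [y1 [x1d y1d b1d D1]]] := @bump_estimate (j < N)%N j j q1 p P d P0 d0 dP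
  (fun hj => ltac:(have [? ? ? ?] := small j ltac:(lia); split => //; exact: g1)).
have r00 : 0 < r0 by exact: r0p.
(* On the ball of radius [Y / 4] about [p] the nearest nodes [q0] and [q1] can be kept fixed: all
   others stay at distance at least [Y - Y / 4]. *)
pose s : R := 3 * Y / 4.
have sr : 2 * r0 < s by rewrite /s; lra.
have Y0 : 0 < Y by lra.
have local p' : dist2 p' p <= Y / 4 -> toral_graph D j p' =
    torus_height D j + (bump (1 < j)%N j.-1 j q0 p' + bump (j < N)%N j j q1 p').
  move=> pp; apply: (toral_graph_local jN sr) => _; split => // q lq qq.
    have := far0 q lq qq; have := dist2_triangle p p' q; rewrite (dist2C p p') /s; lra.
  have := far1 q lq qq; have := dist2_triangle p p' q; rewrite (dist2C p p') /s; lra.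
exists (x0 + x1), (y0 + y1); split.
- by apply: le_trans (ler_normD _ _) _; lra.
- by apply: le_trans (ler_normD _ _) _; lra.
- rewrite local; last by rewrite /dist2 !subrr expr0n/= addr0 sqrtr0; lra.
  by rewrite addrAC subrr add0r; apply: le_trans (ler_normD _ _) _; lra.
move=> a b; split.
  have Y4 : 0 < Y / 4 by lra.
  have near0 := near_line p a b Y4.
  have dc : is_derive (0 : R) (1 : R) (fun _ : R => torus_height D j) 0 by exact: is_derive_cst.
  have H := is_deriveD dc (is_deriveD (D0 a b) (D1 a b)).
  have H' : is_derive (0 : R) 1 (fun t : R => torus_height D j +
     (bump (1 < j)%N j.-1 j q0 (p.1 + t * a, p.2 + t * b) +
      bump (j < N)%N j j q1 (p.1 + t * a, p.2 + t * b)))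
     (a * (x0 + x1) + b * (y0 + y1)).
    by apply: is_derive_eq H _; ring.
  apply: near_eq_is_derive H'; near=> t; rewrite local//.
  by near: t.
(* Slack between [p] and the rim of each nearby hole, positive because [p] is strictly outside; [1]
   is a placeholder when the layer is absent. *)
pose e0 := if (1 < j)%N then dist2 p q0 - r0 else 1.
pose e1 := if (j < N)%N then dist2 p q1 - r0 else 1.
have e0p : 0 < e0 by rewrite /e0; case: ifP => // j1; rewrite subr_gt0 g0.
have e1p : 0 < e1 by rewrite /e1; case: ifP => // j1; rewrite subr_gt0 g1.
have ep : 0 < Order.min (Y / 4) (Order.min e0 e1).
  by rewrite !lt_min e0p e1p !andbT; lra.
have := near_line p a b ep; apply: filterS => t.
rewrite !le_min => /andP[h /andP[h0 h1]].
set p' := (_, _) in h h0 h1 *.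
have tri q : dist2 p q - dist2 p' p <= dist2 p' q.
  by have := dist2_triangle p p' q; rewrite (dist2C p p'); lra.
rewrite /perforated /= => q /removal_pointsE - /(_ jN)[] [c lq].
  have [->|qq] := pselect (q = q0).
    by apply: le_trans (tri _); move: h0; rewrite /e0 c; lra.
  by apply: le_trans (tri _); have := far0 q lq qq; lra.
have [->|qq] := pselect (q = q1).
  by apply: le_trans (tri _); move: h1; rewrite /e1 c; lra.
by apply: le_trans (tri _); have := far1 q lq qq; lra.
Unshelve. all: by end_near. Qed.

End ToralGraph.

(** * From pinched metrics to filled areas *)

Section AreaElement.
Variable R : realType.
Local Notation V4 := 'rV[R]_4.

Lemma sqr_le_norm (x c : R) : `|x| <= c -> x ^+ 2 <= c ^+ 2.
Proof.
move=> xc; rewrite -(real_normK (num_real x)) lerXn2r ?nnegrE//.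
exact: le_trans xc.
Qed.

Lemma pinch_arith (e x s a : R) : 0 <= e -> e <= 1 -> 0 <= x -> 36 * x <= 1 ->
  (1 - e) * s <= a -> a <= (1 + e) * s -> 1 - 18 * x <= s -> s <= 1 + 8 * x ->
  1 - (e + 18 * x) <= a <= 1 + (e + 18 * x).
Proof. by move=> e0 e1 x0 x1 lo hi s0 s1; apply/andP; split; nra. Qed.

Lemma is_derive_comp_diff (G : V4 -> V4) (c : R -> V4) (w : V4) :
  differentiable G (c 0) -> is_derive (0 : R) 1 c w ->
  is_derive (0 : R) 1 (G \o c) ('d G (c 0) w).
Proof.
move=> dG dc.
have cd : differentiable c 0 by apply/derivable1_diffP; exact: (@ex_derive _ _ _ _ _ _ _ dc).
have Gcd : differentiable (G \o c) 0 by exact: differentiable_comp.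
have cw : 'd c 0 1 = w by rewrite -deriveE//; exact: (@derive_val _ _ _ _ _ _ _ dc).
apply: DeriveDef; first by apply/derivable1_diffP.
by rewrite deriveE// diff_comp//= cw.
Qed.

Lemma derive1_line (F : R * R -> V4) (p : R * R) :
  derive1 (fun x => F (x, p.2)) p.1 = derive1 (fun t : R => F (p.1 + t * 1, p.2 + t * 0)) 0 /\
  derive1 (fun y => F (p.1, y)) p.2 = derive1 (fun t : R => F (p.1 + t * 0, p.2 + t * 1)) 0.
Proof.
by split; rewrite /derive1;
  apply: (congr1 (fun g : R -> V4 => lim (g h @[h --> 0^']))); apply/funext => h;
  rewrite !(mulr0, mulr1, addr0, mul0r) [h + _]addrC.
Qed.

(** Straight lines through [p] give curves in [S] with every tangent direction [a *: u + b *: v], so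
    pinching bounds the whole Gram form of the image; monotonicity of determinants does the rest. *)
Lemma area_element_pinched (S : set V4) (Psi : V4 -> V4) (eps : R)
  (F : R * R -> V4) (p : R * R) (u v : V4) :
  smooth_on_subset S Psi -> metric_pinched S Psi eps -> 0 <= eps <= 1 ->
  (forall a b : R,
     is_derive (0 : R) 1 (fun t : R => F (p.1 + t * a, p.2 + t * b)) (a *: u + b *: v) /\
     \forall t \near (0 : R), S (F (p.1 + t * a, p.2 + t * b))) ->
  (1 - eps) * Num.sqrt (dot u u * dot v v - dot u v ^+ 2) <= area_element (Psi \o F) p
  /\ area_element (Psi \o F) p <= (1 + eps) * Num.sqrt (dot u u * dot v v - dot u v ^+ 2).
Proof.
move=> sm pin /andP[e0 e1] HF.
pose c (a b t : R) := F (p.1 + t * a, p.2 + t * b).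
have c0 a b : c a b 0 = F p by rewrite /c !mul0r !addr0; case: (p).
have Sp : S (F p) by rewrite -(c0 0 0); have [_ /nbhs_singleton] := HF 0 0.
(* Differentiation goes through a local smooth extension [G], since smoothness of [Psi] is only
   relative to [S]; the two agree along curves that stay in [S]. *)
have [U [G [oU Up sG GE]]] := sm _ Sp.
have dG : differentiable G (F p) by have [/(_ _ Up)] := sG 1%N.
pose L := 'd G (F p).
have dPsi a b : is_derive (0 : R) 1 (Psi \o c a b) (a *: L u + b *: L v).
  have [dc nS] := HF a b.
  have cd : {for 0, continuous (c a b)}.
    apply: differentiable_continuous; apply/derivable1_diffP.
    exact: (@ex_derive _ _ _ _ _ _ _ dc).
  have := @is_derive_comp_diff G (c a b) (a *: u + b *: v); rewrite c0 => /(_ dG dc).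
  rewrite -/L linearD !linearZ/=; apply: near_eq_is_derive.
  have nU : \forall t \near (0 : R), U (c a b t).
    by apply: cd; rewrite c0; exact: open_nbhs_nbhs.
  near=> t; rewrite /= GE//; first by near: t.
  by near: t.
have bounds a b : (1 - eps) * form (dot u u) (dot u v) (dot v v) a b <=
    form (dot (L u) (L u)) (dot (L u) (L v)) (dot (L v) (L v)) a b <=
    (1 + eps) * form (dot u u) (dot u v) (dot v v) a b.
  have [dc nS] := HF a b.
  have := pin (c a b) (@ex_derive _ _ _ _ _ _ _ dc) nS; cbv zeta.
  rewrite !derive1E (@derive_val _ _ _ _ _ _ _ dc) (@derive_val _ _ _ _ _ _ _ (dPsi a b)).
  by rewrite !dotDZ.
have [l1 l2] := derive1_line (Psi \o F) p.
have -> : area_element (Psi \o F) p =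
    Num.sqrt (dot (L u) (L u) * dot (L v) (L v) - dot (L u) (L v) ^+ 2).
  have Lu : derive1 (Psi \o c 1 0) 0 = L u.
    by rewrite derive1E (@derive_val _ _ _ _ _ _ _ (dPsi 1 0)) scale1r scale0r addr0.
  have Lv : derive1 (Psi \o c 0 1) 0 = L v.
    by rewrite derive1E (@derive_val _ _ _ _ _ _ _ (dPsi 0 1)) scale1r scale0r add0r.
  by rewrite /area_element (etrans l1 Lu) (etrans l2 Lv).
have sc k a b : k * form (dot u u) (dot u v) (dot v v) a b =
    form (k * dot u u) (k * dot u v) (k * dot v v) a b by rewrite /form; ring.
have P0 a b : 0 <= form (dot u u) (dot u v) (dot v v) a b by rewrite -dotDZ dot_ge0.
have P1 a b : 0 <= form (dot (L u) (L u)) (dot (L u) (L v)) (dot (L v) (L v)) a b.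
  by rewrite -dotDZ dot_ge0.
have le0 : 0 <= 1 - eps by rewrite subr_ge0.
have ge0 : 0 <= 1 + eps by rewrite addr_ge0.
split.
  have Plo a b : 0 <= form ((1 - eps) * dot u u) ((1 - eps) * dot u v) ((1 - eps) * dot v v) a b.
    by rewrite -sc mulr_ge0.
  have Hlo a b : form ((1 - eps) * dot u u) ((1 - eps) * dot u v) ((1 - eps) * dot v v) a b <=
      form (dot (L u) (L u)) (dot (L u) (L v)) (dot (L v) (L v)) a b.
    by rewrite -sc; case/andP: (bounds a b).
  have := form_det_mono Plo Hlo.
  rewrite form_det_scale => H; rewrite -{1}(ger0_norm le0) -sqrtr_sqr -sqrtrM ?sqr_ge0//.
  exact: ler_wsqrtr.
have Hhi a b : form (dot (L u) (L u)) (dot (L u) (L v)) (dot (L v) (L v)) a b <=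
    form ((1 + eps) * dot u u) ((1 + eps) * dot u v) ((1 + eps) * dot v v) a b.
  by rewrite -sc; case/andP: (bounds a b).
have := form_det_mono P1 Hhi.
rewrite form_det_scale => H; rewrite -{1}(ger0_norm ge0) -sqrtr_sqr -sqrtrM ?sqr_ge0//.
exact: ler_wsqrtr.
Unshelve. all: by end_near. Qed.

End AreaElement.

Section ToralArea.
Variables (R : realType) (D : stack_data R).
Notation N := (ntori D).
Notation r0 := (hole_radius D).
Hypotheses (hpsi : cutoff (step D)) (N2 : (2 <= N)%N).
Hypotheses (k1 : (1 <= kk D)%N) (kl : (kk D <= ll D)%N) (m1 : (1 <= mm D)%N).
Variables (Sigma : set 'rV[R]_4) (Psi : 'rV[R]_4 -> 'rV[R]_4).
Hypothesis torus : stacked_clifford_torus D Sigma Psi.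
Variables (j : nat) (P d : R).
Hypotheses (jN : (1 <= j <= N)%N) (P0 : 0 <= P) (d0 : 0 <= d <= 1 / 6).
Hypothesis dP : forall s, 0 <= s <= 1 -> `|derive1 (step D) s| <= P.
Hypothesis zd : `|torus_height D j| <= d.
Hypothesis small : forall i, (1 <= i < N)%N -> [/\ 0 < tau D i, 2 * tau D i <= r0,
    (height_gap D i j + neck_size D i) * P / r0 + 2 * tau D i / r0 <= d &
    height_gap D i j + neck_size D i <= d].

Let eps : R := (mm D)%:R ^- 2.

Let eps01 : 0 <= eps <= 1.
Proof.
rewrite /eps invr_ge0 sqr_ge0/= invf_le1 ?exprn_gt0 ?ltr0n//.
by rewrite exprn_ege1// ler1n.
Qed.

Lemma area_element_toral p : (forall q, removal_points D j q -> r0 < dist2 p q) ->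
  1 - (eps + 18 * d ^+ 2) <= area_element (Psi \o toral_param D j) p <= 1 + (eps + 18 * d ^+ 2).
Proof.
move=> good; have [_ _ [g [_ _ sm _]] _ pin] := torus.
have [dd0 dd1] := andP d0; have [e0 e1] := andP eps01.
have [gx [gy [gxd gyd zz line]]] := toral_graph_estimate hpsi N2 k1 kl m1 jN P0 dd0 dP small good.
set z := toral_graph D j p.
have zd3 : `|z| <= 3 * d.
  have := ler_normD (z - torus_height D j) (torus_height D j).
  rewrite subrK => /le_trans; apply.
  have -> : 3 * d = 2 * d + d by ring.
  exact: lerD.
set u := velocity p.1 p.2 z 1 0 gx; set v := velocity p.1 p.2 z 0 1 gy.
have curve (a b : R) : is_derive (0 : R) 1
     (fun t : R => toral_param D j (p.1 + t * a, p.2 + t * b)) (a *: u + b *: v) /\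
     \forall t \near (0 : R), initial_surface D (toral_param D j (p.1 + t * a, p.2 + t * b)).
  have [dz np] := line a b; split; last first.
    apply: filterS np => t pt; left; exists j => //.
    by exists (p.1 + t * a, p.2 + t * b).
  have := is_derive_Phi p.1 p.2 a b dz.
  by rewrite !mul0r !addr0 -surjective_pairing -/z velocity_lin.
have [lo hi] := area_element_pinched sm pin eps01 curve.
move: lo hi; rewrite /u /v velocity_gram -/eps.
set g0 := cos (z * 2) ^+ 2 + _ + _ => lo hi.
have gx2 : gx ^+ 2 <= 4 * d ^+ 2.
  by apply: le_trans (sqr_le_norm gxd) _; rewrite exprMn; lra.
have gy2 : gy ^+ 2 <= 4 * d ^+ 2.
  by apply: le_trans (sqr_le_norm gyd) _; rewrite exprMn; lra.
have z2 : z ^+ 2 <= 9 * d ^+ 2.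
  by apply: le_trans (sqr_le_norm zd3) _; rewrite exprMn; lra.
have d36 : 36 * d ^+ 2 <= 1 by nra.
have S2 := sqr_ge0 (sin (z + pi / 4)); have C2 := sqr_ge0 (cos (z + pi / 4)).
have CS := cos2Dsin2 (z + pi / 4).
have gx0 := sqr_ge0 gx; have gy0 := sqr_ge0 gy.
(* From [cos x >= 1 - x^2 / 2] at [x = 2 z] with [z^2 <= 9 * d^2]; this is the origin of the
   constant [18]. *)
have cz : 1 - 18 * d ^+ 2 <= cos (z * 2).
  by apply: le_trans (cos_ge_quadratic _); nra.
have cz0 : 0 <= cos (z * 2) by lra.
have cz1 : cos (z * 2) <= 1 by exact: cos_le1.
have slo : 1 - 18 * d ^+ 2 <= Num.sqrt g0.
  apply: le_trans cz _; rewrite -[leLHS](ger0_norm cz0) -sqrtr_sqr ler_wsqrtr//.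
  rewrite /g0 -addrA lerDl; apply: addr_ge0; apply: mulr_ge0 => //; exact: mulr_ge0.
have shi : Num.sqrt g0 <= 1 + 8 * d ^+ 2.
  have q0 : 0 <= 1 + 8 * d ^+ 2 by rewrite addr_ge0// mulr_ge0// sqr_ge0.
  rewrite -[leRHS](ger0_norm q0) -sqrtr_sqr ler_wsqrtr// /g0.
  have : cos (z * 2) ^+ 2 <= 1 by rewrite exprn_ile1.
  move: CS S2 C2 gx0 gy0 gx2 gy2.
  move: (sin (z + pi / 4) ^+ 2) (cos (z + pi / 4) ^+ 2) (gx ^+ 2) (gy ^+ 2) (cos (z * 2) ^+ 2) => S C x y c.
  move=> CS S0 C0 x0 y0 x4 y4 c1.
  have h1 : C * x <= C * (4 * d ^+ 2) by rewrite ler_wpM2l.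
  have h2 : S * y <= S * (4 * d ^+ 2) by rewrite ler_wpM2l.
  have h3 : C * (4 * d ^+ 2) + S * (4 * d ^+ 2) = 4 * d ^+ 2 by rewrite -mulrDl CS mul1r.
  have := sqr_ge0 (8 * d ^+ 2); have := sqr_ge0 d; nra.
have dsq := sqr_ge0 d.
exact: pinch_arith lo hi slo shi.
Qed.

Local Notation mu2 := (@lebesgue_measure R \x @lebesgue_measure R)%E.
Local Notation T := (measurableTypeR R * measurableTypeR R)%type.

(** Boundary circles of the holes. At such a point a line may leave the perforated torus at once, so
    the pinching gives no control of the area element there. *)
Definition rims (e : nat) : set T := \bigcup_(ab : int * int) circle (node D e ab.1 ab.2) r0.

Lemma measurable_rims e : measurable (rims e).
Proof.
apply: countable_bigcupT_measurable; first exact: countableP.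
by move=> ab; exact: measurable_circle.
Qed.

Lemma rims_null e : mu2 (rims e) = 0%E.
Proof.
have -> : rims e = \bigcup_n (if unpickle n is Some ab then
    circle (node D e (ab : int * int).1 ab.2) r0 else set0 : set T).
  apply/seteqP; split => p.
    by move=> [ab _ h]; exists (pickle ab) => //; rewrite pickleK.
  by move=> [n _]; case: (unpickle n) => // ab h; exists ab.
have mF n : measurable (if unpickle n is Some ab then
    circle (node D e (ab : int * int).1 ab.2) r0 else set0 : set T).
  by case: unpickle => [ab|]; [exact: measurable_circle | exact: measurable0].
apply: measure_negligible; first exact: bigcupT_measurable.
apply: negligible_bigcup => n; apply/negligibleP => //.
by case: unpickle => [ab|]; [exact: circle_null | exact: measure0].
Qed.

(** The hole areas added back complement the perforated area [M] exactly to [2 * pi ^+ 2], so only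
    the relative error of the area element remains. *)
Lemma filled_area_near : `|filled_area D Psi j - 2 * pi ^+ 2| <= (eps + 18 * d ^+ 2) * (2 * pi ^+ 2).
Proof.
set kap := eps + 18 * d ^+ 2.
have [dd0 dd1] := andP d0; have [e0 e1] := andP eps01.
have kap0 : 0 <= kap by rewrite addr_ge0// mulr_ge0// sqr_ge0.
pose A : set T := perforated D j `&` @fundamental_square R.
have mA : measurable A by exact: measurable_perforated.
have muA := perforated_measure k1 kl m1 j.
set M := 2 * pi ^+ 2 - _ in muA.
have M0 : 0 <= M by rewrite -lee_fin -muA; exact: measure_ge0.
have M1 : M <= 2 * pi ^+ 2.
  by rewrite /M gerBl; apply: mulr_ge0 (sqr_ge0 _); apply: mulr_ge0 (pi_ge0 _).
(* [integral_sandwich] needs a nonnegative lower bound; an area element is nonnegative in any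
   case. *)
pose lo := Order.max 0 (1 - kap).
have lo0 : 0 <= lo by rewrite /lo le_max lexx.
have mN : measurable (rims 0 `|` rims 1) by apply: measurableU; exact: measurable_rims.
have N0 : mu2 (rims 0 `|` rims 1) = 0%E.
  apply/eqP; rewrite eq_le measure_ge0 andbT.
  apply: le_trans (measureU2 _ (measurable_rims 0) (measurable_rims 1)) _.
  exact: (eq_ind_r (fun x => x <= 0)%E (lexx 0%E)
    (etrans (congr2 adde (rims_null 0) (rims_null 1)) (adde0 0%E))).
have bnd p : A p -> ~ (rims 0 `|` rims 1) p ->
    lo <= area_element (Psi \o toral_param D j) p <= 1 + kap.
  move=> [pP _] nrim.
  have good q : removal_points D j q -> r0 < dist2 p q.
    move=> rq; rewrite lt_neqAle (pP q rq) andbT; apply/eqP => E; apply: nrim.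
    have [[a [b qE]]|[a [b qE]]] : lattice D 0 q \/ lattice D 1 q.
      move: rq; rewrite /removal_points; case: ifP => _; first by left.
      case: ifP => _; last by case; [left|right].
      have [->|->] : (N %% 2 = 0 \/ N %% 2 = 1)%N by lia.
        by left.
      by right.
    - by left; exists (a, b) => //; rewrite /circle /= E; congr dist2; rewrite qE.
    - by right; exists (a, b) => //; rewrite /circle /= E; congr dist2; rewrite qE.
  have := area_element_toral good; rewrite -/kap => /andP[h1 h2].
  by rewrite /lo ge_max h1 h2 sqrtr_ge0.
have := integral_sandwich mA mN N0 lo0 (addr_ge0 ler01 kap0) (fun x _ => sqrtr_ge0 _) bnd.
have -> : filled_area D Psi j =
   fine (\int[mu2]_(x in A) (area_element (Psi \o toral_param D j) x)%:E)%E + (2 * pi ^+ 2 - M).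
  by rewrite /filled_area /image_area /parametrized_area /Rintegral /M; ring.
have muA' : mu2 A = M%:E by exact: muA.
rewrite (congr1 (fun x => lo%:E * x)%E muA') (congr1 (fun x => (1 + kap)%:E * x)%E muA').
case: (\int[mu2]_(x in A) _)%E => [r| |]; last 2 first.
- by move=> /andP[_]; rewrite -EFinM leye_eq.
- by move=> /andP[+ _]; rewrite -EFinM leeNy_eq.
move=> /andP[h1 h2].
have {}h1 : lo * M <= r by rewrite -lee_fin.
have {}h2 : r <= (1 + kap) * M by rewrite -lee_fin.
have loM : (1 - kap) * M <= lo * M by rewrite ler_wpM2r// /lo le_max lexx orbT.
have kM : kap * M <= kap * (2 * pi ^+ 2) by rewrite ler_wpM2l.
rewrite /= ler_norml; apply/andP; split; lra.
Qed.

End ToralArea.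

(** * Dependence on [m] *)

Section Waists.
Variables (R : realType) (D : stack_data R) (L cz d2 : R).
Notation N := (ntori D).
Notation r0 := (hole_radius D).
Notation M := ((lattice_size D)%:R : R).
Hypotheses (k1 : (1 <= kk D)%N) (kl : (kk D <= ll D)%N) (m1 : (1 <= mm D)%N).
Hypothesis ratio_ln : forall i, (1 <= i < N)%N ->
  0 < waist_ratio D i /\ `|ln (waist_ratio D i)| <= L.
Hypothesis ratio2 : `|waist_ratio D 2 - d2| <= 8 * pi / M * L.
Hypothesis zetab : forall i, `|zeta D i| <= cz.
Hypothesis d2lt : d2 < 2.

(** Growth rate of [a_i] in [M]: the exponent [M / (4 * pi) * (1 - d2 / 2)] of [tau1] equals [M]
    times this number. *)
Definition conductance_rate : R := (2 - d2) / (8 * pi).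
Notation beta := conductance_rate.

Let r0p : 0 < r0 := hole_radius_gt0 k1 kl m1.
Let p0 : 0 < pi :> R := pi_gt0 R.

Lemma conductance_rate_gt0 : 0 < beta.
Proof. by rewrite divr_gt0 ?subr_gt0// mulr_gt0. Qed.

Lemma lattice_size_ge : (mm D)%:R ^+ 2 <= M.
Proof using k1 kl m1.
by rewrite -natrX ler_nat /lattice_size leq_pmull// muln_gt0 k1 (leq_trans k1 kl).
Qed.

Lemma lattice_size_ge1 : 1 <= M.
Proof using k1 kl m1.
apply: le_trans lattice_size_ge; rewrite exprn_ege1// ler1n; exact: m1.
Qed.

(** The factor [M] in the exponent cancels the [1 / M] in the error of the balancing constant,
    leaving [L]. A second [L] comes from the ratio itself, and each of the two zeta parameters
    contributes at most [cz]. *)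
Lemma tau_log i : (1 <= i < N)%N ->
  0 < tau D i /\ `|ln (r0 / tau D i) - M * beta| <= 2 * L + 2 * cz.
Proof using k1 kl m1 ratio_ln ratio2 zetab.
have M1 := lattice_size_ge1.
move=> iN; have M0 : 0 < M by rewrite (lt_le_trans ltr01).
have cz0 : 0 <= cz := le_trans (normr_ge0 _) (zetab 0).
have [w0 wL] := ratio_ln iN.
have L0 : 0 <= L by exact: le_trans wL.
have t1E : tau1 D = r0 * expR (zeta D 1 - M / (4 * pi) * (1 - waist_ratio D 2 / 2)).
  by rewrite /tau1 /hole_radius expRD mulNr; ring.
have pn : pi != 0 :> R := lt0r_neq0 p0.
have Mn := lt0r_neq0 M0.
have H1 : `|M / (4 * pi) * (1 - waist_ratio D 2 / 2) - M * beta| <= L.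
  have -> : M / (4 * pi) * (1 - waist_ratio D 2 / 2) - M * beta =
      M / (8 * pi) * (d2 - waist_ratio D 2).
    by rewrite /conductance_rate; move: (pi : R) pn => x xn; field.
  rewrite normrM distrC gtr0_norm ?divr_gt0 ?mulr_gt0//.
  have -> : L = M / (8 * pi) * (8 * pi / M * L).
    by move: (pi : R) (M) pn Mn => x y xn yn; field; rewrite xn yn.
  by rewrite ler_pM2l// divr_gt0 ?mulr_gt0.
have z1 := zetab 1.
rewrite /tau; case: eqP => [_|_].
  rewrite t1E; split; first by rewrite mulr_gt0 ?expR_gt0.
  rewrite invfM mulrA divff ?gt_eqF// mul1r -expRN expRK.
  set q := M / _ * _ in H1 *; set s := zeta D 1 in z1 *.
  have -> : - (s - q) - M * beta = (q - M * beta) - s by ring.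
  by apply: le_trans (ler_normB _ _) _; lra.
have wE : waist_ratio D i = expR (ln (waist_ratio D i)) by rewrite lnK// posrE.
have zi : `|zeta D i / M| <= cz.
  rewrite normrM normfV (gtr0_norm M0) ler_pdivrMr//.
  apply: le_trans (zetab i) _; rewrite ler_peMr//.
rewrite t1E {1 2}wE; split; first by rewrite !mulr_gt0 ?expR_gt0.
set q := M / _ * _ in H1 *; set s := zeta D 1 in z1 *.
set x := ln _ in wL *; set y := zeta D i / M in zi *.
have -> : r0 / (expR y * expR x * (r0 * expR (s - q))) = expR (q - s - y - x).
  have -> : expR y * expR x * (r0 * expR (s - q)) = r0 * expR (- (q - s - y - x)).
    by rewrite mulrCA -!expRD; congr (_ * expR _); ring.
  by rewrite invfM mulrA divff ?gt_eqF// mul1r expRN invrK.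
rewrite expRK.
have -> : q - s - y - x - M * beta = (q - M * beta) - s - (y + x) by ring.
apply: le_trans (ler_normB _ _) _.
have := ler_normB (q - M * beta) s; have := ler_normD y x; lra.
Qed.

Notation K1 := (2 * L + 2 * cz).

(** The quotient of conductances is [M * beta / a] with [a] the neck length. The extra [1] beside
    [K1] is a bound for [ln 2], and the size condition gives [a >= M * beta / 2], whence a relative
    error of order [1 / M]. *)
Lemma conductance_near i : (1 <= i < N)%N -> 2 * (K1 + 1) <= M * beta ->
  `|conductance D i / (8 * pi ^+ 2 / (2 - d2)) - 1| <= 2 * (K1 + 1) / beta / (mm D)%:R ^+ 2.
Proof.
move=> iN big; have [t0 tE] := tau_log iN; have b0 := conductance_rate_gt0.
have M1 := lattice_size_ge1.
have M0 : 0 < M by rewrite (lt_le_trans ltr01).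
have K0 : 0 <= K1 by apply: le_trans tE.
set E := ln _ in tE.
have E0 : 0 <= E by move: tE; rewrite ler_norml => /andP[h _]; lra.
have x1 : 1 <= r0 / tau D i.
  by rewrite -(@lnK _ (r0 / tau D i)) ?posrE ?divr_gt0// -expR0 ler_expR.
have a1 := ler_ln_arcosh x1; have a2 := ler_arcosh_ln x1.
rewrite lnM ?posrE ?divr_gt0// in a2.
have ln2 : ln 2 <= 1 :> R by have := @le_ln1Dx R 1; rewrite -[1 + 1]/(2 : R); apply; lra.
rewrite -/E in a1 a2; rewrite /conductance -/(neck_length D i) /neck_length.
set a := arcosh _ in a1 a2 *.
have aM : `|a - M * beta| <= K1 + 1.
  by move: tE; rewrite !ler_norml => /andP[h1 h2]; apply/andP; split; lra.
have ab : M * beta / 2 <= a by move: aM; rewrite ler_norml => /andP[h1 h2]; lra.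
have Mb : 0 < M * beta by rewrite mulr_gt0.
have a0 : 0 < a by apply: lt_le_trans ab; rewrite divr_gt0.
have -> : M * pi / a / (8 * pi ^+ 2 / (2 - d2)) - 1 = (M * beta - a) / a.
  have dn : 2 - d2 != 0 by rewrite gt_eqF// subr_gt0.
  have pn : pi != 0 :> R := lt0r_neq0 p0.
  have an := lt0r_neq0 a0.
  rewrite /conductance_rate; move: (pi : R) (M) a pn an {aM ab a0 a1 a2 Mb} => x y a xn an.
  by field; rewrite dn xn an.
rewrite normrM normfV (gtr0_norm a0) distrC ler_pdivrMr//.
have m0 : 0 < (mm D)%:R ^+ 2 :> R by rewrite exprn_gt0// ltr0n.
apply: le_trans aM _.
have h : 1 <= 2 / beta / (mm D)%:R ^+ 2 * a.
  apply: (@le_trans _ _ (2 / beta / (mm D)%:R ^+ 2 * (M * beta / 2))).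
    have -> : 2 / beta / (mm D)%:R ^+ 2 * (M * beta / 2) = M / (mm D)%:R ^+ 2.
      by field; rewrite !gt_eqF// ltr0n.
    by rewrite ler_pdivlMr// mul1r lattice_size_ge.
  rewrite ler_pM2l//; apply: divr_gt0 => //; exact: divr_gt0.
have K1p : 0 <= K1 + 1 by rewrite addr_ge0.
have := ler_wpM2l K1p h; rewrite mulr1; set K := K1 + 1.
by move=> /le_trans; apply; rewrite le_eqVlt; apply/orP; left; apply/eqP; ring.
Qed.

(** Slopes are divided by [r0], which shrinks with [m], so heights and neck sizes are first bounded
    by [r0] times a small quantity. With [y = m^2 * beta / 2] the small quantities are
    [24 * Ch / beta / y] for the heights and [18 / y] for the neck; [12 / y] bounds
    [2 * tau / r0]. *)
Lemma waist_small (Ch P : R) : 0 <= Ch -> 0 <= P ->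
  2 * (K1 + 1) <= M * beta -> 1 <= (mm D)%:R ^+ 2 * beta / 2 ->
  forall i j, (1 <= i < N)%N -> (1 < N)%N ->
  `|torus_height D j| <= Ch * (mm D)%:R ^+ 2 * tau1 D ->
  `|neck_height D i| <= Ch * (mm D)%:R ^+ 2 * tau1 D ->
  let d := ((24 * Ch / beta + 18) * (P + 1) + 12) * (2 / beta) / (mm D)%:R ^+ 2 in
  [/\ 0 < tau D i, 2 * tau D i <= r0,
      (height_gap D i j + neck_size D i) * P / r0 + 2 * tau D i / r0 <= d &
      height_gap D i j + neck_size D i <= d].
Proof.
move=> C0 P0 big y1 i j iN N1 hj hi d.
have b0 := conductance_rate_gt0.
have m0 : 0 < (mm D)%:R ^+ 2 :> R by rewrite exprn_gt0// ltr0n.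
set y := (mm D)%:R ^+ 2 * beta / 2 in y1.
have y0 : 0 < y by rewrite (lt_le_trans ltr01).
have size_E i' : (1 <= i' < N)%N -> exists2 E, y <= E & tau D i' = r0 * expR (- E).
  move=> iN'; have [t0 tE] := tau_log iN'; exists (ln (r0 / tau D i')).
    have := ler_pM2r b0 ((mm D)%:R ^+ 2) M; rewrite lattice_size_ge => h.
    by move: tE; rewrite ler_norml => /andP[h1 h2]; rewrite /y; lra.
  rewrite expRN lnK ?posrE ?divr_gt0// invf_div mulrC divfK// gt_eqF//.
(* Exponential decay is weakened to [6 / y] through [E^3 / 6 <= expR E]; the spare powers of [E]
   absorb the logarithm in [neck_size] and the factor [m^2] in the heights. *)
have expb E : y <= E -> expR (- E) <= 6 / y /\ E * expR (- E) <= 6 / y.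
  move=> yE; have E1 : 1 <= E by exact: le_trans yE.
  have E0 : 0 < E by rewrite (lt_le_trans ltr01).
  have e3 : E ^+ 3 / 6 <= expR E.
    apply: le_trans (expR_ge1Dxn 2 (ltW E0)); rewrite -[3`!]/6%N; lra.
  have h1 : expR (- E) <= 6 / E ^+ 3.
    by rewrite ler_pdivlMr ?exprn_gt0// expRN mulrC ler_pdivrMr ?expR_gt0//; lra.
  have E3 : E <= E ^+ 3 by rewrite -[leLHS]expr1 ler_weXn2l.
  have E2 : E <= E ^+ 2 by rewrite -[leLHS]expr1 ler_weXn2l.
  have yE' : E^-1 <= y^-1 by rewrite lef_pV2 ?posrE.
  split.
    apply: le_trans h1 _; rewrite ler_pM2l//; apply: le_trans yE'.
    by rewrite lef_pV2 ?posrE ?exprn_gt0.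
  apply: (@le_trans _ _ (6 / E ^+ 2)).
    apply: le_trans (ler_wpM2l (ltW E0) h1) _.
    by rewrite le_eqVlt; apply/orP; left; apply/eqP; field; rewrite gt_eqF.
  rewrite ler_pM2l//; apply: le_trans yE'.
  by rewrite lef_pV2 ?posrE ?exprn_gt0.
have [E yE tE] := size_E i iN.
have [F yF tF] := size_E 1%N N1.
have [e1 e2] := expb E yE; have [f1 f2] := expb F yF.
have E1 : 1 <= E by exact: le_trans yE.
have eE := expR_gt0 (- E); have eF := expR_gt0 (- F).
have t1E : tau1 D = r0 * expR (- F) by rewrite -tF.
have r01 := hole_radius_le1 k1 kl m1.
have gapb : height_gap D i j <= r0 * (24 * Ch / beta / y).
  apply: (@le_trans _ _ (2 * (Ch * (mm D)%:R ^+ 2 * tau1 D))).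
    by rewrite /height_gap; lra.
  have -> : 2 * (Ch * (mm D)%:R ^+ 2 * tau1 D) = r0 * (4 * Ch / beta) * (y * expR (- F)).
    by rewrite t1E /y; field; rewrite gt_eqF.
  have -> : r0 * (24 * Ch / beta / y) = r0 * (4 * Ch / beta) * (6 / y) by ring.
  rewrite ler_wpM2l//.
    by rewrite mulr_ge0 ?(ltW r0p)// divr_ge0 ?(ltW b0)// mulr_ge0.
  by apply: le_trans f2; rewrite ler_wpM2r// ltW.
have neckb : neck_size D i <= r0 * (18 / y).
  rewrite /neck_size tE.
  have -> : 4 * r0 / (r0 * expR (- E)) = 4 * expR E.
    by rewrite expRN; field; rewrite !gt_eqF// expR_gt0.
  rewrite lnM ?posrE ?expR_gt0// expRK -mulrA ler_pM2l//.
  have ln2 : ln 2 <= 1 :> R by have := @le_ln1Dx R 1; rewrite -[1 + 1]/(2 : R); apply; lra.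
  have ln4 : ln 4 <= 2 :> R.
    have -> : 4 = 2 * 2 :> R by ring.
    by rewrite lnM ?posrE//; lra.
  have := ler_wpM2l (ltW eE) ln4; lra.
set Q := 24 * Ch / beta in gapb d *.
have Q0 : 0 <= Q by rewrite divr_ge0 ?(ltW b0)// mulr_ge0.
have dE : d = ((Q + 18) * (P + 1) + 12) / y.
  rewrite /d /y; have un := lt0r_neq0 m0; have vn := lt0r_neq0 b0.
  move: (Q) ((mm D)%:R ^+ 2 : R) beta un vn => q u v un vn.
  by field; rewrite un vn.
have yi : 0 < y^-1 by rewrite invr_gt0.
have sum : height_gap D i j + neck_size D i <= r0 * ((Q + 18) / y).
  by apply: le_trans (lerD gapb neckb) _; rewrite -mulrDr -mulrDl.
have Qy : 0 <= (Q + 18) / y by rewrite divr_ge0 ?addr_ge0 ?(ltW y0).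
rewrite dE; split.
- by rewrite tE mulr_gt0.
- rewrite tE mulrCA -[leRHS]mulr1 ler_pM2l//.
  have : expR 1 <= expR E by rewrite ler_expR.
  have := @expR_ge1Dx R 1 => h1 h2.
  by rewrite expRN ler_pdivrMr ?expR_gt0// mul1r; lra.
- have -> : 2 * tau D i / r0 = 2 * expR (- E) by rewrite tE; field; rewrite gt_eqF.
  have h : (height_gap D i j + neck_size D i) * P / r0 <= (Q + 18) / y * P.
    rewrite ler_pdivrMr//; apply: le_trans (ler_wpM2r P0 sum) _.
    by rewrite le_eqVlt; apply/orP; left; apply/eqP; ring.
  have -> : ((Q + 18) * (P + 1) + 12) / y = (Q + 18) / y * P + (Q + 18) / y + 2 * (6 / y) by ring.
  by lra.
- have -> : ((Q + 18) * (P + 1) + 12) / y = (Q + 18) / y + ((Q + 18) / y * P + 2 * (6 / y)) by ring.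
  have : r0 * ((Q + 18) / y) <= (Q + 18) / y by rewrite ler_piMl.
  have : 0 <= (Q + 18) / y * P by rewrite mulr_ge0.
  have : 0 < 6 / y by rewrite divr_gt0.
  lra.
Qed.

End Waists.

(** * Uniform estimates in [m] and the limit of large [N] *)

Section Asymptotics.
Variable R : realType.

Lemma ler_norm_between (x y z : R) : x <= y -> y <= z -> `|y| <= `|x| + `|z|.
Proof.
move=> xy yz; have := ler_norm z; have := ler_norm (- x); rewrite normrN.
have := normr_ge0 x; have := normr_ge0 z.
by move=> h1 h2 h3 h4; rewrite ler_norml; apply/andP; split; lra.
Qed.

(** Convergence to positive limits traps the ratios of the lower half between half and twice their
    limits, and symmetry covers the rest. This bounds all logarithms by one [L], and
    [balanced_defect] then applies with [eps = 8 * pi / M]. *)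
Lemma waist_ratio_estimate N k l (b : nat -> nat -> R) : (2 <= N)%N -> waist_ratios N k l b ->
  exists L : R, \forall m \near \oo,
    (forall i, (1 <= i < N)%N -> 0 < b m i /\ `|ln (b m i)| <= L) /\
    `|b m 2%N - limiting_ratio R N 2| <= 8 * pi / (k * l * m ^ 2)%:R * L.
Proof.
move=> N2 [nb h4]; have [[d1 dN2 dN3 _] _] := @limiting_ratioP R N N2.
have [N4|N4] := ltnP N 4.
  exists 0; near=> m; have [b1 bN2 bN3 _] := nb m.
  have [NE|N3] := eqVneq N 2%N.
    split; last by rewrite bN2// dN2// subrr normr0 mulr0.
    move=> i iN; have -> : i = 1%N by lia.
    by rewrite b1 ln1 normr0.
  have NE : N = 3%N by lia.
  split; last by rewrite bN3// dN3// subrr normr0 mulr0.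
  move=> i iN; have [->|->] : i = 1%N \/ i = 2%N by lia.
    by rewrite b1 ln1 normr0.
  by rewrite bN3// ln1 normr0.
have [bal cv] := h4 N4; pose d := limiting_ratio R N.
pose L := \sum_(i < N) (`|ln (d i / 2)| + `|ln (2 * d i)|).
have d_gt0 i : (0 < i < N)%N -> 0 < d i by move=> iN; exact: limiting_ratio_gt0.
exists L; near=> m; have [b1 _ _ bs] := nb m.
have close : forall i : 'I_N, (0 < i <= N./2)%N -> d i / 2 <= b m i <= 2 * d i.
  near: m; apply: filter_forall => i.
  have [iN|iN] := boolP (0 < i <= N./2)%N; last by near=> m => //; rewrite (negbTE iN).
  have di := d_gt0 i ltac:(have := ltn_ord i; lia).
  have [i1|i1] := eqVneq (i : nat) 1%N.
    near=> m => _; have [b1 _ _ _] := nb m; rewrite i1 b1 /d d1; apply/andP; split; lra.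
  have e0 : 0 < d i / 2 by rewrite divr_gt0.
  have := cv i ltac:(lia) ltac:(lia) => /cvgrPdist_lt /(_ _ e0).
  apply: filterS => m' + _; rewrite -/d ltr_norml => /andP[h1 h2]; apply/andP; split; lra.
have half i : (N./2 < i)%N -> (0 < i < N)%N -> [/\ (i <= N.-1)%N, (N - i <= N./2)%N & (0 < N - i < N)%N].
  by clear; move=> h /andP[h0 h1]; split; lia.
have est i : (0 < i < N)%N -> 0 < b m i /\ `|ln (b m i)| <= L.
  wlog iN2 : i / (i <= N./2)%N.
    move=> H iN; have [iN2|iN2] := leqP i N./2; first exact: H.
    by have [h1 h2 h3] := half i iN2 iN; rewrite (bs i iN2 h1); exact: H.
  move=> iN; have /andP[i0 iN'] := iN.
  have di := d_gt0 i iN.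
  have i0N : (0 < Ordinal iN' <= N./2)%N by rewrite /= i0.
  have /andP[/= h1 h2] := close (Ordinal iN') i0N.
  have bp : 0 < b m i by apply: lt_le_trans h1; rewrite divr_gt0.
  split=> //.
  apply: (@le_trans _ _ (`|ln (d i / 2)| + `|ln (2 * d i)|)).
    have l1 : ln (d i / 2) <= ln (b m i) by rewrite ler_ln ?posrE ?divr_gt0.
    have l2 : ln (b m i) <= ln (2 * d i) by rewrite ler_ln ?posrE ?mulr_gt0.
    exact: ler_norm_between.
  by rewrite /L (bigD1 (Ordinal iN'))//= lerDl sumr_ge0// => j _; rewrite addr_ge0.
split=> //.
rewrite limiting_ratio2//; apply: (balanced_defect N4) => //.
- by rewrite divr_ge0// mulr_ge0// pi_ge0.
- by near: m.
- by move=> i iN; case: (est i iN).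
- by move=> i iN; case: (est i iN).
Unshelve. all: by end_near. Qed.

Lemma quadratic_cos (x : R) : `|2 - 2 * cos x - x ^+ 2| <= x ^+ 4 / 12.
Proof.
have h1 := cos_ge_quadratic x; have h2 := cos_le_quartic x.
have x4 : 0 <= x ^+ 4 by rewrite (_ : x ^+ 4 = (x ^+ 2) ^+ 2) ?sqr_ge0//; ring.
by rewrite ler_norml; apply/andP; split; lra.
Qed.

(** With [x = pi / N] and [lm = 2 - 2 * cos x], Taylor gives an error [x^4 / 12] in [lm]; for the
    reciprocals it is divided by [lm * x^2 >= x^4 / 2], which gives [1 / 6]. The constant is the sum
    of both bounds. *)
Lemma large_N_asymptotics : exists (K : R) (N0 : nat), forall N, (N0 <= N)%N ->
  `|lambda1 (path_laplacian R N) - pi ^+ 2 / N%:R ^+ 2| <= K / N%:R ^+ 4 /\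
  `|limit_conductance R N - 8 * N%:R ^+ 2| <= K.
Proof.
exists (pi ^+ 4 / 12 + 8 * pi ^+ 2 / 6), 2%N => N N2.
have p0 := pi_gt0 R; have p2 : 0 <= pi ^+ 2 :> R by exact: sqr_ge0.
have p4 : 0 <= pi ^+ 4 :> R by rewrite (_ : pi ^+ 4 = (pi ^+ 2) ^+ 2) ?sqr_ge0//; ring.
have N0 : 0 < N%:R :> R by rewrite ltr0n; lia.
have N4 : 0 < N%:R ^+ 4 :> R by rewrite exprn_gt0.
rewrite /limit_conductance limiting_ratio2// lambda1_path//.
have Q := quadratic_cos (pi / N%:R).
have lam := lambda_gt0 R N2.
set x := pi / N%:R in Q lam *; set lm := 2 - 2 * cos x in Q lam *.
have x0 : 0 < x by rewrite divr_gt0.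
have x2 : x ^+ 2 = pi ^+ 2 / N%:R ^+ 2 by rewrite /x expr_div_n.
have x4 : x ^+ 4 = pi ^+ 4 / N%:R ^+ 4 by rewrite /x expr_div_n.
split.
  rewrite -x2; apply: le_trans Q _; rewrite x4 mulrAC ler_pM2r ?invr_gt0//.
  by rewrite lerDl divr_ge0// mulr_ge0.
have xs : x ^+ 2 <= 4.
  have x2' : x <= 2.
    rewrite /x ler_pdivrMr//; have := pihalf_lt2 R; rewrite ltr_pdivrMr// => h.
    have : 2%:R <= N%:R :> R by rewrite ler_nat.
    by lra.
  nra.
have x20 : 0 < x ^+ 2 by rewrite exprn_gt0.
have x44 : x ^+ 4 = x ^+ 2 * x ^+ 2 by ring.
have lmx : x ^+ 2 / 2 <= lm.
  move: Q; rewrite ler_norml x44 => /andP[h1 h2].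
  have : x ^+ 2 * x ^+ 2 <= 4 * x ^+ 2 by rewrite ler_pM2r.
  lra.
have NE : 8 * N%:R ^+ 2 = 8 * pi ^+ 2 / x ^+ 2 :> R.
  by rewrite x2; move: (pi : R) (N%:R : R) (lt0r_neq0 p0) (lt0r_neq0 N0) => q n qn nn; field; rewrite qn nn.
rewrite NE.
have -> : 8 * pi ^+ 2 / lm - 8 * pi ^+ 2 / x ^+ 2 = 8 * pi ^+ 2 * ((x ^+ 2 - lm) / (lm * x ^+ 2)).
  move: (pi : R) lm lam {Q lmx} => q lm lam.
  by field; rewrite (lt0r_neq0 lam) (lt0r_neq0 x0).
have P8 : 0 <= 8 * pi ^+ 2 :> R by rewrite mulr_ge0.
rewrite normrM (ger0_norm P8).
apply: (@le_trans _ _ (8 * pi ^+ 2 * (1 / 6))); last first.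
  have : 0 <= pi ^+ 4 / 12 :> R by rewrite divr_ge0.
  lra.
have lx0 : 0 < lm * x ^+ 2 by exact: mulr_gt0.
rewrite ler_wpM2l// normrM normfV distrC (gtr0_norm lx0) ler_pdivrMr//.
apply: le_trans Q _; rewrite x44.
have : x ^+ 2 / 2 * x ^+ 2 <= lm * x ^+ 2 by rewrite ler_pM2r.
lra.
Qed.

Lemma conductance_lambda1 N : (2 <= N)%N ->
  limit_conductance R N / (2 * pi ^+ 2) * lambda1 (path_laplacian R N) = 4.
Proof.
move=> N2; rewrite /limit_conductance limiting_ratio2// lambda1_path//.
have p0 := lt0r_neq0 (pi_gt0 R); have lam := lt0r_neq0 (lambda_gt0 R N2).
move: (pi : R) (2 - 2 * cos _) p0 lam => q lm q0 lm0.
by field; rewrite q0 lm0.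
Qed.

Lemma near_ge_nat (A : R) : \forall m \near \oo, A <= m%:R.
Proof. by near=> m; near: m; exact: nbhs_infty_ger. Unshelve. all: by end_near. Qed.

Lemma le_invsqr (A : R) (m : nat) : (1 <= m)%N -> A <= m%:R -> A / m%:R ^+ 2 <= 1.
Proof.
move=> m1 Am; have m1' : 1 <= m%:R :> R by rewrite ler1n.
have m0 : 0 < m%:R ^+ 2 :> R by rewrite exprn_gt0// (lt_le_trans ltr01).
rewrite ler_pdivrMr// mul1r; apply: le_trans Am _.
by rewrite -[leLHS]expr1 ler_weXn2l.
Qed.

Lemma stacked_torus_estimates (psi : R -> R) (b : nat -> nat -> nat -> nat -> nat -> R)
  (c C : nat -> nat -> nat -> R) (zT zK : prescription R) (N k l : nat) :
  cutoff psi -> heights_bounded psi b c C zT zK ->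
  (2 <= N)%N -> (1 <= k)%N -> (k <= l)%N -> waist_ratios N k l (b N k l) ->
  exists (K : R) (m0 : nat), forall m, (1 <= m)%N -> (m0 <= m)%N ->
  forall ze xi : nat -> R,
  bounded_by (c N k l) ze -> bounded_by (c N k l) xi ->
  let D := prescribed_data psi b zT zK N k l m ze xi in
  forall Sigma Psi, stacked_clifford_torus D Sigma Psi ->
    (forall i, (1 <= i <= N.-1)%N ->
       `|conductance D i / limit_conductance R N - 1| <= K / m%:R ^+ 2) /\
    (exists mu : R,
       is_lowest_rayleigh N (filled_area D Psi) (conductance D) mu /\
       `|mu - 4| <= K / m%:R ^+ 2).
Proof.
move=> hpsi hz N2 k1 kl wr.
have [L nearL] := waist_ratio_estimate N2 wr.
have nearz := hz N k l N2 k1 kl.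
have [P P0 dP] := cutoff_derive_bound hpsi.
have lam := lambda_gt0 R N2; have d2E := limiting_ratio2 R N2.
set d2 := limiting_ratio R N 2 in d2E nearL.
have d2lt : d2 < 2 by rewrite d2E -subr_gt0.
set cz := c N k l in nearz *; pose Ch := `|C N k l|.
pose beta := conductance_rate d2; have b0 : 0 < beta := conductance_rate_gt0 d2lt.
pose K1 := 2 * L + 2 * cz.
pose K2 := ((24 * Ch / beta + 18) * (P + 1) + 12) * (2 / beta).
(* Common constant for conductances and areas: in the second summand [1] is the metric pinching and
   [18 * K2] comes from the graphs, with [d ^+ 2 <= d]. *)
pose K3 := 2 * (K1 + 1) / beta + (1 + 18 * K2).
have C0 : 0 <= Ch by exact: normr_ge0.
have K20 : 0 <= K2.
  apply: mulr_ge0; last by rewrite divr_ge0// ltW.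
  apply: addr_ge0 => //; apply: mulr_ge0; last exact: addr_ge0.
  by apply: addr_ge0 => //; apply: divr_ge0 (ltW b0); exact: mulr_ge0.
(* The summands secure in turn [2 * (K1 + 1) <= m^2 * beta], [1 <= m^2 * beta / 2], [d <= 1 / 6] and
   [del <= 1 / 2]. *)
pose big := 2 * `|K1 + 1| / beta + 2 / beta + 6 * K2 + 2 * `|K3|.
have [m0 _ H] : \forall m \near \oo, [/\ big <= m%:R,
    (forall i, (1 <= i < N)%N -> 0 < b N k l m i /\ `|ln (b N k l m i)| <= L) /\
     `|b N k l m 2%N - d2| <= 8 * pi / (k * l * m ^ 2)%:R * L &
    forall ze xi : nat -> R, bounded_by cz ze -> bounded_by cz xi ->
    let D := prescribed_data psi b zT zK N k l m ze xi in
    (forall j, (1 <= j <= N)%N ->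
       `|torus_height D j| <= C N k l * m%:R ^+ 2 * tau1 D) /\
    (forall i, (1 <= i < N)%N ->
       `|neck_height D i| <= C N k l * m%:R ^+ 2 * tau1 D)].
  near=> m; split; [near: m; exact: near_ge_nat | by near: m | by near: m].
(* The factor [16] is [4 * l] in [lowest_rayleigh_near] at the unperturbed value [l = 4]. *)
exists (16 * `|K3|), m0 => m m1 mm0 ze xi zeb xib D Sigma Psi torus.
have [bigm [ratio ratio2] heights] := H m mm0.
have [hT hK] := heights ze xi zeb xib; rewrite -/D in hT hK.
have K10 : 0 <= `|K1 + 1| by exact: normr_ge0.
have bb0 : 0 <= 2 * `|K1 + 1| / beta by rewrite divr_ge0 ?(ltW b0)// mulr_ge0.
have bb1 : 0 <= 2 / beta by rewrite divr_ge0 ?(ltW b0).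
have m1' : 1 <= m%:R :> R by rewrite ler1n.
have msq : 0 < m%:R ^+ 2 :> R by rewrite exprn_gt0// (lt_le_trans ltr01).
have mm2 : m%:R <= m%:R ^+ 2 :> R by rewrite -[leLHS]expr1 ler_weXn2l.
have K30 : 0 <= `|K3| by exact: normr_ge0.
have big1 : 2 * (K1 + 1) <= m%:R ^+ 2 * beta.
  rewrite -ler_pdivrMr//; apply: le_trans mm2; apply: le_trans bigm.
  apply: (@le_trans _ _ (2 * `|K1 + 1| / beta)).
    by rewrite ler_pM2r ?invr_gt0// ler_pM2l// ler_norm.
  by rewrite /big; lra.
have big2 : 1 <= m%:R ^+ 2 * beta / 2.
  have : 2 / beta <= m%:R ^+ 2 by apply: le_trans mm2; apply: le_trans bigm; rewrite /big; lra.
  by rewrite ler_pdivrMr// => h; lra.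
have sizeM : m%:R ^+ 2 * beta <= (lattice_size D)%:R * beta.
  by rewrite ler_pM2r//; exact: (@lattice_size_ge R D k1 kl m1).
have big1' := le_trans big1 sizeM.
have cond i : (1 <= i < N)%N ->
    `|conductance D i / limit_conductance R N - 1| <= 2 * (K1 + 1) / beta / m%:R ^+ 2.
  by move=> iN; exact: (@conductance_near R D L cz d2 k1 kl m1 ratio ratio2 zeb d2lt i iN big1').
pose d := K2 / m%:R ^+ 2.
have d0 : 0 <= d <= 1 / 6.
  rewrite divr_ge0 ?(ltW msq)//=; have : 6 * K2 / m%:R ^+ 2 <= 1.
    by apply: le_invsqr => //; apply: le_trans bigm; rewrite /big; lra.
  by rewrite /d; lra.
have [dd0 dd1] := andP d0.
have smallness j : (1 <= j <= N)%N -> forall i, (1 <= i < N)%N ->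
    [/\ 0 < tau D i, 2 * tau D i <= hole_radius D,
      (height_gap D i j + neck_size D i) * P / hole_radius D + 2 * tau D i / hole_radius D <= d &
      height_gap D i j + neck_size D i <= d].
  move=> jN i iN.
  have [t0 _] := @tau_log R D L cz d2 k1 kl m1 ratio ratio2 zeb 1%N N2.
  rewrite /tau eqxx in t0.
  have Cle x : x <= C N k l * m%:R ^+ 2 * tau1 D -> x <= Ch * m%:R ^+ 2 * tau1 D.
    move=> /le_trans; apply; rewrite ler_pM2r// ler_pM2r//; exact: ler_norm.
  exact: (@waist_small R D L cz d2 k1 kl m1 ratio ratio2 zeb d2lt Ch P C0 P0 big1' big2 i j iN N2
    (Cle _ (hT j jN)) (Cle _ (hK i iN))).
have dle : d ^+ 2 <= d.
  by rewrite expr2 ler_piMl//; apply: le_trans dd1 _; rewrite ler_pdivrMr// mul1r ler1n.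
have area j : (1 <= j <= N)%N ->
    `|filled_area D Psi j - 2 * pi ^+ 2| <= (1 + 18 * K2) / m%:R ^+ 2 * (2 * pi ^+ 2).
  move=> jN; have sm := smallness j jN.
  have zd : `|torus_height D j| <= d.
    have [t0 t1 _ gap] := sm 1%N N2.
    apply: le_trans gap; rewrite /height_gap -addrA lerDl addr_ge0//.
    rewrite /neck_size mulr_ge0 ?(ltW t0)// ln_ge0// ler_pdivlMr//; lra.
  have := @filled_area_near R D hpsi N2 k1 kl m1 Sigma Psi torus j P d jN P0 d0 dP zd sm.
  move=> /le_trans; apply; rewrite ler_wpM2r//.
    by rewrite mulr_ge0// sqr_ge0.
  have -> : (1 + 18 * K2) / m%:R ^+ 2 = (m%:R ^+ 2)^-1 + 18 * d.
    by rewrite /d mulrDl mul1r mulrA.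
  by apply: lerD => //; rewrite ler_pM2l.
have dl (x : R) : x <= K3 -> x / m%:R ^+ 2 <= `|K3| / m%:R ^+ 2.
  by move=> xK; rewrite ler_pM2r ?invr_gt0//; apply: le_trans xK _; exact: ler_norm.
have cpos : 0 <= 2 * (K1 + 1) / beta.
  have N1 : (1 <= 1 < N)%N by [].
  have := le_trans (normr_ge0 _) (cond 1%N N1).
  by rewrite pmulr_lge0 ?invr_gt0.
pose del := `|K3| / m%:R ^+ 2.
have del1 : 2 * del <= 1.
  by rewrite /del mulrA; apply: le_invsqr => //; apply: le_trans bigm; rewrite /big; lra.
have del0 : 0 <= del by rewrite divr_ge0// ltW.
have cond' i : (1 <= i < N)%N -> `|conductance D i / limit_conductance R N - 1| <= del.
  move=> iN; apply: le_trans (cond i iN) _; apply: dl.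
  by rewrite /K3 lerDl addr_ge0// mulr_ge0.
have area' j : (1 <= j <= N)%N -> `|filled_area D Psi j - 2 * pi ^+ 2| <= del * (2 * pi ^+ 2).
  move=> jN; apply: le_trans (area j jN) _; rewrite ler_wpM2r//.
    by rewrite mulr_ge0// sqr_ge0.
  by apply: dl; rewrite /K3 lerDr.
have p20 : 0 < 2 * pi ^+ 2 :> R by rewrite mulr_gt0// exprn_gt0// pi_gt0.
have lc0 : 0 < limit_conductance R N.
  by rewrite /limit_conductance divr_gt0 ?subr_gt0// mulr_gt0// exprn_gt0// pi_gt0.
have E16 : 16 * `|K3| / m%:R ^+ 2 = 16 * del by rewrite mulrA.
split.
  move=> i iN; have iN' : (1 <= i < N)%N by move: iN N2; case: (N) => // N' /andP[-> ?].
  by rewrite E16; apply: le_trans (cond' i iN') _; rewrite ler_peMl// ler1n.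
have Apos j : (1 <= j <= N)%N -> 0 < filled_area D Psi j.
  move=> /area'; rewrite ler_norml => /andP[h _].
  have : del * (2 * pi ^+ 2) <= 1 / 2 * (2 * pi ^+ 2).
    by rewrite ler_pM2r// ler_pdivlMr// mulrC.
  by move: h p20; clear; move: (_ * (_ ^+ 2)) => x; lra.
have [mu low] := lowest_rayleigh_exists (conductance D) N2 Apos.
exists mu; split => //.
have del01 : 0 <= del <= 1 / 2 by rewrite del0 ler_pdivlMr// mulrC.
have condk i : (1 <= i < N)%N ->
    `|conductance D i - limit_conductance R N| <= del * limit_conductance R N.
  move=> iN; have := cond' i iN.
  have -> : conductance D i / limit_conductance R N - 1 =
      (conductance D i - limit_conductance R N) / limit_conductance R N.
    by rewrite mulrBl divff// gt_eqF.
  by rewrite normrM normfV (gtr0_norm lc0) ler_pdivrMr.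
have four : 4 = limit_conductance R N / (2 * pi ^+ 2) * (2 - 2 * cos (pi / N%:R)).
  by rewrite -lambda1_path// conductance_lambda1.
have := lowest_rayleigh_near N2 four p20 lc0 del01 area' condk low.
by rewrite E16 => /le_trans; apply; lra.
Unshelve. all: by end_near. Qed.

End Asymptotics.

Theorem theoremB (R : realType)
  (psi : R -> R) (b : nat -> nat -> nat -> nat -> nat -> R)
  (c C : nat -> nat -> nat -> R) (zT zK : prescription R)
  (hpsi : cutoff psi)
  (hb : forall N k l, (2 <= N)%N -> (1 <= k)%N -> (k <= l)%N ->
          waist_ratios N k l (b N k l))
  (hz : heights_bounded psi b c C zT zK) :
  (* (i) *)
  (forall N, (2 <= N)%N ->
     [/\ (forall i, (1 <= i <= N.-1)%N ->
            limiting_ratio R N i = sin (i%:R * pi / N%:R) / sin (pi / N%:R)),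
         limiting_ratio R N 2 = 2 * cos (pi / N%:R),
         is_greatest (spectrum (path_adjacency R N.-1)) (limiting_ratio R N 2),
         is_least [set a | spectrum (path_laplacian R N) a /\ a != 0]
           (lambda1 (path_laplacian R N)) &
         lambda1 (path_laplacian R N) = 2 - limiting_ratio R N 2]) /\
  (* (ii) *)
  ((forall N k l, (2 <= N)%N -> (1 <= k)%N -> (k <= l)%N ->
      exists (K : R) (m0 : nat), forall m, (1 <= m)%N -> (m0 <= m)%N ->
      forall ze xi : nat -> R,
      bounded_by (c N k l) ze -> bounded_by (c N k l) xi ->
      let D := prescribed_data psi b zT zK N k l m ze xi in
      forall Sigma Psi, stacked_clifford_torus D Sigma Psi ->
        (forall i, (1 <= i <= N.-1)%N ->
           `|conductance D i / limit_conductance R N - 1| <= K / m%:R ^+ 2) /\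
        (exists mu : R,
           is_lowest_rayleigh N (filled_area D Psi) (conductance D) mu /\
           `|mu - 4| <= K / m%:R ^+ 2)) /\
   (forall N, (2 <= N)%N ->
      limit_conductance R N / (2 * pi ^+ 2) * lambda1 (path_laplacian R N) = 4)) /\
  (* (iii) *)
  (exists (K : R) (N0 : nat), forall N, (N0 <= N)%N ->
     `|lambda1 (path_laplacian R N) - pi ^+ 2 / N%:R ^+ 2| <= K / N%:R ^+ 4 /\
     `|limit_conductance R N - 8 * N%:R ^+ 2| <= K).
Proof.
split; [|split; [split|]].
- move=> N N2; split.
  + by move=> i iN; exact: limiting_ratioE.
  + exact: limiting_ratio2.
  + by rewrite limiting_ratio2//; exact: cos_pi_is_greatest.
  + exact: lambda1_is_least.
  + by rewrite limiting_ratio2// lambda1_path.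
- by move=> N k l N2 k1 kl; exact: (stacked_torus_estimates hpsi hz N2 k1 kl (hb N k l N2 k1 kl)).
- by move=> N N2; exact: conductance_lambda1.
- exact: large_N_asymptotics.
Qed.
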